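(* Let $0<d_1,d_2<1/2$ and let $X=\{X(t,s);(t,s)\in\mathbb{Z}^2\}$ be a stationary Gaussian random field with zero mean and spectral density $$f(x,y)=\frac{g(x,y)}{|x|^{2d_1}|y|^{2d_2}},\qquad (x,y)\in[-\pi,\pi]^2,$$ where $g\ge0$ is a bounded function such that $\lim_{x,y\to0}g(x,y)=1$. Then for any $\gamma>0$, as $n\to\infty$, in the sense of weak convergence of finite-dimensional distributions, $$n^{-H(\gamma)}\sum_{1\le t\le nx,\ 1\le s\le n^{\gamma}y}X(t,s)\ \longrightarrow\ \kappa(d_1)\kappa(d_2)\,B_{d_1+\frac12,\,d_2+\frac12}(x,y),\qquad (x,y)\in\mathbb{R}^2_+,$$ where $H(\gamma):=(1+\gamma)/2+d_1+d_2\gamma$, $B_{d_1+\frac12,d_2+\frac12}$ is a fractional Brownian sheet, and $\kappa(d)>0$ is given by $$\kappa^2(d):=\int_{\mathbb{R}}|1-e^{\mathrm{i}x}|^2|x|^{-2-2d}\,dx=\frac{\pi}{(d+\frac12)\,\Gamma(2d+1)\cos(\pi d)}.$$ As a consequence, $X$ does not exhibit scaling transition for any $0<d_1,d_2<1/2$.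
   Context: Notation: $\mathbb{R}^2_+=\{(x,y):x>0,y>0\}$, $\bar{\mathbb{R}}^2_+=\{(x,y):x\ge0,y\ge0\}$. ''fdd'' means finite-dimensional distributions. Random fields (RFs) are real-valued. A stationary zero-mean RF $X$ on $\mathbb{Z}^2$ has spectral density $f$ (nonnegative, even, integrable on $[-\pi,\pi]^2$) if $\mathrm{E}[X(0,0)X(t,s)]=\int_{[-\pi,\pi]^2}e^{\mathrm{i}(tu+sv)}f(u,v)\,du\,dv$ for all $(t,s)\in\mathbb{Z}^2$. **Fractional Brownian sheet.** For $0<\mathcal{H}_1,\mathcal{H}_2\le1$, $B_{\mathcal{H}_1,\mathcal{H}_2}$ is the zero-mean Gaussian process on $\bar{\mathbb{R}}^2_+$ with $\mathrm{E}[B_{\mathcal{H}_1,\mathcal{H}_2}(x,y)B_{\mathcal{H}_1,\mathcal{H}_2}(x',y')]=\tfrac14(x^{2\mathcal{H}_1}+x'^{2\mathcal{H}_1}-|x-x'|^{2\mathcal{H}_1})(y^{2\mathcal{H}_2}+y'^{2\mathcal{H}_2}-|y-y'|^{2\mathcal{H}_2})$. **Scaling transition.** Let $X$ be a stationary RF on $\mathbb{Z}^2$ such that for every $\gamma>0$ there are a normalization $A_n(\gamma)\to\infty$ and a nontrivial RF $V_\gamma$ with $A_n^{-1}(\gamma)\sum_{1\le t\le nx,\,1\le s\le n^\gamma y}X(t,s)\to V_\gamma(x,y)$, $(x,y)\in\mathbb{R}^2_+$, in the sense of fdd. $X$ exhibits scaling transition if there exist $\gamma_0>0$ and RFs $V_+,V_-$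 such that $V_\gamma$ has the same fdd as $V_+$ for all $\gamma>\gamma_0$, the same fdd as $V_-$ for all $\gamma<\gamma_0$, and for no $a>0$ do $V_+$ and $aV_-$ have the same fdd. *)

(* Defs.v *)
From HB Require Import structures.
From mathcomp Require Import all_boot all_order all_algebra complex.
From mathcomp Require Import all_classical all_reals all_analysis.
From mathcomp Require Import measurable_realfun.

Set Implicit Arguments.
Unset Strict Implicit.
Unset Printing Implicit Defensive.

Import Order.TTheory GRing.Theory Num.Theory.
Import numFieldNormedType.Exports.

Local Open Scope classical_set_scope.
Local Open Scope ring_scope.

(* A real-valued random field indexed by I, together with the probability space
   carrying it: fields compared in law may live on different spaces. *)
Record random_field (R : realType) (I : Type) := RandomField {
  rf_display : measure_display;
  rf_space : measurableType rf_display;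
  rf_prob : probability rf_space R;
  rf_val :> I -> rf_space -> R;
  rf_measurable : forall i : I, measurable_fun [set: rf_space] (rf_val i)
}.

Definition rf_vector (R : realType) (I : Type) (Y : random_field R I)
    (k : nat) (p : 'I_k -> I) (w : rf_space Y) : 'rV[R]_k :=
  \row_(j < k) Y (p j) w.

Definition rf_reindex (R : realType) (I J : Type) (h : J -> I)
    (Y : random_field R I) : random_field R J :=
  @RandomField R J _ _ (rf_prob Y) (fun j => Y (h j))
    (fun j => @rf_measurable R I Y (h j)).

Lemma rf_scale_measurable (R : realType) (I : Type) (a : R)
    (Y : random_field R I) (i : I) :
  measurable_fun [set: rf_space Y] (fun w => a * Y i w).
Proof. by apply: measurable_funM => //; exact: rf_measurable. Qed.

Definition rf_scale (R : realType) (I : Type) (a : R)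
    (Y : random_field R I) : random_field R I :=
  @RandomField R I _ _ (rf_prob Y) (fun i w => a * Y i w)
    (@rf_scale_measurable R I a Y).

(* <<s open >> is the Borel sigma-algebra of R^k. *)
Definition same_fdd (R : realType) (I : Type) (Y Z : random_field R I) : Prop :=
  forall (k : nat) (p : 'I_k -> I) (A : set 'rV[R]_k),
    <<s [set U : set 'rV[R]_k | open U] >> A ->
    rf_prob Y (@rf_vector R I Y k p @^-1` A) =
    rf_prob Z (@rf_vector R I Z k p @^-1` A).

Definition fdd_cvg (R : realType) (I : Type) (Y : nat -> random_field R I)
    (Z : random_field R I) : Prop :=
  forall (k : nat) (p : 'I_k -> I) (phi : 'rV[R]_k -> R),
    continuous phi -> bounded_fun phi ->
    ('E_(rf_prob (Y n))[phi \o @rf_vector R I (Y n) k p] @[n --> \oo] -->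
     'E_(rf_prob Z)[phi \o @rf_vector R I Z k p])%E.

Definition zero_mean (R : realType) (I : Type) (Y : random_field R I) : Prop :=
  forall i : I, ('E_(rf_prob Y)[Y i] = 0)%E.

(* Constants count as (degenerate) normal variables; they need a separate clause
   because normal_prob m 0 is not the Dirac measure at m. *)
Definition normal_rv (R : realType) (d : measure_display) (T : measurableType d)
    (P : probability T R) (Y : T -> R) : Prop :=
  exists m s : R,
    forall A : set (measurableTypeR R), measurable A ->
      pushforward P Y A = if s == 0 then \d_m A else normal_prob m s A.

Definition gaussian (R : realType) (I : Type) (Y : random_field R I) : Prop :=
  forall (k : nat) (p : 'I_k -> I) (a : 'I_k -> R),
    normal_rv (rf_prob Y) (fun w => \sum_(j < k) a j * Y (p j) w).

Definition stationary (R : realType) (X : random_field R (int * int)) : Prop :=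
  forall h : int * int, same_fdd (rf_reindex (fun t => t + h) X) X.

Definition expi (R : realType) (x : R) : R[i] := (cos x +i* sin x)%C.

Definition Cintegral (R : realType) (d : measure_display) (T : measurableType d)
    (mu : {measure set T -> \bar R}) (D : set T) (F : T -> R[i]) : R[i] :=
  ((\int[mu]_(z in D) complex.Re (F z)) +i* (\int[mu]_(z in D) complex.Im (F z)))%C.

Definition lebesgue2 (R : realType) :
    {measure set (measurableTypeR R * measurableTypeR R) -> \bar R} :=
  (@lebesgue_measure R \x @lebesgue_measure R)%E.

Definition torus (R : realType) : set (R * R) := `[- pi, pi] `*` `[- pi, pi].

Definition spectral_density (R : realType) (X : random_field R (int * int))
    (f : R * R -> R) : Prop :=
  [/\ forall z, torus z -> 0 <= f z,
      forall z, torus z -> f (- z) = f z,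
      (@lebesgue2 R).-integrable (@torus R) (EFin \o f) &
      forall t s : int, exists2 c : R,
        'E_(rf_prob X)[fun w => (X (0, 0) w * X (t, s) w)%R]%E = c%:E &
        (c%:C)%C = Cintegral (@lebesgue2 R) (@torus R)
          (fun z => expi (t%:~R * z.1 + s%:~R * z.2) * ((f z)%:C)%C)].

Definition open_quadrant (R : realType) : Type := ({posnum R} * {posnum R})%type.

Definition closed_quadrant (R : realType) : Type :=
  ({nonneg R} * {nonneg R})%type.

Definition quadrant_incl (R : realType) (p : open_quadrant R) :
    closed_quadrant R :=
  (p.1%:num%:nng, p.2%:num%:nng).

Definition fractional_brownian_sheet (R : realType) (H1 H2 : R)
    (B : random_field R (closed_quadrant R)) : Prop :=
  [/\ gaussian B, zero_mean B &
      forall p q : closed_quadrant R,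
        let x := p.1%:num in let y := p.2%:num in
        let x' := q.1%:num in let y' := q.2%:num in
        'E_(rf_prob B)[fun w => (B p w * B q w)%R]%E =
        (4^-1 * (x `^ (2 * H1) + x' `^ (2 * H1) - `|x - x'| `^ (2 * H1))
              * (y `^ (2 * H2) + y' `^ (2 * H2) - `|y - y'| `^ (2 * H2)))%:E].

(* For r >= 0, the integers t with 1 <= t <= r are those with
   1 <= t <= Num.truncn r. *)
Definition partial_sum_val (R : realType) (X : random_field R (int * int))
    (gamma : R) (n : nat) (p : open_quadrant R) (w : rf_space X) : R :=
  \sum_(1 <= t < (Num.truncn (n%:R * p.1%:num)).+1)
    \sum_(1 <= s < (Num.truncn (n%:R `^ gamma * p.2%:num)).+1)
      X (t%:Z, s%:Z) w.

Lemma partial_sum_measurable (R : realType) (X : random_field R (int * int))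
    (gamma : R) (n : nat) (p : open_quadrant R) :
  measurable_fun [set: rf_space X] (@partial_sum_val R X gamma n p).
Proof.
by apply: measurable_sum => t; apply: measurable_sum => s; exact: rf_measurable.
Qed.

Definition partial_sum (R : realType) (X : random_field R (int * int))
    (gamma : R) (n : nat) : random_field R (open_quadrant R) :=
  @RandomField R (open_quadrant R) _ _ (rf_prob X) (@partial_sum_val R X gamma n)
    (@partial_sum_measurable R X gamma n).

Definition nontrivial (R : realType) (I : Type) (V : random_field R I) : Prop :=
  ~ forall i : I, {ae rf_prob V, forall w, V i w = 0}.

Definition exhibits_scaling_transition (R : realType)
    (X : random_field R (int * int)) : Prop :=
  stationary X /\
  exists (A : R -> nat -> R) (V : R -> random_field R (open_quadrant R)),
    (forall gamma : R, 0 < gamma ->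
      [/\ A gamma n @[n --> \oo] --> +oo, nontrivial (V gamma) &
          fdd_cvg (fun n => rf_scale (A gamma n)^-1 (partial_sum X gamma n))
                  (V gamma)]) /\
    exists (gamma0 : R) (Vp Vm : random_field R (open_quadrant R)),
      [/\ 0 < gamma0,
          forall gamma, gamma0 < gamma -> same_fdd (V gamma) Vp,
          forall gamma, 0 < gamma < gamma0 -> same_fdd (V gamma) Vm &
          forall a : R, 0 < a -> ~ same_fdd Vp (rf_scale a Vm)].

(* The integrand is 0 at x = 0, since 0 `^ r = 0 for r != 0. *)
Definition kappa_sq (R : realType) (d : R) : \bar R :=
  (\int[@lebesgue_measure R]_x
     (ComplexField.Normc.normc (1 - expi x) ^+ 2 * `|x| `^ (- 2 - 2 * d))%:E)%E.

Definition kappa (R : realType) (d : R) : R := Num.sqrt (fine (kappa_sq d)).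

Definition Gamma (R : realType) (z : R) : R :=
  \int[@lebesgue_measure R]_(x in `]0, +oo[) (x `^ (z - 1) * expR (- x)).

(* Main.v *)
Require Import Defs.
From HB Require Import structures.
From mathcomp Require Import all_boot all_order all_algebra complex.
From mathcomp Require Import all_classical all_reals all_analysis.
From mathcomp Require Import measurable_realfun.
From mathcomp Require Import ring lra.

Set Implicit Arguments.
Unset Strict Implicit.
Unset Printing Implicit Defensive.

Import Order.TTheory GRing.Theory Num.Theory.
Import numFieldNormedType.Exports.

Local Open Scope classical_set_scope.
Local Open Scope ring_scope.

(** The partial sums of X are Gaussian, so the limit theorem reduces to the
    convergence of covariances, which are integrals of products of Dirichlet
    kernels against the spectral density.  For g = 1 the integral factorizes and
    polarization reduces each factor to
      N^(-1-2d) int_{-pi}^{pi} sin^2(m u/2) / sin^2(u/2) |u|^(-2d) du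
        --> x^(1+2d) kappa(d)^2     as m/N --> x,
    by rescaling and dominated convergence.  The contribution of g - 1 is
    negligible because the Fejer masses concentrate at the origin.  Since no
    Levy continuity theorem is used, convergence of covariances is turned into
    convergence in law by approximating test functions by trigonometric sums,
    through Bernstein polynomials in the variables (1 + sin (y_j / L)) / 2.

    The limit covariance does not depend on gamma.  If A_n^-1 S_n has a nontrivial
    limit V, then E exp (- (A_n^-1 S_n)^2 / 2) = (1 + A_n^-2 Var S_n)^(-1/2) converges,
    which forces A_n^-2 n^(2H) to converge to a positive limit; hence any two of the
    fields V_gamma agree in law up to a positive factor.

    The value of kappa^2 comes from Gamma(2d+2) kappa^2 = 4 int_0^oo t^(2d)/(1+t^2) dt
    (Tonelli) and from the alternating series of the latter integral, which is
    a Dirichlet-kernel expression for 1/cos (pi d). *)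

(** * The constant kappa *)

(** The hypothesis on [g] controls the density only near the origin, whereas the weight is singular
    along both axes. The error is therefore measured relative to the weight: it is small when both
    coordinates are small, and bounded on the two strips where one coordinate stays away from 0. On
    a strip, the kernel in the distant coordinate has a bounded mass, which the normalization sends
    to 0, while the normalized mass in the other coordinate converges. The density is even only
    under a change of sign of both coordinates, so the kernel factorizes only once the density is
    replaced by the weight, which is even in each variable. In the definition of scaling transition
    the normalizations and the limits are arbitrary, and fields may live on different spaces. Laws
    are therefore compared through expectations of bounded continuous functions: two Gaussian
    sequences with a common covariance limit have asymptotically equal expectations. This serves
    both the limit theorem, with a constant second sequence, and the comparison of two unknown
    limits. *)

Section lebesgue_scaling.
Context {R : realType}.
Local Notation mu := (@lebesgue_measure R).
Local Open Scope ereal_scope.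

(** [c] times the pushforward of Lebesgue measure under the affine map gives half-open intervals
    their length, and this determines it. *)
Lemma lebesgue_measure_affine (c b : R) (A : set R) : (0 < c)%R -> measurable A ->
  mu ((fun x => c * x + b)%R @^-1` A) = c^-1%:E * mu A.
Proof.
move=> c0 mA.
have cV0 : (0 <= c^-1)%R by rewrite invr_ge0 ltW.
have mc : measurable_fun [set: R] ((fun x => c * x + b)%R : R -> measurableTypeR R).
  by apply: measurable_funD => //; exact: measurable_funM.
pose nu : {measure set (measurableTypeR R) -> \bar R} :=
  mscale (NngNum (ltW c0))
    (pushforward mu ((fun x => c * x + b)%R : R -> measurableTypeR R)).
have : mu A = nu mc A.
  apply: lebesgue_measure_unique => //= _ [[u v]] _ <-.
  rewrite /nu /mscale /= /pushforward.
  have -> : (fun x => c * x + b)%R @^-1` `]u, v]%classic =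
      `](c^-1 * (u - b))%R, (c^-1 * (v - b))%R]%classic.
    apply/seteqP; split => x /=; rewrite !in_itv/= ltr_pdivrMl// ler_pdivlMl//;
      by rewrite ltrBlDr lerBrDr.
  rewrite !lebesgue_measure_itv/= !lte_fin ltr_pM2l ?invr_gt0// ltrD2r.
  case: ifPn => _; last by rewrite mule0.
  by rewrite -!EFinD -EFinM; congr EFin; field; rewrite gt_eqF.
move=> ->; rewrite /nu /mscale /= muleA -EFinM mulVf ?gt_eqF// mul1e.
by [].
Qed.

Lemma ge0_integral_affine (c b : R) (D : set R) (f : R -> \bar R) :
  (0 < c)%R -> measurable D -> measurable_fun D f -> (forall x, D x -> 0 <= f x) ->
  \int[mu]_(x in (fun x => c * x + b)%R @^-1` D) f (c * x + b)%R =
  c^-1%:E * \int[mu]_(x in D) f x.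
Proof.
move=> c0 mD mf f0.
have cV0 : (0 <= c^-1)%R by rewrite invr_ge0 ltW.
have mc : measurable_fun [set: R] ((fun x => c * x + b)%R : R -> measurableTypeR R).
  by apply: measurable_funD => //; exact: measurable_funM.
rewrite -[LHS](@ge0_integral_pushforward _ _ (measurableTypeR R) (measurableTypeR R) _
  (fun x => c * x + b)%R mc mu D f)//; last first.
  by move=> y; rewrite inE; exact: f0.
rewrite -(@ge0_integral_mscale _ _ _ mu D mD (NngNum cV0))//.
apply: eq_measure_integral => A mA AD.
exact: (lebesgue_measure_affine b c0 mA).
Qed.

Lemma ge0_integral_scale (c : R) (D : set R) (f : R -> \bar R) :
  (0 < c)%R -> measurable D -> measurable_fun D f -> (forall x, D x -> 0 <= f x) ->
  \int[mu]_(x in ( *%R c) @^-1` D) f (c * x)%R = c^-1%:E * \int[mu]_(x in D) f x.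
Proof.
move=> c0 mD mf f0; rewrite -(ge0_integral_affine 0 c0 mD mf f0).
have -> : ( *%R c) @^-1` D = (fun x => c * x + 0)%R @^-1` D.
  by apply/seteqP; split => x /=; rewrite addr0.
by apply: eq_integral => x _; rewrite addr0.
Qed.

Lemma ge0_integral_even (f : R -> \bar R) :
  measurable_fun [set: R] f -> (forall x, 0 <= f x) -> (forall x, f (- x)%R = f x) ->
  \int[mu]_x f x = 2%:E * \int[mu]_(x in `]0%R, +oo[) f x.
Proof.
move=> mf f0 fN.
rewrite -(setUv `]-oo, 0%R]%classic) ge0_integral_setU//=.
- rewrite setCitvl.
  rewrite mule_natl mule2n; congr (_ + _).
  rewrite integral_itv_obnd_cbnd; last exact: measurable_funTS.
  rewrite ge0_integration_by_substitution0//.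
  by apply: eq_integral => x _; rewrite fN.
- exact: measurableC.
- by rewrite setUv.
- exact/disj_setPCl.
Qed.

(** Extension of [f] by zero outside [A] times [B] reduces this to Tonelli on the whole plane. *)
Lemma tonelli_on (A B : set R) (f : R * R -> \bar R) :
  measurable A -> measurable B -> measurable_fun (A `*` B) f ->
  (forall z, (A `*` B) z -> 0 <= f z) ->
  \int[mu]_(x in A) \int[mu]_(y in B) f (x, y) =
  \int[mu]_(y in B) \int[mu]_(x in A) f (x, y).
Proof.
move=> mA mB mf f0.
have mAB : measurable (A `*` B) by exact: measurableX.
pose g := f \_ (A `*` B).
have mg : measurable_fun [set: R * R] g by apply/(measurable_restrictT _ _).1.
have g0 z : 0 <= g z.
  by rewrite /g patchE; case: ifPn => //; rewrite inE; exact: f0.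
have E1 : \int[mu]_(x in A) \int[mu]_(y in B) f (x, y) =
          \int[mu]_x \int[mu]_y g (x, y).
  rewrite integral_mkcond; apply: eq_integral => x _.
  rewrite patchE; case: ifPn => [xA|xA].
    rewrite integral_mkcond; apply: eq_integral => y _.
    by rewrite /g !patchE in_setX xA.
  by rewrite integral0_eq// => y _; rewrite /g patchE in_setX (negbTE xA).
have E2 : \int[mu]_(y in B) \int[mu]_(x in A) f (x, y) =
          \int[mu]_y \int[mu]_x g (x, y).
  rewrite integral_mkcond; apply: eq_integral => y _.
  rewrite patchE; case: ifPn => [yB|yB].
    rewrite integral_mkcond; apply: eq_integral => x _.
    by rewrite /g !patchE in_setX yB andbT.
  by rewrite integral0_eq// => x _; rewrite /g patchE in_setX (negbTE yB) andbF.
rewrite E1 E2.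
exact: (@fubini_tonelli _ _ _ _ _ mu mu g).
Qed.

End lebesgue_scaling.

(* A copy of [is_derive] at 1 that type class resolution does not see, so that
   [auto_is_derive] computes the derivative in a predictable form. *)
Definition deriv_at {R : realType} (f : R -> R) (x df : R) : Prop :=
  is_derive x 1 f df.

Section pointwise_derivatives.
Context {R : realType}.
Implicit Types (f g : R -> R) (x df dg : R).

Lemma deriv_at_eq f x df dg : deriv_at f x df -> df = dg -> is_derive x 1 f dg.
Proof. by move=> h <-. Qed.

Lemma deriv_at_cst (c : R) x : deriv_at (fun=> c) x 0.
Proof. exact: is_derive_cst. Qed.

Lemma deriv_at_id x : deriv_at (fun y => y) x 1.
Proof. exact: is_derive_id. Qed.

Lemma deriv_atD f g x df dg : deriv_at f x df -> deriv_at g x dg ->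
  deriv_at (fun y => f y + g y) x (df + dg).
Proof. by move=> fx gx; exact: (@is_deriveD _ _ _ f g x 1 df dg fx gx). Qed.

Lemma deriv_atB f g x df dg : deriv_at f x df -> deriv_at g x dg ->
  deriv_at (fun y => f y - g y) x (df - dg).
Proof. by move=> fx gx; exact: (@is_deriveB _ _ _ f g x 1 df dg fx gx). Qed.

Lemma deriv_atN f x df : deriv_at f x df -> deriv_at (fun y => - f y) x (- df).
Proof. by move=> fx; exact: (@is_deriveN _ _ _ f x 1 df fx). Qed.

Lemma deriv_atM f g x df dg : deriv_at f x df -> deriv_at g x dg ->
  deriv_at (fun y => f y * g y) x (df * g x + f x * dg).
Proof.
move=> fx gx; have fgx := @is_deriveM _ _ f g x 1 df dg fx gx.
by apply: (is_derive_eq fgx); rewrite addrC /GRing.scale /= (mulrC (g x)).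
Qed.

Lemma deriv_atX f n x df : deriv_at f x df ->
  deriv_at (fun y => f y ^+ n) x (n%:R * f x ^+ n.-1 * df).
Proof.
move=> fx; have := @is_deriveX _ _ f n x 1 df fx.
by rewrite /GRing.scale /= /deriv_at exprfctE.
Qed.

Lemma deriv_atV f x df : f x != 0 -> deriv_at f x df ->
  deriv_at (fun y => (f y)^-1) x (- df / f x ^+ 2).
Proof.
move=> fx0 fx; have fVx := @is_deriveV _ f x df 1 fx0 fx.
by apply: (is_derive_eq fVx); rewrite /GRing.scale /= !mulNr mulrC.
Qed.

Lemma deriv_at_sin f x df : deriv_at f x df ->
  deriv_at (fun y => sin (f y)) x (df * cos (f x)).
Proof.
move=> fx; have h := @is_derive1_comp _ sin f x (cos (f x)) df (is_derive_sin _) fx.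
by apply: (is_derive_eq h); rewrite mulrC.
Qed.

Lemma deriv_at_cos f x df : deriv_at f x df ->
  deriv_at (fun y => cos (f y)) x (- (df * sin (f x))).
Proof.
move=> fx; have h := @is_derive1_comp _ cos f x (- sin (f x)) df (is_derive_cos _) fx.
by apply: (is_derive_eq h); rewrite mulNr mulrC.
Qed.

Lemma deriv_at_expR f x df : deriv_at f x df ->
  deriv_at (fun y => expR (f y)) x (df * expR (f x)).
Proof.
move=> fx; have h := @is_derive1_comp _ expR f x (expR (f x)) df (is_derive_expR _) fx.
by apply: (is_derive_eq h); rewrite mulrC.
Qed.

Lemma deriv_at_continuous f x df : deriv_at f x df -> {for x, continuous f}.
Proof. by move=> [d _]; apply/differentiable_continuous/derivable1_diffP. Qed.

Lemma is_derive1_continuous f x df : is_derive x 1 f df -> {for x, continuous f}.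
Proof. exact: deriv_at_continuous. Qed.

End pointwise_derivatives.

(** Constants are tried before the arithmetic rules, so that a quotient by a constant leaves no side
    condition; a varying denominator leaves its nonvanishing as a goal. *)
Ltac deriv_at_rec := first
  [ eassumption | apply: deriv_at_cst | apply: deriv_at_id
  | apply: deriv_atD; deriv_at_rec | apply: deriv_atB; deriv_at_rec
  | apply: deriv_atN; deriv_at_rec | apply: deriv_atM; deriv_at_rec
  | apply: deriv_atX; deriv_at_rec
  | apply: deriv_at_sin; deriv_at_rec | apply: deriv_at_cos; deriv_at_rec
  | apply: deriv_at_expR; deriv_at_rec
  | apply: deriv_atV; [|deriv_at_rec] ].
Ltac auto_is_derive := apply: deriv_at_eq; [deriv_at_rec|..]; cbv beta.
Ltac auto_continuous := apply: deriv_at_continuous; deriv_at_rec.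

Section calculus.
Context {R : realType}.
Local Notation mu := (@lebesgue_measure R).

Lemma continuous_at_within (f : R -> R) (a b : R) :
  (forall x, a <= x <= b -> {for x, continuous f}) ->
  {within `[a, b], continuous f}.
Proof.
by move=> cf; apply: continuous_in_subspaceT => x; rewrite inE/= in_itv/=; exact: cf.
Qed.

Lemma integrable_continuous_itv (f : R -> R) (a b : R) :
  (forall x, a <= x <= b -> {for x, continuous f}) ->
  mu.-integrable `[a, b] (EFin \o f).
Proof.
move=> cf; apply: continuous_compact_integrable; first exact: segment_compact.
exact: continuous_at_within.
Qed.

Lemma integral_FTC (F f : R -> R) (a b : R) : a < b ->
  (forall x, a <= x <= b -> is_derive x 1 F (f x)) ->
  (forall x, a <= x <= b -> {for x, continuous f}) ->
  (\int[mu]_(x in `[a, b]) (f x)%:E = (F b - F a)%:E)%E.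
Proof.
move=> ab dF cf.
have cF x : a <= x <= b -> F y @[y --> x] --> F x.
  by move=> /dF; exact: is_derive1_continuous.
rewrite (@continuous_FTC2 _ f F) ?EFinB//.
- exact: continuous_at_within.
- split.
  + by move=> x; rewrite in_itv/= => /andP[/ltW ax /ltW xb]; have [] := dF x _; rewrite ?ax.
  + by apply: cvg_at_right_filter; apply: cF; rewrite lexx ltW.
  + by apply: cvg_at_left_filter; apply: cF; rewrite lexx ltW.
- move=> x; rewrite in_itv/= => /andP[/ltW ax /ltW xb].
  by rewrite derive1E; have [] := dF x _; rewrite ?ax.
Qed.

Lemma Rintegral_FTC (F f : R -> R) (a b : R) : a < b ->
  (forall x, a <= x <= b -> is_derive x 1 F (f x)) ->
  (forall x, a <= x <= b -> {for x, continuous f}) ->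
  \int[mu]_(x in `[a, b]) f x = F b - F a.
Proof. by move=> ab dF cf; rewrite /Rintegral (integral_FTC ab dF cf). Qed.

Lemma normr_cosB1_le (x : R) : `|cos x - 1| <= `|x|.
Proof.
wlog x0 : x / 0 <= x.
  move=> h; have [|/ltW x0] := leP 0 x; first exact: h.
  by rewrite -cosN -(normrN x) h// oppr_ge0.
have [|c _] := @MVT_segment R cos (fun x => - sin x) 0 x x0.
  exact/continuous_subspaceT/continuous_cos.
by rewrite cos0 !subr0 => ->; rewrite normrM normrN ler_piMl// sin_max.
Qed.

(** A weak form of Jordan's inequality. On [[0, 1]] the mean value theorem gives the slope [cos 1];
    on [[1, pi / 2]] the sine is at least [sin 1] while [x <= 2]. *)
Lemma sin_ge_linear : exists2 c : R, 0 < c &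
  forall x : R, 0 <= x <= pi / 2 -> c * x <= sin x.
Proof.
have c1 := @cos1_gt0 R.
have p2 : 1 <= pi / 2 :> R := pihalf_ge1 R.
have p2' : pi / 2 < 2 :> R := pihalf_lt2 R.
have s1 : 0 < sin 1 :> R by apply: sin2_gt0; lra.
exists (Num.min (cos 1) (sin 1 / 2)) => [|x /andP[x0 xp]].
  by rewrite lt_min c1 divr_gt0.
have [x1|x1] := leP x 1.
  have [|c] := @MVT_segment R sin cos 0 x x0.
      exact/continuous_subspaceT/continuous_sin.
  rewrite sin0 !subr0 in_itv/= => /andP[c0 cx] ->.
  apply: ler_wpM2r => //; apply: (@le_trans _ _ (cos 1)).
    by rewrite ge_min lexx.
  have [->|/eqP c1'] := eqVneq c 1; first by [].
  apply/ltW; rewrite ltr_cos ?in_itv/= ?c0 ?ler01//=.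
  - by rewrite lt_neqAle; apply/andP; split; [exact/eqP|exact: le_trans x1].
  - by apply: (le_trans cx); apply: (le_trans xp); lra.
  - lra.
apply: (@le_trans _ _ (sin 1)).
  apply: (@le_trans _ _ (sin 1 / 2 * x)).
    by apply: ler_wpM2r => //; rewrite ge_min lexx orbT.
  have : x <= 2 by lra.
  nra.
apply/ltW; rewrite ltr_sin// in_itv/= ?xp ?p2 !andbT; lra.
Qed.

End calculus.

(** * Odd Dirichlet kernel and the partial fractions of the secant *)

Section euler_integral.
Context {R : realType}.
Local Notation mu := (@lebesgue_measure R).

(** Taken with alternating signs, the terms of the partial fraction expansion of pi / (2 cos (pi a /
    2)). *)
Definition odd_recip (a : R) (k : nat) : R :=
  (k.*2.+1%:R + a)^-1 + (k.*2.+1%:R - a)^-1.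

(** The Dirichlet kernel on odd frequencies, equal to sin (2 n x) / sin x away from the zeros of the
    sine. *)
Definition cos_odd_sum (n : nat) (x : R) : R :=
  \sum_(k < n) 2 * cos (k.*2.+1%:R * x).

Lemma sin_cos_odd_sum n x : sin x * cos_odd_sum n x = sin (n.*2%:R * x).
Proof.
elim: n => [|n IH]; first by rewrite /cos_odd_sum big_ord0 mulr0 mul0r sin0.
rewrite /cos_odd_sum big_ord_recr/= mulrDr -/(cos_odd_sum n x) IH.
have -> : n.+1.*2%:R * x = n.*2.+1%:R * x + x by rewrite doubleS -[n.*2.+2]addn1 natrD; ring.
have -> : n.*2%:R * x = n.*2.+1%:R * x - x by rewrite -[n.*2.+1]addn1 natrD; ring.
by rewrite sinB sinD; ring.
Qed.

Lemma sin_odd_pihalf k : sin (k.*2.+1%:R * (pi / 2)) = (-1) ^+ k :> R.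
Proof.
elim: k => [|k IH]; first by rewrite mul1r expr0 sin_pihalf.
have -> : k.+1.*2.+1%:R * (pi / 2) = k.*2.+1%:R * (pi / 2) + pi :> R.
  by rewrite doubleS -[k.*2.+3]addn2 natrD; field.
by rewrite sinDpi IH exprS mulN1r.
Qed.

Lemma cos_odd_pihalf k : cos (k.*2.+1%:R * (pi / 2)) = 0 :> R.
Proof.
elim: k => [|k IH]; first by rewrite mul1r cos_pihalf.
have -> : k.+1.*2.+1%:R * (pi / 2) = k.*2.+1%:R * (pi / 2) + pi :> R.
  by rewrite doubleS -[k.*2.+3]addn2 natrD; field.
by rewrite cosDpi IH oppr0.
Qed.

Lemma continuous_cosM (a : R) : continuous (fun x : R => cos (a * x)).
Proof. by move=> x; auto_continuous. Qed.

Lemma continuous_cos_odd_sum n : continuous (cos_odd_sum n).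
Proof.
rewrite /cos_odd_sum => x; elim: n => [|n IH].
  by under eq_fun do rewrite big_ord0; exact: cvg_cst.
under eq_fun do rewrite big_ord_recr/=.
by apply: cvgD => //; apply: cvgM; [exact: cvg_cst|exact: continuous_cosM].
Qed.

Lemma odd_denominators_neq0 (a : R) (k : nat) : `|a| < 1 ->
  k.*2.+1%:R + a != 0 /\ k.*2.+1%:R - a != 0.
Proof.
rewrite ltr_norml => /andP[a1 a2].
have : 1 <= k.*2.+1%:R :> R by rewrite ler1n.
by move=> h; split; rewrite gt_eqF//; lra.
Qed.

Lemma Rintegral_cos_cos_odd (a : R) (k : nat) : `|a| < 1 ->
  \int[mu]_(x in `[0, pi / 2]) (cos (a * x) * (2 * cos (k.*2.+1%:R * x))) =
  (-1) ^+ k * cos (a * (pi / 2)) * odd_recip a k.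
Proof.
move=> a1; have [p0 m0] := odd_denominators_neq0 k a1.
set p := k.*2.+1%:R in p0 m0 *.
pose F (x : R) := sin ((p + a) * x) / (p + a) + sin ((p - a) * x) / (p - a).
transitivity (F (pi / 2) - F 0); first apply: Rintegral_FTC.
- by rewrite divr_gt0// pi_gt0.
- move=> x _; rewrite /F; auto_is_derive.
  have -> : (p + a) * x = p * x + a * x by ring.
  have -> : (p - a) * x = p * x - a * x by ring.
  rewrite cosB cosD.
  by clearbody p; field; rewrite m0 p0.
- by move=> x _; auto_continuous.
- rewrite /F !mulr0 sin0 !mul0r addr0 subr0 /odd_recip -/p.
  rewrite mulrDl mulrBl sinB sinD /p sin_odd_pihalf cos_odd_pihalf.
  by rewrite !mul0r subr0 addr0; ring.
Qed.

Lemma Rintegral_cos_cos_odd_sum (a : R) (n : nat) : `|a| < 1 ->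
  \int[mu]_(x in `[0, pi / 2]) (cos (a * x) * cos_odd_sum n x) =
  cos (a * (pi / 2)) * \sum_(k < n) (-1) ^+ k * odd_recip a k.
Proof.
move=> a1; elim: n => [|n IH].
  rewrite big_ord0 mulr0; under eq_Rintegral do rewrite /cos_odd_sum big_ord0 mulr0.
  by rewrite Rintegral_cst// mul0r.
rewrite big_ord_recr/= mulrDr -IH.
transitivity (\int[mu]_(x in `[0, pi / 2])
    (cos (a * x) * cos_odd_sum n x + cos (a * x) * (2 * cos (n.*2.+1%:R * x)))).
  by apply: eq_Rintegral => x _; rewrite /cos_odd_sum big_ord_recr/= mulrDr.
rewrite RintegralD//; last 2 first.
- apply: integrable_continuous_itv => x _; apply: cvgM; first exact: continuous_cosM.
  exact: continuous_cos_odd_sum.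
- apply: integrable_continuous_itv => x _.
  by auto_continuous.
by congr (_ + _); rewrite Rintegral_cos_cos_odd//; ring.
Qed.

Lemma Rintegral_itv_split (f : R -> R) (a b c : R) : a <= b <= c ->
  (forall x, a <= x <= c -> {for x, continuous f}) ->
  \int[mu]_(x in `[a, c]) f x =
  \int[mu]_(x in `[a, b]) f x + \int[mu]_(x in `[b, c]) f x.
Proof.
move=> /andP[ab bc] cf.
apply/eqP; rewrite addrC -subr_eq.
rewrite (@Rintegral_itvB _ f (BLeft a) (BRight c) b) ?bnd_simp//; last first.
  exact: integrable_continuous_itv.
rewrite Rintegral_itv_obnd_cbnd//.
apply: (integrableS _ _ _ (integrable_continuous_itv cf)) => //.
by apply: subset_itvr; rewrite bnd_simp.
Qed.

Lemma normr_Rintegral_le (f : R -> R) (a b M : R) : a <= b ->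
  (forall x, a <= x <= b -> {for x, continuous f}) ->
  (forall x, a <= x <= b -> `|f x| <= M) ->
  `|\int[mu]_(x in `[a, b]) f x| <= M * (b - a).
Proof.
move=> ab cf fM.
have If := integrable_continuous_itv cf.
apply: (le_trans (le_normr_Rintegral _ If)) => //.
apply: (@le_trans _ _ (\int[mu]_(x in `[a, b]) M)).
  apply: le_Rintegral => //.
  - exact: integrable_norm.
  - by apply: integrable_continuous_itv => x _; exact: cvg_cst.
rewrite Rintegral_cst//=.
suff -> : fine (mu `[a, b]) = b - a by [].
rewrite lebesgue_measure_itv/= lte_fin.
by case: ltgtP ab => //= -> _; rewrite subrr.
Qed.

(* A Riemann-Lebesgue argument: the integrand is [h x * sin (2 n x)] with
   [h x = (cos (a x) - 1) / sin x] bounded, and smooth away from 0. *)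
Lemma cvg_Rintegral_cosB1_odd_sum (a : R) : `|a| < 1 ->
  \int[mu]_(x in `[0, pi / 2]) ((cos (a * x) - 1) * cos_odd_sum n x)
    @[n --> \oo] --> 0.
Proof.
move=> a1; have [c c0 sinc] := @sin_ge_linear R.
have p0 : 0 < pi / 2 :> R by rewrite divr_gt0// pi_gt0.
pose G n (x : R) := (cos (a * x) - 1) * cos_odd_sum n x.
have cG n (x : R) : {for x, continuous (G n)}.
  apply: cvgM; last exact: continuous_cos_odd_sum.
  by apply: cvgB; [exact: continuous_cosM|exact: cvg_cst].
have cosax (x : R) : 0 <= x -> `|cos (a * x) - 1| <= x.
  move=> x0; apply: (le_trans (normr_cosB1_le _)).
  by rewrite normrM (ger0_norm x0) ler_piMl// ltW.
have sin0x (x : R) : 0 < x <= pi / 2 -> 0 < sin x.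
  move=> /andP[x0 xp]; apply: (@lt_le_trans _ _ (c * x)); first by rewrite mulr_gt0.
  by apply: sinc; rewrite (ltW x0).
have GE n (x : R) : 0 < x <= pi / 2 -> G n x = (cos (a * x) - 1) / sin x * sin (n.*2%:R * x).
  move=> x0; rewrite -sin_cos_odd_sum /G mulrA divfK// gt_eqF//.
  exact: sin0x.
have hb (x : R) : 0 < x <= pi / 2 -> `|(cos (a * x) - 1) / sin x| <= c^-1.
  move=> x0p; have /andP[x0 xp] := x0p; have s0 := sin0x _ x0p.
  rewrite normrM normfV (gtr0_norm s0) ler_pdivrMr// ler_pdivlMl//.
  apply: le_trans (sinc x _); last by rewrite ltW.
  by rewrite ler_wpM2l ?(ltW c0)// cosax// ltW.
have Gb n (x : R) : 0 <= x <= pi / 2 -> `|G n x| <= c^-1.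
  move=> /andP[]; rewrite le_eqVlt => /predU1P[<- _|x0 xp].
    by rewrite /G mulr0 cos0 subrr mul0r normr0 invr_ge0 ltW.
  have x0p : 0 < x <= pi / 2 by rewrite x0.
  rewrite GE// normrM; apply: le_trans (hb x x0p).
  by rewrite ler_piMr// sin_max.
pose h (x : R) : R := (cos (a * x) - 1) / sin x.
pose h' (x : R) : R := - (a * sin (a * x)) / sin x +
   (cos (a * x) - 1) * (- cos x / sin x ^+ 2).
have dh (x : R) : 0 < x <= pi / 2 -> is_derive x 1 h (h' x).
  move=> x0p; have s0 : sin x != 0 by rewrite gt_eqF// sin0x.
  by rewrite /h; auto_is_derive => //; rewrite /h'; field.
have tail (e : R) : 0 < e < pi / 2 -> exists C : R, forall n, (0 < n)%N ->
    `|\int[mu]_(x in `[e, pi / 2]) G n x| <= C / n%:R.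
  move=> /andP[e0 ep].
  pose M := 1 / (c * e) + pi / 2 / (c * e) ^+ 2.
  (* Integration by parts leaves two boundary terms, each at most [c^-1 / n%:R], and the integral of
     [h'], bounded by [M], against a primitive of size at most [n%:R^-1]. *)
  exists (2 / c + M * (pi / 2 - e)) => n n0.
  have n20 : 0 < n.*2%:R :> R by rewrite ltr0n double_gt0.
  have xe (x : R) : e <= x <= pi / 2 -> 0 < x <= pi / 2.
    by move=> /andP[ex ->]; rewrite (lt_le_trans e0).
  have sine (x : R) : e <= x <= pi / 2 -> c * e <= sin x.
    move=> /andP[ex xp]; apply: (@le_trans _ _ (c * x)).
      by rewrite ler_wpM2l// ltW.
    by apply: sinc; rewrite xp (le_trans (ltW e0)).
  have h'b (x : R) : e <= x <= pi / 2 -> `|h' x| <= M.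
    move=> exp; have se := sine _ exp; have ce0 : 0 < c * e by rewrite mulr_gt0.
    have s0 : 0 < sin x by exact: lt_le_trans se.
    have x0 : 0 <= x by move/xe : exp => /andP[/ltW].
    rewrite /h' (le_trans (ler_normD _ _))// lerD//.
      rewrite normrM normrN normfV (gtr0_norm s0) ler_pM//.
      - by rewrite invr_ge0 ltW.
      - by rewrite normrM mulr_ile1// ?sin_max// ltW.
      - by rewrite lef_pV2.
    rewrite !normrM normrN normfV normrX (gtr0_norm s0) ler_pM//.
    - by rewrite mulr_ge0// invr_ge0 exprn_ge0// ltW.
    - by apply: (le_trans (cosax x x0)); move: exp => /andP[].
    - rewrite -[leRHS]mul1r ler_pM ?cos_max// ?invr_ge0 ?exprn_ge0 ?(ltW s0)//.
      by rewrite lef_pV2 ?posrE ?exprn_gt0// lerXn2r// nnegrE ltW.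
  pose F (x : R) := h x * (- cos (n.*2%:R * x) / n.*2%:R).
  pose E (x : R) := h' x * (- cos (n.*2%:R * x) / n.*2%:R).
  have ch (x : R) : e <= x <= pi / 2 -> {for x, continuous h}.
    by move=> exp; apply: is_derive1_continuous; apply: dh; exact: xe.
  have ch' (x : R) : e <= x <= pi / 2 -> {for x, continuous h'}.
    move=> exp; have s0 : sin x != 0 by rewrite gt_eqF// sin0x// xe.
    by rewrite /h'; auto_continuous => //; rewrite expf_neq0.
  have cc (x : R) : {for x, continuous (fun x : R => - cos (n.*2%:R * x) / n.*2%:R)}.
    by auto_continuous.
  have cE (x : R) : e <= x <= pi / 2 -> {for x, continuous E}.
    by move=> exp; apply: cvgM; [exact: ch'|exact: cc].
  have -> : \int[mu]_(x in `[e, pi / 2]) G n x =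
      F (pi / 2) - F e - \int[mu]_(x in `[e, pi / 2]) E x.
    have <- : \int[mu]_(x in `[e, pi / 2]) (E x + G n x) = F (pi / 2) - F e.
      apply: Rintegral_FTC => //; last first.
        by move=> x exp; apply: cvgD; [exact: cE|exact: cG].
      move=> x exp; have dhx : deriv_at h x (h' x) := dh _ (xe _ exp).
      rewrite /F; auto_is_derive.
      rewrite /E GE ?xe// -/(h x); congr (_ + _ * _).
      by field; rewrite gt_eqF.
    rewrite RintegralD//; first by rewrite addrAC subrr add0r.
      exact: integrable_continuous_itv.
    by apply: integrable_continuous_itv => x _; exact: cG.
  have cosb (x : R) : `|- cos (n.*2%:R * x) / n.*2%:R| <= n%:R^-1.
    rewrite normrM normrN normfV (gtr0_norm n20) -[leRHS]mul1r ler_pM ?cos_max//.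
    by rewrite lef_pV2 ?posrE ?ltr0n ?double_gt0// ler_nat -addnn leq_addr.
  have Fb (x : R) : e <= x <= pi / 2 -> `|F x| <= c^-1 / n%:R.
    move=> exp; rewrite /F normrM ler_pM// hb//; exact: xe.
  have Eb (x : R) : e <= x <= pi / 2 -> `|E x| <= M / n%:R.
    by move=> exp; rewrite /E normrM ler_pM// h'b.
  rewrite (le_trans (ler_normB _ _))//.
  have -> : (2 / c + M * (pi / 2 - e)) / n%:R =
    (c^-1 / n%:R + c^-1 / n%:R) + M / n%:R * (pi / 2 - e) by field; rewrite !gt_eqF ?ltr0n.
  rewrite lerD//; last by apply: normr_Rintegral_le => //; exact: ltW.
  by rewrite (le_trans (ler_normB _ _))// lerD// Fb// ?lexx ?(ltW ep).
apply/cvgrPdist_le => eps eps0.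
(* As [G n] is bounded by [c^-1] uniformly in [n], the interval [[0, e]] contributes at most
   [eps / 2]. The second term of the minimum only keeps [e] below [pi / 2]. *)
pose e := Num.min (c * eps / 2) (pi / 4).
have e0 : 0 < e by rewrite lt_min !divr_gt0 ?mulr_gt0 ?pi_gt0.
have ep : e < pi / 2.
  by rewrite gt_min; apply/orP; right; have := @pi_gt0 R; lra.
have [|C hC] := tail e; first by rewrite e0.
have C0 : 0 <= C.
  by have := hC 1%N erefl; rewrite divr1; exact: le_trans.
near=> n.
have n0 : (0 < n)%N by near: n; exact: nbhs_infty_gt.
rewrite sub0r normrN -/(G n).
rewrite (@Rintegral_itv_split (G n) 0 e (pi / 2)) ?(ltW e0) ?(ltW ep)//.
rewrite (le_trans (ler_normD _ _))// [leRHS](splitr eps) lerD//.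
  apply: (@le_trans _ _ (c^-1 * (e - 0))).
    apply: normr_Rintegral_le => //; first exact: ltW.
    by move=> x /andP[x0 xe]; apply: Gb; rewrite x0 (le_trans xe)// ltW.
  rewrite subr0 mulrC ler_pdivrMr// mulrC.
  by rewrite (_ : c * (eps / 2) = c * eps / 2) ?mulrA// ge_min lexx.
apply: (le_trans (hC _ n0)).
rewrite ler_pdivrMr ?ltr0n// mulrC -ler_pdivrMr ?divr_gt0//.
by near: n; exact: nbhs_infty_ger.
Unshelve. all: by end_near. Qed.

End euler_integral.

(** * The integral of t^a / (1 + t^2) over the half-line *)

Section mellin_integrals.
Context {R : realType}.
Local Notation mu := (@lebesgue_measure R).

Lemma ge0_integrable d (T : measurableType d) (m : {measure set T -> \bar R})
    (D : set T) (f : T -> R) (r : R) :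
  measurable_fun D f -> (forall x, D x -> 0 <= f x) ->
  (\int[m]_(x in D) (f x)%:E <= r%:E)%E -> m.-integrable D (EFin \o f).
Proof.
move=> mf f0 fr; apply/integrableP; split; first exact/measurable_EFinP.
apply: le_lt_trans (ltry r); apply: le_trans fr.
by rewrite le_eqVlt; apply/orP; left; apply/eqP/eq_integral => x /set_mem Dx;
  rewrite /= ger0_norm// f0.
Qed.

(** The geometric expansion of 1 / (1 + q) with exact remainder. The integrals [A k] of
    [w x * q x ^+ k / (1 + q x)] satisfy [A k + A k.+1 = m k], so the error after [n] terms is [A n]
    up to sign, and [A n <= m n]. *)
Lemma alternating_integral_bound (D : set R) (w q : R -> R) (m : nat -> R) :
  measurable D -> measurable_fun D w -> measurable_fun D q ->
  (forall x, D x -> 0 <= w x) -> (forall x, D x -> 0 <= q x) ->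
  (forall k, (\int[mu]_(x in D) (w x * q x ^+ k)%:E = (m k)%:E)%E) ->
  forall n, `|\int[mu]_(x in D) (w x / (1 + q x)) -
              \sum_(k < n) (-1) ^+ k * m k| <= m n.
Proof.
move=> mD mw mq w0 q0 mE.
have mwq k : measurable_fun D (fun x => w x * q x ^+ k).
  by apply: measurable_funM => //; exact: measurable_funX.
have iwq k : mu.-integrable D (EFin \o (fun x => w x * q x ^+ k)).
  apply: (@ge0_integrable _ _ _ _ _ (m k)); [exact: mwq| |by rewrite mE].
  by move=> x Dx; rewrite /= mulr_ge0 ?w0// exprn_ge0// q0.
have q1 x : D x -> 0 < 1 + q x by move=> Dx; rewrite ltr_pwDl// q0.
have iA k : mu.-integrable D (EFin \o (fun x => w x * q x ^+ k / (1 + q x))).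
  apply: le_integrable (iwq k) => //.
    apply/measurable_EFinP; apply: measurable_funM; first exact: mwq.
    apply: (measurable_comp (F := [set x : R | 0 < x])) => //.
    - by rewrite -set_itvoy.
    - by move=> _ [x Dx <-] /=; exact: q1.
    - apply: open_continuous_measurable_fun.
        by rewrite -set_itvoy; exact: interval_open.
      by move=> x; rewrite inE /= => x0; apply: inv_continuous; rewrite gt_eqF.
    - by apply: measurable_funD.
  move=> x Dx; rewrite /= lee_fin.
  have wq0 : 0 <= w x * q x ^+ k by rewrite mulr_ge0 ?w0// exprn_ge0// q0.
  rewrite !ger0_norm//; last by rewrite divr_ge0// ltW// q1.
  by rewrite ler_pdivrMr ?q1// ler_peMr// lerDl q0.
pose A k := \int[mu]_(x in D) (w x * q x ^+ k / (1 + q x)).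
have A0 k : 0 <= A k.
  apply: Rintegral_ge0 => x Dx; rewrite divr_ge0 ?(ltW (q1 _ _))//.
  by rewrite mulr_ge0 ?w0// exprn_ge0// q0.
have AS k : A k + A k.+1 = m k.
  rewrite /A -RintegralD// /Rintegral -[RHS]/(fine (m k)%:E) -mE; congr fine.
  apply: eq_integral => x /set_mem Dx; congr EFin; rewrite exprS.
  by field; rewrite gt_eqF// q1.
have AE n : \int[mu]_(x in D) (w x / (1 + q x)) - \sum_(k < n) (-1) ^+ k * m k =
    (-1) ^+ n * A n.
  elim: n => [|n IH].
    rewrite big_ord0 subr0 expr0 mul1r; apply: eq_Rintegral => x _.
    by rewrite expr0 mulr1.
  by rewrite big_ord_recr/= opprD addrA IH -AS exprS; ring.
move=> n; rewrite AE normrM normrX normrN1 expr1n mul1r ger0_norm//.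
by rewrite -AS lerDl.
Qed.

Lemma continuous_powR (p x : R) : 0 < x -> {for x, continuous (fun y : R => y `^ p)}.
Proof. by move=> x0; apply: is_derive1_continuous; exact: is_derive1_powR. Qed.

Lemma integral_powR01 (p : R) : 0 <= p ->
  (\int[mu]_(x in `]0%R, 1%R]) (x `^ p)%:E = ((p + 1)^-1)%:E)%E.
Proof.
move=> p0; have p1 : 0 < p + 1 by rewrite ltr_wpDl.
rewrite integral_itv_obnd_cbnd; last first.
  by apply/measurable_EFinP/measurable_funTS; exact: measurable_powR.
(* The exponent 0 is separate: the power is then constantly 1, also at the point 0. *)
have right0 (r : R) : 0 <= r -> x `^ r @[x --> 0^'+] --> (0 : R) `^ r.
  rewrite le_eqVlt => /predU1P[<-|r0]; last by rewrite powR0 ?gt_eqF//; exact: powR_cvg0.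
  by rewrite powRr0; under eq_fun do rewrite powRr0; exact: cvg_cst.
pose F (x : R) := x `^ (p + 1) / (p + 1) : R.
have dF (x : R) : 0 < x -> is_derive x 1 F (x `^ p).
  move=> x0; have h : deriv_at (fun y : R => y `^ (p + 1)) x ((p + 1) * x `^ (p + 1 - 1)).
    exact: is_derive1_powR.
  rewrite /F; auto_is_derive; rewrite mulr0 addr0 addrK mulrC mulrA mulVf ?mul1r//.
  by rewrite gt_eqF.
rewrite (@continuous_FTC2 _ _ F)//.
- by rewrite /F powR1 powR0 ?gt_eqF// mul0r mul1r sube0.
- apply/continuous_within_itvP => //; split.
  + by move=> x; rewrite in_itv/= => /andP[x0 _]; exact: continuous_powR.
  + exact: right0.
  + by apply: cvg_at_left_filter; exact: continuous_powR.
- split.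
  + by move=> x; rewrite in_itv/= => /andP[x0 _]; have [] := dF x x0.
  + by apply: cvgM; [exact: right0 (ltW p1)|exact: cvg_cst].
  + by apply: cvg_at_left_filter; exact: is_derive1_continuous (dF 1 ltr01).
- by move=> x; rewrite in_itv/= => /andP[x0 _]; rewrite derive1E; have [] := dF x x0.
Qed.

Lemma powR_cvgy0 (p : R) : 0 < p -> x `^ (- p) @[x --> +oo] --> (0 : R).
Proof.
move=> p0; apply/cvgrPdist_lt => e e0; near=> x.
have x0 : 0 < x by near: x; exact: nbhs_pinfty_gt.
rewrite sub0r normrN ger0_norm ?powR_ge0// powRN.
rewrite invf_plt ?posrE ?powR_gt0//.
have -> : e^-1 = (e^-1 `^ p^-1) `^ p.
  by rewrite -powRrM mulVf ?gt_eqF// powRr1// invr_ge0 ltW.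
rewrite gt0_ltr_powR// ?nnegrE ?powR_ge0 ?(ltW x0)//.
Unshelve. all: by end_near. Qed.

Lemma integral_powR1y (p : R) : 1 < p ->
  (\int[mu]_(x in `[1%R, +oo[) (x `^ (- p))%:E = ((p - 1)^-1)%:E)%E.
Proof.
move=> p1; have p10 : 0 < p - 1 by rewrite subr_gt0.
pose F (x : R) := - x `^ (- (p - 1)) / (p - 1) : R.
have dF (x : R) : 0 < x -> is_derive x 1 F (x `^ (- p)).
  move=> x0; have h : deriv_at (fun y : R => y `^ (- (p - 1))) x
     (- (p - 1) * x `^ (- (p - 1) - 1)) by exact: is_derive1_powR.
  rewrite /F; auto_is_derive.
  have -> : - (p - 1) - 1 = - p by ring.
  by field; rewrite gt_eqF.
rewrite (@ge0_continuous_FTC2y _ _ F 1 0).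
- by rewrite /F powR1 sub0e; congr EFin; rewrite mulNr mul1r opprK.
- by move=> x _; exact: powR_ge0.
- apply/continuous_within_itvcyP; split => [x|].
    by rewrite in_itv/= andbT => x1; apply: continuous_powR; exact: lt_trans x1.
  by apply: cvg_at_right_filter; exact: continuous_powR.
- rewrite -(mul0r (p - 1)^-1) -(oppr0 R); apply: cvgM; last exact: cvg_cst.
  by apply: cvgN; exact: powR_cvgy0.
- by move=> x x1; have [] := dF x (lt_trans ltr01 x1).
- by apply: cvg_at_right_filter; exact: is_derive1_continuous (dF 1 ltr01).
- move=> x; rewrite in_itv/= andbT => x1; rewrite derive1E.
  by have [] := dF x (lt_trans ltr01 x1).
Qed.

Definition euler_kernel (a t : R) : R := t `^ a / (1 + t ^+ 2).

Lemma euler_kernel_ge0 (a t : R) : 0 <= euler_kernel a t.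
Proof. by rewrite divr_ge0 ?powR_ge0// addr_ge0// sqr_ge0. Qed.

Lemma measurable_euler_kernel (a : R) : measurable_fun [set: R] (euler_kernel a).
Proof.
apply: measurable_funM; first exact: measurable_powR.
apply: continuous_measurable_fun => x; apply: deriv_at_continuous.
deriv_at_rec.
by rewrite gt_eqF// ltr_pwDl// sqr_ge0.
Qed.

Definition euler_sum (a : R) (n : nat) : R :=
  \sum_(k < n) (-1) ^+ k * odd_recip a k.

Lemma cvg_odd_recip (a : R) : `|a| < 1 -> odd_recip a n @[n --> \oo] --> 0.
Proof.
rewrite ltr_norml => /andP[a1 a2].
apply/cvgrPdist_le => e e0; near=> n.
have n0 : (0 < n)%N by near: n; exact: nbhs_infty_gt.
have n0' : 0 < n%:R :> R by rewrite ltr0n.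
have [hp hm] : n%:R <= n.*2.+1%:R + a /\ n%:R <= n.*2.+1%:R - a.
  have : n.+1%:R <= n.*2.+1%:R :> R by rewrite ler_nat ltnS -addnn leq_addr.
  by rewrite -natr1; split; lra.
rewrite sub0r normrN ger0_norm; last first.
  by rewrite addr_ge0// invr_ge0 (le_trans (ltW n0')).
apply: (@le_trans _ _ (n%:R^-1 + n%:R^-1)).
  by rewrite lerD// lef_pV2// posrE// (lt_le_trans n0').
have -> : n%:R^-1 + n%:R^-1 = 2 / n%:R :> R by ring.
rewrite ler_pdivrMr// mulrC -ler_pdivrMr//.
by near: n; exact: nbhs_infty_ger.
Unshelve. all: by end_near. Qed.

(** The kernel is expanded in powers of t^2 on []0, 1]] and, written as t^(a - 2) / (1 + t^(-2)), in
    powers of t^(-2) on [[1, +oo[]. The moments are 1 / (2k + 1 + a) and 1 / (2k + 1 - a), so the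
    total error after [n] terms is at most [odd_recip a n]. *)
Lemma cvg_euler_sum (a : R) : 0 <= a < 1 ->
  (exists2 I, (\int[mu]_(t in `]0%R, +oo[) (euler_kernel a t)%:E = I%:E)%E
   & euler_sum a n @[n --> \oo] --> I).
Proof.
move=> /andP[a0 a1].
have na1 : `|a| < 1 by rewrite ger0_norm.
pose D1 := `]0, 1]%classic : set R; pose D2 := `[1, +oo[%classic : set R.
have mD1 : measurable D1 by exact: measurable_itv.
have mD2 : measurable D2 by exact: measurable_itv.
pose w1 (t : R) := t `^ a : R; pose q1 (t : R) := t ^+ 2 : R.
pose w2 (t : R) := t `^ (- (2 - a)) : R; pose q2 (t : R) := t `^ (- 2) : R.
have q1E (t : R) k : 0 < t -> w1 t * q1 t ^+ k = t `^ (a + k.*2%:R).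
  move=> t0; rewrite /w1 /q1 powRD ?(gt_eqF t0) ?implybT//.
  by rewrite powR_mulrn ?(ltW t0)// -exprM mul2n.
have q2E (t : R) k : 0 < t -> w2 t * q2 t ^+ k = t `^ (- (k.*2.+1%:R - a + 1)).
  move=> t0; rewrite /w2 /q2 -powR_mulrn ?powR_ge0// -powRrM -powRD ?(gt_eqF t0) ?implybT//.
  by congr powR; rewrite -[k.*2.+1]addn1 natrD -mul2n natrM; ring.
have E1 k : (\int[mu]_(t in D1) (w1 t * q1 t ^+ k)%:E = ((k.*2.+1%:R + a)^-1)%:E)%E.
  rewrite -[k.*2.+1]addn1 natrD -addrA (addrC 1) addrA (addrC _ a) -integral_powR01//; last by rewrite addr_ge0.
  by apply: eq_integral => t; rewrite inE /D1/= in_itv/= => /andP[t0 _]; rewrite q1E.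
have E2 k : (\int[mu]_(t in D2) (w2 t * q2 t ^+ k)%:E = ((k.*2.+1%:R - a)^-1)%:E)%E.
  rewrite -[X in (X^-1)%:E](addrK 1) -integral_powR1y//.
    apply: eq_integral => t; rewrite inE /D2/= in_itv/= andbT => t1.
    by rewrite q2E// (lt_le_trans ltr01).
  rewrite ltrDr subr_gt0 (lt_le_trans a1)//.
  by rewrite ler1n.
have mpw (D : set R) p : measurable_fun D (fun t : R => t `^ p).
  by apply: measurable_funTS; exact: measurable_powR.
have B1 := @alternating_integral_bound D1 w1 q1 _ _ _ _ _ _ E1.
have B2 := @alternating_integral_bound D2 w2 q2 _ _ _ _ _ _ E2.
have {}B1 := B1 (measurable_itv _) (mpw _ _) (measurable_funX _ (@measurable_id _ _ _))
  (fun x _ => powR_ge0 _ _) (fun x _ => sqr_ge0 _).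
have {}B2 := B2 (measurable_itv _) (mpw _ _) (mpw _ _)
  (fun x _ => powR_ge0 _ _) (fun x _ => powR_ge0 _ _).
pose I1 := \int[mu]_(t in D1) (w1 t / (1 + q1 t)).
pose I2 := \int[mu]_(t in D2) (w2 t / (1 + q2 t)).
have mek (D : set R) : measurable_fun D (euler_kernel a).
  by apply: measurable_funTS; exact: measurable_euler_kernel.
have F1 : (\int[mu]_(t in D1) (euler_kernel a t)%:E = I1%:E)%E.
  rewrite /I1 /Rintegral fineK//.
  apply: integrable_fin_num => //; apply: (@ge0_integrable _ _ _ _ _ (0.*2.+1%:R + a)^-1); first exact: mek.
    by move=> t _; exact: euler_kernel_ge0.
  rewrite -E1; apply: ge0_le_integral => //.
  - by move=> t _; rewrite lee_fin euler_kernel_ge0.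
  - by apply/measurable_EFinP; exact: mek.
  - by apply/measurable_EFinP; apply: measurable_funM; [exact: mpw|exact: measurable_cst].
  - move=> t; rewrite /D1/= in_itv/= => /andP[t0 _]; rewrite lee_fin expr0 mulr1.
    by rewrite ler_pdivrMr ?ltr_pwDl ?sqr_ge0// ler_peMr ?powR_ge0// lerDl sqr_ge0.
have ekE (t : R) : 0 < t -> w2 t / (1 + q2 t) = euler_kernel a t.
  move=> t0; rewrite /w2 /q2 /euler_kernel.
  rewrite (powRN _ 2) (powR_mulrn 2) ?(ltW t0)// opprB powRB ?(gt_eqF t0) ?implybT//.
  rewrite (powR_mulrn 2) ?(ltW t0)//; field.
  by rewrite !gt_eqF// addr_gt0// exprn_gt0.
have F2 : (\int[mu]_(t in D2) (euler_kernel a t)%:E = I2%:E)%E.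
  rewrite /I2 /Rintegral fineK//.
    apply: eq_integral => t; rewrite inE /D2/= in_itv/= andbT => t1.
    by rewrite ekE// (lt_le_trans ltr01).
  apply: integrable_fin_num => //; apply: (@ge0_integrable _ _ _ _ _ (0.*2.+1%:R - a)^-1) => //.
  - apply: eq_measurable_fun (mek D2) => t; rewrite inE /D2/= in_itv/= andbT => t1.
    by rewrite ekE// (lt_le_trans ltr01).
  - by move=> t _; rewrite divr_ge0 ?powR_ge0// addr_ge0// powR_ge0.
  rewrite -E2; apply: ge0_le_integral => //.
  - by move=> t _; rewrite lee_fin divr_ge0 ?powR_ge0// addr_ge0// powR_ge0.
  - apply/measurable_EFinP; apply: eq_measurable_fun (mek D2) => t; rewrite inE /D2/= in_itv/= andbT => t1.
    by rewrite ekE// (lt_le_trans ltr01).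
  - by apply/measurable_EFinP; apply: measurable_funM; [exact: mpw|exact: measurable_cst].
  - move=> t _; rewrite lee_fin expr0 mulr1.
    by rewrite ler_pdivrMr ?ltr_pwDl ?powR_ge0// ler_peMr ?powR_ge0// lerDl powR_ge0.
exists (I1 + I2).
  have -> : `]0, +oo[%classic = D1 `|` `]1, +oo[%classic :> set R.
    by apply: itv_bndbnd_setU; rewrite bnd_simp.
  rewrite ge0_integral_setU//=.
  - by rewrite F1 EFinD -F2 integral_itv_obnd_cbnd//; apply/measurable_EFinP; exact: mek.
  - by apply/measurable_EFinP; exact: mek.
  - by move=> t _; rewrite lee_fin euler_kernel_ge0.
  - apply/disj_setPS => t []; rewrite /D1/= !in_itv/= andbT => /andP[_ t1].
    by rewrite ltNge t1.
have sumE n : euler_sum a n = \sum_(k < n) (-1) ^+ k * (k.*2.+1%:R + a)^-1 +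
   \sum_(k < n) (-1) ^+ k * (k.*2.+1%:R - a)^-1.
  by rewrite -big_split/=; apply: eq_bigr => k _; rewrite /odd_recip mulrDr.
have := cvg_odd_recip na1 => /cvgrPdist_le h.
apply/cvgrPdist_le => e e0; near=> n.
have : `|0 - odd_recip a n| <= e by near: n; exact: h.
rewrite sub0r normrN; apply: le_trans.
apply: le_trans (ler_norm _).
rewrite sumE opprD addrACA (le_trans (ler_normD _ _))// lerD//.
Unshelve. all: by end_near. Qed.

(** Up to the factor cos (pi a / 2), the partial sums are integrals of cos (a x) against
    [cos_odd_sum n]. Subtracting the case a = 0 leaves the integral of cos (a x) - 1, which tends to
    0. Hence cos (pi a / 2) times the integral equals its value at a = 0, the arctangent integral pi
    / 2. *)
Lemma integral_euler_kernel (a : R) : 0 <= a < 1 ->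
  (\int[mu]_(t in `]0%R, +oo[) (euler_kernel a t)%:E =
   (pi / (2 * cos (pi * a / 2)))%:E)%E.
Proof.
move=> a01; have /andP[a0 a1] := a01.
have na1 : `|a| < 1 by rewrite ger0_norm.
have n01 : `|0 : R| < 1 by rewrite normr0 ltr01.
have [I IE cvI] := cvg_euler_sum a01.
have [|J JE cvJ] := @cvg_euler_sum 0; first by rewrite lexx ltr01.
have JE' : J = pi / 2.
  apply/EFin_inj; rewrite -JE -integral0y_oneDsqr -integral_itv_obnd_cbnd; last first.
    apply/measurable_EFinP/measurable_funTS.
    by apply: continuous_measurable_fun; exact: continuous_oneDsqrV.
  by apply: eq_integral => t _; rewrite /euler_kernel powRr0 mul1r.
have cosE : cos (pi * a / 2) = cos (a * (pi / 2)) by congr cos; ring.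
have c0 : 0 < cos (pi * a / 2).
  by apply: cos_gt0_pihalf; have := @pi_gt0 R; nra.
have diffE n : \int[mu]_(x in `[0, pi / 2]) ((cos (a * x) - 1) * cos_odd_sum n x) =
    cos (pi * a / 2) * euler_sum a n - euler_sum 0 n.
  rewrite cosE -Rintegral_cos_cos_odd_sum//.
  have := @Rintegral_cos_cos_odd_sum R 0 n n01.
  rewrite mul0r cos0 mul1r -/(euler_sum 0 n) => <-.
  rewrite -RintegralB//; last 2 first.
  - apply: integrable_continuous_itv => x _; apply: cvgM; first exact: continuous_cosM.
    exact: continuous_cos_odd_sum.
  - apply: integrable_continuous_itv => x _; apply: cvgM; first exact: continuous_cosM.
    exact: continuous_cos_odd_sum.
  by apply: eq_Rintegral => x _; rewrite mulrBl mul0r cos0.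
have L0 := cvg_Rintegral_cosB1_odd_sum na1.
have : cos (pi * a / 2) * euler_sum a n - euler_sum 0 n @[n --> \oo] --> cos (pi * a / 2) * I - J.
  by apply: cvgB => //; apply: cvgM => //; exact: cvg_cst.
under eq_fun do rewrite -diffE.
move=> cvD; have E0 : 0 = cos (pi * a / 2) * I - J := cvg_unique (@norm_hausdorff _ _) L0 cvD.
have cI : cos (pi * a / 2) * I = pi / 2 by apply/eqP; rewrite -subr_eq0 -JE' -E0.
rewrite IE; congr EFin; 
have cn0 : cos (pi * a / 2) != 0 by rewrite gt_eqF.
by apply: (mulfI cn0); rewrite cI; field.
Qed.

End mellin_integrals.

(** * Evaluation of the square of kappa *)

Section kappa_value.
Context {R : realType}.
Local Notation mu := (@lebesgue_measure R).

(** Euler's integral for Gamma (s + 1), extended-real so that Tonelli applies before finiteness is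
    known. *)
Definition egamma (s : R) : \bar R :=
  (\int[mu]_(x in `]0%R, +oo[) (x `^ s * expR (- x))%:E)%E.

Lemma measurable_expRM (c : R) : measurable_fun [set: R] (fun x : R => expR (- (x * c))).
Proof.
by apply: continuous_measurable_fun => x; apply: deriv_at_continuous; deriv_at_rec.
Qed.

Lemma measurable_expRN : measurable_fun [set: R] (fun x : R => expR (- x)).
Proof. by apply: measurableT_comp => //; exact: measurable_expR. Qed.

Lemma egamma_ge0 s : (0 <= egamma s)%E.
Proof. by apply: integral_ge0 => x _; rewrite lee_fin mulr_ge0 ?powR_ge0 ?expR_ge0. Qed.

Lemma preimage_scale_itv0y (c : R) : 0 < c ->
  ( *%R c) @^-1` `]0, +oo[%classic = `]0, +oo[%classic :> set R.
Proof.
by move=> c0; apply/seteqP; split => x /=; rewrite !in_itv/= !andbT pmulr_rgt0.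
Qed.

Lemma egamma_scale (p x : R) : 0 < x ->
  (\int[mu]_(t in `]0%R, +oo[) (t `^ p * expR (- (t * x)))%:E =
   (x `^ (- (p + 1)))%:E * egamma p)%E.
Proof.
move=> x0; have mf : measurable_fun (`]0%R, +oo[%classic : set R)
    (fun t : R => (t `^ p * expR (- t))%:E).
  apply/measurable_EFinP/measurable_funTS; apply: measurable_funM.
    exact: measurable_powR.
  exact: measurable_expRN.
have f0 (t : R) : (`]0%R, +oo[%classic : set R) t -> (0 <= (t `^ p * expR (- t))%:E)%E.
  by move=> _; rewrite lee_fin mulr_ge0 ?powR_ge0 ?expR_ge0.
have := ge0_integral_scale x0 (measurable_itv _) mf f0.
rewrite preimage_scale_itv0y// -/(egamma p) => h.
have -> : ((x `^ (- (p + 1)))%:E = ((x `^ p)^-1)%:E * (x^-1)%:E)%E.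
  rewrite -EFinM; congr EFin; rewrite opprD powRD ?(gt_eqF x0) ?implybT//.
  by rewrite powRN powR_inv1// ltW.
rewrite -muleA -h -ge0_integralZl_EFin//; last 3 first.
- move=> t _; rewrite lee_fin mulr_ge0 ?powR_ge0 ?expR_ge0//.
- apply/measurable_EFinP/measurable_funTS; apply: measurable_funM.
    apply: (measurableT_comp (measurable_powR p)); exact: measurable_funM.
  by under eq_fun do rewrite mulrC; exact: measurable_expRM.
- by rewrite invr_ge0 powR_ge0.
apply: eq_integral => t; rewrite inE/= in_itv/= andbT => t0.
rewrite -EFinM; congr EFin; rewrite powRM ?(ltW x0) ?(ltW t0)//.
by rewrite -!mulrA mulKf ?powR_eq0 ?(gt_eqF x0)// (mulrC t).
Qed.

Lemma cvg_expRNM (t : R) : 0 < t -> expR (- (x * t)) @[x --> +oo] --> 0.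
Proof.
move=> t0; apply: (cvg_comp (fun x => x * t) (fun y => expR (- y))).
  exact/gt0_cvgMly.
exact: cvgr_expR.
Qed.

Lemma integral_expR1y (x : R) : 0 < x ->
  (\int[mu]_(t in `]1%R, +oo[) (expR (- (t * x)))%:E = (expR (- x) / x)%:E)%E.
Proof.
move=> x0; rewrite integral_itv_obnd_cbnd; last first.
  by apply/measurable_EFinP/measurable_funTS; exact: measurable_expRM.
pose F (t : R) := - expR (- (t * x)) / x.
have dF (t : R) : is_derive t 1 F (expR (- (t * x))).
  by rewrite /F; auto_is_derive; field; rewrite gt_eqF.
rewrite (@ge0_continuous_FTC2y _ _ F 1 0).
- by rewrite -EFinB sub0r /F mul1r mulNr opprK.
- by move=> t _; exact: expR_ge0.
- by apply: continuous_subspaceT => t; auto_continuous.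
- rewrite -(mul0r x^-1) -(oppr0 R); apply: cvgM; last exact: cvg_cst.
  by apply: cvgN; exact: cvg_expRNM.
- by move=> t _; have [] := dF t.
- by apply: cvg_at_right_filter; exact: is_derive1_continuous (dF 1).
- by move=> t _; rewrite derive1E; have [] := dF t.
Qed.

(** The functional equation by Tonelli: exp (- x) / x is the integral of exp (- t x) over t > 1, and
    for fixed t the integral in x is a rescaled [egamma (q + 1)]. *)
Lemma egammaS (q : R) : 0 <= q -> (egamma q = (q + 1)^-1%:E * egamma (q + 1))%E.
Proof.
move=> q0.
pose f (z : R * R) := (z.1 `^ (q + 1) * expR (- (z.1 * z.2)))%:E.
have mf (D : set (R * R)) : measurable_fun D f.
  apply/measurable_EFinP/measurable_funTS; apply: measurable_funM.
    exact: (measurableT_comp (measurable_powR _)).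
  by apply: measurableT_comp => //; apply: measurableT_comp => //; exact: measurable_funM.
have f0 z : (0 <= f z)%E by rewrite lee_fin mulr_ge0 ?powR_ge0 ?expR_ge0.
have := @tonelli_on R `]0%R, +oo[%classic `]1%R, +oo[%classic f (measurable_itv _) (measurable_itv _) (mf _) (fun z _ => f0 z).
have -> : (\int[mu]_(x in `]0%R, +oo[) \int[mu]_(y in `]1%R, +oo[) f (x, y) = egamma q)%E.
  apply: eq_integral => x; rewrite inE/= in_itv/= andbT => x0.
  under eq_integral do rewrite /f/= EFinM.
  rewrite ge0_integralZl_EFin ?powR_ge0//; last first.
    by apply/measurable_EFinP/measurable_funTS; under eq_fun do rewrite mulrC; exact: measurable_expRM.
  under eq_integral do rewrite mulrC.
  rewrite integral_expR1y// -EFinM; congr EFin.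
  rewrite powRD ?(gt_eqF x0) ?implybT// powRr1 ?(ltW x0)//.
  by field; rewrite gt_eqF.
move=> ->.
transitivity (\int[mu]_(t in `]1%R, +oo[) ((t `^ (- (q + 1 + 1)))%:E * egamma (q + 1)))%E.
  apply: eq_integral => t; rewrite inE/= in_itv/= andbT => t1.
  by rewrite -egamma_scale ?(lt_trans ltr01).
rewrite ge0_integralZr//=.
- rewrite integral_itv_obnd_cbnd; last first.
    by apply/measurable_EFinP/measurable_funTS; exact: measurable_powR.
  by rewrite integral_powR1y ?addrK// ltrDr ltr_pwDr.
- by apply/measurable_EFinP/measurable_funTS; exact: measurable_powR.
- by move=> t _; rewrite lee_fin powR_ge0.
- exact: egamma_ge0.
Qed.

Lemma integral_1Bcos_expR (t : R) : 0 < t ->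
  (\int[mu]_(x in `]0%R, +oo[) ((1 - cos x) * expR (- (x * t)))%:E =
   ((t * (1 + t ^+ 2))^-1)%:E)%E.
Proof.
move=> t0; have t2 : 0 < 1 + t ^+ 2 by rewrite ltr_pwDl ?sqr_ge0.
rewrite integral_itv_obnd_cbnd; last first.
  apply/measurable_EFinP/measurable_funTS; apply: measurable_funM; last exact: measurable_expRM.
  by apply: continuous_measurable_fun => x; auto_continuous.
pose F (x : R) := expR (- (x * t)) * (- t^-1 - (sin x - t * cos x) / (1 + t ^+ 2)).
have dF (x : R) : is_derive x 1 F ((1 - cos x) * expR (- (x * t))).
  by rewrite /F; auto_is_derive; field; rewrite !gt_eqF.
rewrite (@ge0_continuous_FTC2y _ _ F 0 0).
- rewrite -EFinB sub0r /F mul0r oppr0 expR0 sin0 cos0; congr EFin.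
  by field; rewrite !gt_eqF.
- by move=> x _; rewrite mulr_ge0 ?expR_ge0// subr_ge0 cos_le1.
- by apply: continuous_subspaceT => x; auto_continuous.
- pose M := t^-1 + (1 + t) / (1 + t ^+ 2).
  apply/cvgr0Pnorm_le => e e0.
  have : expR (- (x * t)) * M @[x --> +oo] --> 0.
    by rewrite -(mul0r M); apply: cvgM; [exact: cvg_expRNM|exact: cvg_cst].
  move=> /cvgr0Pnorm_le /(_ e e0); apply: filterS => x; apply: le_trans.
  rewrite /F !normrM ler_wpM2l//.
  have M0 : 0 <= M.
    by rewrite /M addr_ge0 ?invr_ge0 ?(ltW t0)// divr_ge0 ?(ltW t2)// addr_ge0 ?ler01 ?(ltW t0).
  rewrite [leRHS]ger0_norm //.
  rewrite (le_trans (ler_normB _ _))// normrN normfV (gtr0_norm t0) lerD//.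
  rewrite normrM normfV (gtr0_norm t2) ler_wpM2r ?invr_ge0 ?(ltW t2)//.
  rewrite (le_trans (ler_normB _ _))// lerD ?sin_max// normrM (gtr0_norm t0).
  by rewrite ler_piMr ?cos_max// ltW.
- by move=> x _; have [] := dF x.
- by apply: cvg_at_right_filter; exact: is_derive1_continuous (dF 0).
- by move=> x _; rewrite derive1E; have [] := dF x.
Qed.

Definition half_kappa (d : R) : \bar R :=
  (\int[mu]_(x in `]0%R, +oo[) ((1 - cos x) * x `^ (- (2 + 2 * d)))%:E)%E.

Lemma measurable_1Bcos_powR p : measurable_fun [set: R] (fun x : R => (1 - cos x) * x `^ p).
Proof.
apply: measurable_funM; last exact: measurable_powR.
by apply: continuous_measurable_fun => x; auto_continuous.
Qed.

(** The double integral is that of (1 - cos x) t^(1 + 2d) exp (- t x). Integrating in t first yields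
    the power of x in [half_kappa] and the factor [egamma]; integrating in x first yields
    [euler_kernel (2 * d)]. *)
Lemma egamma_half_kappa (d : R) : 0 < d < 2^-1 ->
  (half_kappa d * egamma (1 + 2 * d) = (pi / (2 * cos (pi * d)))%:E)%E.
Proof.
move=> /andP[d0 d1].
pose f (z : R * R) := ((1 - cos z.1) * (z.2 `^ (1 + 2 * d) * expR (- (z.2 * z.1))))%:E.
have f0 z : (0 <= f z)%E.
  by rewrite lee_fin mulr_ge0 ?mulr_ge0 ?powR_ge0 ?expR_ge0// subr_ge0 cos_le1.
have mf (D : set (R * R)) : measurable_fun D f.
  apply/measurable_EFinP/measurable_funTS; apply: measurable_funM.
    apply: measurable_funB => //; apply: measurableT_comp => //.
    by apply: continuous_measurable_fun; exact: continuous_cos.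
  apply: measurable_funM.
    exact: (measurableT_comp (measurable_powR _)).
  by apply: measurableT_comp => //; apply: measurableT_comp => //; exact: measurable_funM.
have := @tonelli_on R `]0%R, +oo[%classic `]0%R, +oo[%classic f (measurable_itv _) (measurable_itv _) (mf _) (fun z _ => f0 z).
have -> : (\int[mu]_(x in `]0%R, +oo[) \int[mu]_(y in `]0%R, +oo[) f (x, y) =
    half_kappa d * egamma (1 + 2 * d))%E.
  rewrite -ge0_integralZr//=; last 3 first.
  - by apply/measurable_EFinP/measurable_funTS; exact: measurable_1Bcos_powR.
  - by move=> x _; rewrite lee_fin mulr_ge0 ?powR_ge0// subr_ge0 cos_le1.
  - exact: egamma_ge0.
  apply: eq_integral => x; rewrite inE/= in_itv/= andbT => x0.
  under eq_integral do rewrite /f/= EFinM.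
  rewrite ge0_integralZl_EFin//; last 2 first.
  - by move=> t _; rewrite lee_fin mulr_ge0 ?powR_ge0 ?expR_ge0.
  - apply/measurable_EFinP/measurable_funTS; apply: measurable_funM; last exact: measurable_expRM.
    exact: measurable_powR.
  rewrite egamma_scale// muleA -EFinM; congr (_%:E * _)%E.
  by congr (_ * _ `^ _); ring.
move=> ->.
have -> : pi / (2 * cos (pi * d)) = pi / (2 * cos (pi * (2 * d) / 2)) :> R.
  by congr (_ / (_ * cos _)); field.
rewrite -integral_euler_kernel; last by apply/andP; split; lra.
apply: eq_integral => t; rewrite inE/= in_itv/= andbT => t0.
transitivity (\int[mu]_(x in `]0%R, +oo[) ((t `^ (1 + 2 * d))%:E * ((1 - cos x) * expR (- (x * t)))%:E))%E.
  apply: eq_integral => x _; rewrite /f/= -EFinM; congr EFin; rewrite (mulrC t x); ring.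
rewrite ge0_integralZl_EFin ?powR_ge0//; last first.
- apply/measurable_EFinP/measurable_funTS; apply: measurable_funM; last exact: measurable_expRM.
  by apply: continuous_measurable_fun => x; auto_continuous.
rewrite integral_1Bcos_expR// -EFinM; congr EFin.
rewrite powRD ?(gt_eqF t0) ?implybT// powRr1 ?(ltW t0)// /euler_kernel.
by field; rewrite !gt_eqF// ltr_pwDl ?sqr_ge0.
Qed.

Lemma kappa_sqE (d : R) : kappa_sq d = (\int[mu]_x ((2 * (1 - cos x)) * `|x| `^ (- 2 - 2 * d))%:E)%E.
Proof.
apply: eq_integral => x _; congr ((_ * _)%:E).
rewrite /expi /= sqr_sqrtr ?addr_ge0 ?sqr_ge0//.
by rewrite sub0r sqrrN sin2cos2; ring.
Qed.

Lemma kappa_sq_half (d : R) : (kappa_sq d = 4%:E * half_kappa d)%E.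
Proof.
rewrite kappa_sqE ge0_integral_even.
- have -> : (4%:E = 2%:E * 2%:E :> \bar R)%E by rewrite -EFinM -natrM.
  rewrite -muleA; congr (_ * _)%E.
  rewrite -ge0_integralZl_EFin//; last 2 first.
  - by move=> x _; rewrite lee_fin mulr_ge0 ?powR_ge0// subr_ge0 cos_le1.
  - by apply/measurable_EFinP/measurable_funTS; exact: measurable_1Bcos_powR.
  apply: eq_integral => x; rewrite inE/= in_itv/= andbT => x0.
  rewrite gtr0_norm// -EFinM mulrA.
  by congr ((_ * _ `^ _)%:E); ring.
- apply/measurable_EFinP; apply: measurable_funM.
    by apply: continuous_measurable_fun => x; auto_continuous.
  by apply: (measurableT_comp (measurable_powR _)); exact: normr_measurable.
- by move=> x; rewrite lee_fin mulr_ge0 ?powR_ge0// mulr_ge0// subr_ge0 cos_le1.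
- by move=> x; rewrite cosN normrN.
Qed.

Lemma kappa_sq_value (d : R) : 0 < d < 2^-1 ->
  kappa_sq d = (pi / ((d + 2^-1) * Gamma (2 * d + 1) * cos (pi * d)))%:E /\
  (0 < kappa_sq d)%E.
Proof.
move=> d01; have /andP[d0 d1] := d01.
have cos0 : 0 < cos (pi * d) by apply: cos_gt0_pihalf; have := @pi_gt0 R; nra.
set c := pi / (2 * cos (pi * d)).
have c0 : 0 < c by rewrite divr_gt0 ?pi_gt0// mulr_gt0.
have hk0 : (0 <= half_kappa d)%E.
  by apply: integral_ge0 => x _; rewrite lee_fin mulr_ge0 ?powR_ge0// subr_ge0 cos_le1.
have hG : Gamma (2 * d + 1) = fine (egamma (2 * d)).
  by rewrite /Gamma /Rintegral addrK.
have G0 := egamma_ge0 (1 + 2 * d).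
have := egamma_half_kappa d01; rewrite -/c kappa_sq_half.
have dS : 0 <= 2 * d by lra.
rewrite hG (egammaS dS) (addrC (2 * d)).
(* Finiteness of both factors is read off their product, which is finite and positive: an infinite
   factor would make the product infinite, or 0 if the other factor were 0. *)
have [k [g [hk hg k0 g0]]] : exists k g : R,
    [/\ half_kappa d = k%:E, egamma (1 + 2 * d) = g%:E, 0 <= k & 0 <= g].
  move: (egamma_half_kappa d01) G0 hk0; rewrite -/c.
  case: (half_kappa d) => [k| |//]; case: (egamma (1 + 2 * d)) => [g| |//] //=.
  - by move=> _ g0 k0; exists k, g; split.
  - move=> h _; rewrite lee_fin le_eqVlt => /predU1P[k0|k0].
      by move: h; rewrite -k0 mul0e => -[] /eqP; rewrite lt_eqF.
    by move: h; rewrite gt0_muley// lte_fin.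
  - move=> h; rewrite lee_fin le_eqVlt => /predU1P[g0|g0] _.
      by move: h; rewrite -g0 mule0 => -[] /eqP; rewrite lt_eqF.
    by move: h; rewrite gt0_mulye// lte_fin.
rewrite hk hg -!EFinM => -[kg] /=.
have gk : 0 < k /\ 0 < g.
  split; rewrite lt_neqAle ?k0 ?g0 andbT; apply/eqP => z.
    by move: kg; rewrite -z mul0r => /eqP; rewrite lt_eqF.
  by move: kg; rewrite -z mulr0 => /eqP; rewrite lt_eqF.
split; last by rewrite lte_fin mulr_gt0//; case: gk.
congr EFin; have -> : k = c / g by rewrite -kg mulfK// gt_eqF//; case: gk.
have g1 : 0 < g by case: gk.
have d2 : 0 < 1 + 2 * d by lra.
have d3 : 0 < d + 2^-1 by lra.
rewrite /c; clear - cos0 g1 d2 d3; field.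
by rewrite !gt_eqF.
Qed.

Lemma kappa_gt0 (d : R) : 0 < d < 2^-1 -> 0 < kappa d.
Proof.
move=> /kappa_sq_value[kE]; rewrite /kappa kE lte_fin => k0.
by rewrite sqrtr_gt0.
Qed.

Lemma kappa_sqK (d : R) : 0 < d < 2^-1 -> kappa_sq d = (kappa d ^+ 2)%:E.
Proof.
move=> /kappa_sq_value[kE]; rewrite /kappa kE lte_fin => k0.
by rewrite sqr_sqrtr// ltW.
Qed.

End kappa_value.

(** * Integration against a density *)

Section density.
Local Open Scope ereal_scope.
Context d (T : measurableType d) (R : realType).
Variables (mu nu : {measure set T -> \bar R}) (p : T -> R).
Hypothesis mp : measurable_fun [set: T] p.
Hypothesis p0 : forall x, (0 <= p x)%R.
Hypothesis nuE : forall A, measurable A -> nu A = \int[mu]_(x in A) (p x)%:E.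

Import HBNNSimple.

(** By [nuE] the two sides agree on indicators, hence on simple functions, and monotone convergence
    passes to increasing limits of these. *)
Lemma ge0_integral_density (f : T -> \bar R) :
  measurable_fun [set: T] f -> (forall x, 0 <= f x) ->
  \int[nu]_x f x = \int[mu]_x (f x * (p x)%:E).
Proof.
move=> mf f0.
pose f_ := nnsfun_approx measurableT mf.
have cvf x : EFin \o f_^~ x @ \oo --> f x by exact: cvg_nnsfun_approx.
have ndf x : nondecreasing_seq (fun n => (f_ n x)%:E).
  by move=> m n mn; rewrite lee_fin; exact/lefP/nd_nnsfun_approx.
have p0' x : 0 <= (p x)%:E by rewrite lee_fin.
have mp' : measurable_fun [set: T] (EFin \o p) by exact/measurable_EFinP.
transitivity (limn (fun n => \int[nu]_x (f_ n x)%:E)).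
  rewrite -monotone_convergence//.
  - by apply: eq_integral => y _; apply/esym/cvg_lim => //; exact: cvf.
  - by move=> n; exact/measurable_EFinP/measurable_funP.
  - by move=> n y _; rewrite lee_fin.
transitivity (limn (fun n => \int[mu]_x ((f_ n x)%:E * (p x)%:E))); last first.
  rewrite -monotone_convergence//.
  - apply: eq_integral => y _; apply/cvg_lim => //.
    by apply: cvgeZr => //; exact: cvf.
  - move=> n; apply: emeasurable_funM => //.
    exact/measurable_EFinP/measurable_funP.
  - by move=> n y _; rewrite mule_ge0 ?lee_fin.
  - by move=> x _ m n mn; rewrite lee_wpmul2r// ndf.
congr (limn _); apply/funext => n.
transitivity (\sum_(k \in range (f_ n)) \int[nu]_x (k * \1_(f_ n @^-1` [set k]) x)%:E).
  under eq_integral do rewrite fimfunE -fsumEFin//.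
  rewrite ge0_integral_fsum//.
  - by move=> y; exact/measurable_EFinP/measurable_funM.
  - by move=> y x _; rewrite nnfun_muleindic_ge0.
transitivity (\sum_(k \in range (f_ n))
    \int[mu]_x ((k * \1_(f_ n @^-1` [set k]) x)%:E * (p x)%:E)); last first.
  rewrite -ge0_integral_fsum//.
  - apply: eq_integral => x _; rewrite -ge0_mule_fsuml; last first.
      by move=> k; rewrite nnfun_muleindic_ge0.
    by rewrite fsumEFin// -fimfunE.
  - move=> k; apply: emeasurable_funM => //.
    exact/measurable_EFinP/measurable_funM.
  - by move=> k x _; rewrite mule_ge0// nnfun_muleindic_ge0.
apply: eq_fsbigr => k; rewrite inE => -[t _ <-].
have ft0 : (0 <= f_ n t)%R by [].
move: (f_ n t) ft0 => {k t}k k0.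
rewrite integralZl_indic_nnsfun// integral_indic// setIT nuE//.
under [RHS]eq_integral do rewrite EFinM -muleA.
rewrite ge0_integralZl_EFin//.
- congr (_ * _); rewrite integral_mkcond; apply: eq_integral => x _.
  rewrite patchE indicE; case: ifPn => _; first by rewrite mul1e.
  by rewrite mul0e.
- by move=> x _; rewrite mule_ge0 ?lee_fin.
- by apply: emeasurable_funM => //; exact/measurable_EFinP.
Qed.

End density.

(** * Linearity for real-valued integrands *)

Section real_integrable.
Context d (T : measurableType d) (R : realType) (mu : {measure set T -> \bar R}).
Variables (D : set T) (mD : measurable D).
Implicit Types f g : T -> R.

Lemma integrable_realD f g : mu.-integrable D (EFin \o f) ->
  mu.-integrable D (EFin \o g) ->
  mu.-integrable D (EFin \o (fun x => f x + g x)).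
Proof. by move=> fi gi; exact: (integrableD mD fi gi). Qed.

Lemma integrable_realB f g : mu.-integrable D (EFin \o f) ->
  mu.-integrable D (EFin \o g) ->
  mu.-integrable D (EFin \o (fun x => f x - g x)).
Proof. by move=> fi gi; exact: (integrableB mD fi gi). Qed.

Lemma integrable_realZ k f : mu.-integrable D (EFin \o f) ->
  mu.-integrable D (EFin \o (fun x => k * f x)).
Proof. by move=> fi; exact: (integrableZl mD k fi). Qed.

Lemma integrable_real_sum (I : Type) (s : seq I) (f : I -> T -> R) :
  (forall i, mu.-integrable D (EFin \o f i)) ->
  mu.-integrable D (EFin \o (fun x => \sum_(i <- s) f i x)).
Proof.
move=> fi; have := @integrable_sum _ _ _ mu D mD I s xpredT _ (fun i _ => fi i).
by apply: eq_integrable => // x _; rewrite /= sumEFin.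
Qed.

Lemma Rintegral_sum (I : Type) (s : seq I) (f : I -> T -> R) :
  (forall i, mu.-integrable D (EFin \o f i)) ->
  \int[mu]_(x in D) (\sum_(i <- s) f i x) = \sum_(i <- s) \int[mu]_(x in D) f i x.
Proof.
move=> fi; elim: s => [|i s IH].
  rewrite big_nil; under eq_Rintegral do rewrite big_nil.
  by rewrite /Rintegral integral0.
rewrite big_cons -IH -RintegralD//; last exact: integrable_real_sum.
by apply: eq_Rintegral => x _; rewrite big_cons.
Qed.

End real_integrable.

(** * Gaussian vectors *)

Section gaussian_law.
Context {R : realType}.
Local Notation mu := (@lebesgue_measure R).
Local Notation gam := (normal_prob (0 : R) 1).

Lemma normal_peakE (s : R) : 0 < s -> s * normal_peak s = normal_peak 1.
Proof.
move=> s0; rewrite /normal_peak -mulrnAr sqrtrM ?sqr_ge0// sqrtr_sqr gtr0_norm//.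
by rewrite invfM mulrA mulfV ?gt_eqF// mul1r expr1n mul1r.
Qed.

Lemma normal_pdf_affine (m s x : R) : 0 < s ->
  s * normal_pdf m s (s * x + m) = normal_pdf 0 1 x.
Proof.
move=> s0; rewrite !normal_pdfE ?gt_eqF// mulrA normal_peakE//; congr (_ * expR _).
rewrite addrK subr0 expr1n; field; rewrite gt_eqF//.
Qed.

Lemma normal_prob_affine (m s : R) (A : set R) : 0 < s -> measurable A ->
  normal_prob m s A = gam ((fun x => s * x + m) @^-1` A).
Proof.
move=> s0 mA.
have mp : measurable_fun A (fun x => (s * normal_pdf m s x)%:E).
  apply/measurable_EFinP/measurable_funTS; apply: measurable_funM => //.
  exact: measurable_normal_pdf.
have p0 x : A x -> (0 <= (s * normal_pdf m s x)%:E)%E.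
  by move=> _; rewrite lee_fin mulr_ge0 ?normal_pdf_ge0// ltW.
have := ge0_integral_affine m s0 mA mp p0.
under eq_integral do rewrite normal_pdf_affine//.
rewrite /normal_prob => ->; under [in RHS]eq_integral do rewrite EFinM.
rewrite ge0_integralZl_EFin ?(ltW s0)//.
- by rewrite muleA -EFinM mulVf ?gt_eqF// mul1e.
- by move=> x _; rewrite lee_fin normal_pdf_ge0.
- by apply/measurable_EFinP/measurable_funTS; exact: measurable_normal_pdf.
Qed.

Lemma normal_prob_normr (m s : R) (A : set R) :
  normal_prob m s A = normal_prob m `|s| A.
Proof.
rewrite /normal_prob; apply: eq_integral => x _; congr EFin.
have [->|s0] := eqVneq s 0; first by rewrite normr0.
rewrite !normal_pdfE ?normr_eq0// /normal_peak /normal_fun.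
by rewrite real_normK// num_real.
Qed.

(* The case [s = 0] is the Dirac mass of [normal_rv]. *)
Lemma normal_rv_pushforward d (T : measurableType d) (P : probability T R) (Y : T -> R) :
  normal_rv P Y -> exists m s : R, 0 <= s /\ forall A : set R, measurable A ->
    P (Y @^-1` A) = gam ((fun x => s * x + m) @^-1` A).
Proof.
move=> [m [s YE]]; exists m, `|s|; split => // A mA.
have := YE A mA; rewrite /pushforward => ->; case: eqVneq => [->|s0].
  rewrite normr0 diracE; have [mA'|mA'] := boolP (m \in A).
    rewrite (_ : _ @^-1` A = setT) ?probability_setT//.
    apply/seteqP; split => x //= _; rewrite mul0r add0r; exact/set_mem.
  rewrite (_ : _ @^-1` A = set0) ?measure0//.
  apply/seteqP; split => x //=; rewrite mul0r add0r => Am.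
  by move: mA'; rewrite notin_setE.
by rewrite normal_prob_normr normal_prob_affine// normr_gt0.
Qed.

Lemma ge0_integral_gauss (f : R -> R) : measurable_fun [set: R] f ->
  (forall x, 0 <= f x) ->
  (\int[gam]_x (f x)%:E = \int[mu]_x (f x * normal_pdf 0 1 x)%:E)%E.
Proof.
move=> mf f0.
rewrite (@ge0_integral_density _ _ R mu gam (normal_pdf 0 1)).
- by under eq_integral do rewrite -EFinM.
- exact: measurable_normal_pdf.
- exact: normal_pdf_ge0.
- by [].
- exact/measurable_EFinP.
- by move=> x; rewrite lee_fin.
Qed.

(** The integrand times the standard density is [s] times the normal density of standard deviation
    [s], the inverse square root of 1 + c. Applied with [c = - 2^-1] to integrate the square, with
    [c = 1] to bound its integral from below, and with a variance as [c] to recover that variance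
    from a bounded test function. *)
Lemma integral_gauss_exp_sqr (c : R) : -1 < c ->
  (\int[gam]_x (expR (- (c * x ^+ 2 / 2)))%:E = ((Num.sqrt (1 + c))^-1)%:E)%E.
Proof.
move=> c1; have c0 : 0 < 1 + c by lra.
pose s := (Num.sqrt (1 + c))^-1.
have s0 : 0 < s by rewrite invr_gt0 sqrtr_gt0.
rewrite ge0_integral_gauss; last 2 first.
- by apply: continuous_measurable_fun => x; auto_continuous.
- by move=> x; exact: expR_ge0.
transitivity (\int[mu]_x (s%:E * (normal_pdf 0 s x)%:E))%E.
  apply: eq_integral => x _; rewrite -EFinM; congr EFin.
  rewrite !normal_pdfE ?gt_eqF// [RHS]mulrA normal_peakE// mulrCA; congr (_ * _).
  rewrite /normal_fun -expRD; congr expR.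
  have -> : s ^+ 2 = (1 + c)^-1 by rewrite exprVn sqr_sqrtr// ltW.
  by rewrite !subr0 expr1n; field; rewrite gt_eqF.
rewrite ge0_integralZl_EFin ?(ltW s0)//.
- by rewrite integral_normal_pdf mule1.
- by move=> x _; rewrite lee_fin normal_pdf_ge0.
- by apply/measurable_EFinP; exact: measurable_normal_pdf.
Qed.

(* Its value is 1, but only its positivity matters. *)
Definition gauss_var : R := \int[gam]_x (x ^+ 2).

Lemma measurable_sqr : measurable_fun [set: R] (fun x : R => x ^+ 2).
Proof. exact: measurable_funX. Qed.

Lemma integrable_gauss_sqr : gam.-integrable [set: R] (EFin \o (fun x : R => x ^+ 2)).
Proof.
(* The bound comes from x^2 <= 4 exp (x^2 / 4). *)
pose r := 4 * (Num.sqrt (1 + - 2^-1))^-1 : R.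
apply: (@ge0_integrable _ _ _ _ _ _ r); [exact: measurable_sqr|by move=> x _; exact: sqr_ge0|].
rewrite /r EFinM -integral_gauss_exp_sqr; last by lra.
have mE : measurable_fun [set: R] (fun x : R => expR (- (- 2^-1 * x ^+ 2 / 2))).
  by apply: continuous_measurable_fun => x; auto_continuous.
rewrite -ge0_integralZl_EFin//; last exact/measurable_EFinP.
apply: ge0_le_integral => //.
- by move=> x _; rewrite lee_fin sqr_ge0.
- by apply/measurable_EFinP; exact: measurable_sqr.
- by apply/measurable_EFinP; exact: measurable_funM.
move=> x _; rewrite -EFinM lee_fin.
have := expR_ge1Dx (- (- 2^-1 * x ^+ 2 / 2)); lra.
Qed.

Lemma integral_gauss_sqr : (\int[gam]_x (x ^+ 2)%:E = gauss_var%:E)%E.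
Proof.
by rewrite /gauss_var /Rintegral fineK//; exact: integrable_fin_num integrable_gauss_sqr.
Qed.

(** The inequality 1 <= exp (- x^2 / 2) + x^2 integrates to 1 <= 1 / sqrt 2 + [gauss_var]. *)
Lemma gauss_var_gt0 : 0 < gauss_var.
Proof.
have mE : measurable_fun [set: R] (fun x : R => expR (- (1 * x ^+ 2 / 2))).
  by apply: continuous_measurable_fun => x; auto_continuous.
have h : (1%:E <= \int[gam]_x (expR (- (1 * x ^+ 2 / 2)) + x ^+ 2)%:E)%E.
  rewrite -[leLHS](@probability_setT _ _ _ gam) -[leLHS]mul1e -integral_cst//.
  apply: ge0_le_integral => //.
  - apply/measurable_EFinP; apply: measurable_funD => //; exact: measurable_sqr.
  - move=> x _; rewrite lee_fin; have := expR_ge1Dx (- (1 * x ^+ 2 / 2)).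
    by have := sqr_ge0 x; lra.
move: h; under eq_integral do rewrite EFinD.
rewrite ge0_integralD//.
- rewrite integral_gauss_sqr integral_gauss_exp_sqr; last by lra.
  rewrite -EFinD lee_fin; suff : (Num.sqrt (1 + 1 : R))^-1 < 1 by lra.
  rewrite invf_lt1 ?sqrtr_gt0 ?ltr0n// -[ltLHS]sqrtr1 ltr_sqrt//; lra.
- exact/measurable_EFinP.
- by move=> x _; rewrite lee_fin sqr_ge0.
- by apply/measurable_EFinP; exact: measurable_sqr.
Qed.

Lemma integrable_gauss_id : gam.-integrable [set: R] (EFin \o (fun x : R => x)).
Proof.
have i1 : gam.-integrable [set: R] (EFin \o (fun x : R => 1 + x ^+ 2)).
  apply: integrable_realD => //; last exact: integrable_gauss_sqr.
  exact: finite_measure_integrable_cst.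
apply: le_integrable i1 => //; first by apply/measurable_EFinP; exact: measurable_id.
move=> x _; rewrite /= lee_fin ler_norml.
have : 0 <= 1 + x ^+ 2 by rewrite addr_ge0// sqr_ge0.
by move=> /ger0_norm ->; nra.
Qed.

Lemma normal_probN (A : set R) : measurable A -> gam (-%R @^-1` A) = gam A.
Proof.
move=> mA; rewrite /normal_prob.
have mN : measurable_fun [set: measurableTypeR R] (-%R : measurableTypeR R -> measurableTypeR R).
  exact: oppr_measurable.
have mp : measurable_fun A (EFin \o normal_pdf (0 : R) 1).
  by apply/measurable_EFinP/measurable_funTS; exact: measurable_normal_pdf.
transitivity (\int[mu]_(x in -%R @^-1` A) ((EFin \o normal_pdf 0 1) \o -%R) x)%E.
  apply: eq_integral => x _; congr EFin.
  by rewrite /= !normal_pdfE ?oner_eq0// /normal_fun !subr0 sqrrN.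
rewrite -(@ge0_integral_pushforward _ _ _ _ _ _ mN mu A)//; last first.
  by move=> y _; rewrite lee_fin normal_pdf_ge0.
by apply: eq_measure_integral => B mB _; exact: lebesgue_measureN.
Qed.

Lemma Rintegral_gauss_id : \int[gam]_x x = 0.
Proof.
have mN : measurable_fun [set: measurableTypeR R] (-%R : measurableTypeR R -> measurableTypeR R).
  exact: oppr_measurable.
have : (\int[gam]_x x%:E = \int[gam]_x (- x)%:E)%E.
  transitivity (\int[pushforward gam (-%R : measurableTypeR R -> measurableTypeR R)]_x x%:E)%E.
    by apply: eq_measure_integral => A mA _; exact: (esym (normal_probN mA)).
  rewrite integral_pushforward//.
  by rewrite preimage_setT; exact: (integrableN integrable_gauss_id).
under [RHS]eq_integral do rewrite EFinN.
rewrite integralN/=; last exact: integrable_add_def integrable_gauss_id.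
rewrite /Rintegral; case: (integral _ _ _) => //= r [] /eqP.
by rewrite -subr_eq0 opprK -mulr2n mulrn_eq0/= => /eqP.
Qed.

Definition gauss_expect (h : R -> R) (s : R) : R := \int[gam]_x h (s * x).

Lemma integral_prob_cst d (T : measurableType d) (P : probability T R) (r : R) :
  (\int[P]_x r%:E = r%:E)%E.
Proof. by rewrite integral_cst//= probability_setT mule1. Qed.

Lemma integrable_prob_bounded d (T : measurableType d) (P : probability T R)
    (f : T -> R) (K : R) : measurable_fun [set: T] f -> (forall x, `|f x| <= K) ->
  P.-integrable [set: T] (EFin \o f).
Proof.
move=> mf fK; apply: (le_integrable _ _ _ (finite_measure_integrable_cst P K measurableT)) => //.
  exact/measurable_EFinP.
by move=> x _; rewrite /= lee_fin (le_trans (fK x))// ler_norm.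
Qed.

Section centered.
Context d (T : measurableType d) (P : probability T R) (Y : T -> R).
Hypothesis mY : measurable_fun [set: T] Y.
Hypothesis nY : normal_rv P Y.

Let maff (m s : R) : measurable_fun [set: R] (fun x : R => s * x + m).
Proof. by apply: measurable_funD => //; exact: measurable_funM. Qed.

Lemma normal_rv_ge0_integral : exists m s : R, 0 <= s /\
  forall f : R -> \bar R, measurable_fun [set: R] f -> (forall x, 0 <= f x)%E ->
    (\int[P]_w f (Y w) = \int[gam]_x f (s * x + m)%R)%E.
Proof.
have [m [s [s0 YE]]] := normal_rv_pushforward nY; exists m, s; split => // f mf f0.
have mY' : measurable_fun [set: T] (Y : T -> measurableTypeR R) by [].
have ma' : measurable_fun [set: measurableTypeR R]
  ((fun x => s * x + m) : measurableTypeR R -> measurableTypeR R) := maff m s.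
rewrite -[LHS](@ge0_integral_pushforward _ _ _ _ _ _ mY' P setT)//.
rewrite -[RHS](@ge0_integral_pushforward _ _ _ _ _ _ ma' gam setT)//.
by apply: eq_measure_integral => A mA _; exact: YE.
Qed.

Lemma centered_normal_law : ('E_P[Y] = 0)%E -> exists s : R, 0 <= s /\
  forall f : R -> \bar R, measurable_fun [set: R] f -> (forall x, 0 <= f x)%E ->
    (\int[P]_w f (Y w) = \int[gam]_x f (s * x)%R)%E.
Proof.
have [m [s [s0 YE]]] := normal_rv_ge0_integral; rewrite unlock => EY0.
suff m0 : m = 0.
  by exists s; split => // f mf f0; rewrite YE//; apply: eq_integral => x _; rewrite m0 addr0.
(* [YE] transfers nonnegative functions only, hence the separate treatment of positive and negative
   parts. The right-hand side is [m], because the standard normal law is centred. *)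
have : (\int[P]_w (Y w)%:E = \int[gam]_x (s * x + m)%:E)%E.
  rewrite integralE [RHS]integralE; congr (_ - _)%E.
  - have YEp := YE (fun y : R => maxe y%:E 0).
    transitivity (\int[P]_w maxe (Y w)%:E 0)%E.
      by apply: eq_integral => w _; rewrite funeposE.
    rewrite YEp.
    + by apply: eq_integral => x _; rewrite funeposE.
    + by apply: measurable_maxe => //; apply/measurable_EFinP; exact: measurable_id.
    + by move=> x; rewrite le_max lexx orbT.
  - have YEn := YE (fun y : R => maxe (- y%:E) 0)%E.
    transitivity (\int[P]_w maxe (- (Y w)%:E) 0)%E.
      by apply: eq_integral => w _; rewrite funenegE.
    rewrite YEn.
    + by apply: eq_integral => x _; rewrite funenegE.
    + by apply: measurable_maxe => //; apply/measurable_EFinP; exact: oppr_measurable.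
    + by move=> x; rewrite le_max lexx orbT.
rewrite EY0; under eq_integral do rewrite EFinD EFinM.
rewrite integralD//; last 2 first.
- exact: (integrableZl measurableT s integrable_gauss_id).
- exact: finite_measure_integrable_cst.
rewrite integralZl//; last exact: integrable_gauss_id.
rewrite (integral_prob_cst gam m).
have -> : (\int[gam]_x x%:E = 0)%E.
  rewrite -(fineK (integrable_fin_num _ integrable_gauss_id))//.
  by have := Rintegral_gauss_id; rewrite /Rintegral => ->.
by rewrite mule0 add0e => -[].
Qed.

Lemma centered_normal_expectation (h : R -> R) (v : R) :
  ('E_P[Y] = 0)%E -> ('E_P[(fun w => Y w * Y w)%R] = v%:E)%E ->
  measurable_fun [set: R] h -> bounded_fun h ->
  'E_P[h \o Y]%E = (gauss_expect h (Num.sqrt (v / gauss_var)))%:E.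
Proof.
move=> EY0 EY2 mh [M [_ Mh]].
have [s [s0 YE]] := centered_normal_law EY0.
have sE : Num.sqrt (v / gauss_var) = s.
  suff -> : v = s ^+ 2 * gauss_var.
    by rewrite mulfK ?gt_eqF ?gauss_var_gt0// sqrtr_sqr ger0_norm.
  apply/EFin_inj; rewrite -EY2 unlock EFinM -integral_gauss_sqr.
  have -> : (\int[P]_w (Y w * Y w)%:E = \int[gam]_x (s * x * (s * x))%:E)%E.
    apply: (YE (fun y : R => (y * y)%:E)).
      by apply/measurable_EFinP; exact: measurable_funM.
    by move=> x; rewrite lee_fin -expr2 sqr_ge0.
  rewrite -ge0_integralZl_EFin ?sqr_ge0//; last 2 first.
  - by move=> x _; rewrite lee_fin sqr_ge0.
  - by apply/measurable_EFinP; exact: measurable_sqr.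
  by apply: eq_integral => x _; rewrite -EFinM; congr EFin; ring.
(* [bounded_fun] gives a bound for each number strictly above [M], whence [M + 1]. Adding this
   constant makes [h] nonnegative, so that [YE] applies. *)
have hb (x : R) : `|h x| <= M + 1 by apply: (Mh (M + 1)) => //; rewrite ltrDl.
pose K := M + 1.
have hK0 (x : R) : 0 <= h x + K by have := hb x; rewrite ler_norml => /andP[]; rewrite /K; lra.
have mhK : measurable_fun [set: R] (fun x => (h x + K)%:E).
  by apply/measurable_EFinP; exact: measurable_funD.
have mhY : measurable_fun [set: T] (h \o Y) by exact: measurableT_comp.
have ihY : P.-integrable [set: T] (EFin \o (h \o Y)).
  by apply: (@integrable_prob_bounded _ _ _ _ K) => // w; exact: hb.
have ihg : gam.-integrable [set: R] (EFin \o (fun x : R => h (s * x))).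
  apply: (@integrable_prob_bounded _ _ _ _ K) => [|x]; last exact: hb.
  by apply: measurableT_comp => //; exact: measurable_funM.
have := YE (fun x => (h x + K)%:E) mhK (fun x => hK0 x).
under eq_integral do rewrite EFinD; under [RHS]eq_integral do rewrite EFinD.
rewrite integralD//; last exact: finite_measure_integrable_cst.
rewrite [RHS]integralD//; last exact: finite_measure_integrable_cst.
rewrite (integral_prob_cst P K) (integral_prob_cst gam K).
rewrite sE /gauss_expect /Rintegral fineK ?integrable_fin_num// unlock.
by move=> /(congr1 (fun z => z - K%:E)%E); rewrite !addeK.
Qed.

End centered.

Lemma gauss_expect_cvg (h : R -> R) (s : nat -> R) (l : R) :
  continuous h -> bounded_fun h -> s n @[n --> \oo] --> l ->
  gauss_expect h (s n) @[n --> \oo] --> gauss_expect h l.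
Proof.
move=> ch [M [_ Mh]] sl; pose K := M + 1.
have hb (x : R) : `|h x| <= K by apply: (Mh (M + 1)) => //; rewrite ltrDl.
have mh c : measurable_fun [set: R] (fun x : R => (h (c * x))%:E).
  apply/measurable_EFinP; apply: measurableT_comp; last exact: measurable_funM.
  exact: continuous_measurable_fun.
have fin c : (\int[gam]_x (h (c * x))%:E \is a fin_num)%E.
  apply: integrable_fin_num => //.
  apply: (@integrable_prob_bounded _ _ _ _ K) => [|x]; last exact: hb.
  by apply/measurable_EFinP; exact: mh.
apply: fine_cvg; rewrite fineK//.
apply: (@dominated_cvg _ _ _ gam setT measurableT _ _ (EFin \o cst K)) => //.
- by move=> n; exact: mh.
- move=> x _; apply: cvg_EFin; first by near=> n.
  rewrite /comp/=; apply: (cvg_comp _ h); last exact: ch.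
  by apply: cvgM => //; exact: cvg_cst.
- exact: finite_measure_integrable_cst.
- by move=> n x _; rewrite /= lee_fin.
Unshelve. all: by end_near. Qed.

End gaussian_law.

(** * Multivariate Bernstein approximation *)

Section bernstein.
Context {R : realType}.

(* [bernstein_op s n f] is the expectation of [f] under the binomial law
   with parameters [n] and [s]. *)
Fixpoint bernstein_op (s : R) (n : nat) (f : nat -> R) : R :=
  if n is m.+1 then s * bernstein_op s m (fun i => f i.+1) +
                    (1 - s) * bernstein_op s m f
  else f 0%N.

Lemma bernstein_op_le s n f g : 0 <= s <= 1 -> (forall i, f i <= g i) ->
  bernstein_op s n f <= bernstein_op s n g.
Proof.
move=> /andP[s0 s1]; elim: n f g => [|n IH] f g fg //=.
by rewrite lerD// ler_wpM2l ?subr_ge0// IH.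
Qed.

Lemma eq_bernstein_op s n f g : f =1 g -> bernstein_op s n f = bernstein_op s n g.
Proof. by move=> /funext ->. Qed.

Lemma bernstein_opD s n f g :
  bernstein_op s n (fun i => f i + g i) = bernstein_op s n f + bernstein_op s n g.
Proof. by elim: n f g => [|n IH] f g //=; rewrite !IH; ring. Qed.

Lemma bernstein_opZ s n c f :
  bernstein_op s n (fun i => c * f i) = c * bernstein_op s n f.
Proof. by elim: n f => [|n IH] f //=; rewrite !IH; ring. Qed.

Lemma bernstein_op_cst s n c : bernstein_op s n (fun=> c) = c.
Proof. by elim: n => [|n IH] //=; rewrite !IH; ring. Qed.

(** Variance plus squared bias. The centre [a] is arbitrary because the induction shifts it by 1. *)
Lemma bernstein_op_var s n a : bernstein_op s n (fun i => (i%:R - a) ^+ 2) =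
  n%:R * s * (1 - s) + (n%:R * s - a) ^+ 2.
Proof.
elim: n a => [|n IH] a /=; first by ring.
rewrite IH (eq_bernstein_op _ _ (g := fun i => (i%:R - (a - 1)) ^+ 2)).
  by rewrite IH -[n.+1]addn1 natrD; ring.
by move=> i; rewrite -[i.+1]addn1 natrD; ring.
Qed.

Context {k : nat}.

Definition update (x : 'I_k -> nat) (j : 'I_k) (i : nat) : 'I_k -> nat :=
  fun l => if l == j then i else x l.

(** The expectation of [F] when the coordinates listed in [cs] are independent binomial variables
    with parameters [n] and [s j], the other coordinates being frozen at [x]. *)
Fixpoint multi_bernstein (s : 'I_k -> R) (n : nat) (cs : seq 'I_k)
    (F : ('I_k -> nat) -> R) (x : 'I_k -> nat) : R :=
  if cs is j :: cs' then
    bernstein_op (s j) n (fun i => multi_bernstein s n cs' F (update x j i))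
  else F x.

Lemma multi_bernstein_le s n cs F G x : (forall j, 0 <= s j <= 1) ->
  (forall y, F y <= G y) -> multi_bernstein s n cs F x <= multi_bernstein s n cs G x.
Proof.
by move=> s01 FG; elim: cs x => [|j cs IH] x //=; apply: bernstein_op_le.
Qed.

Lemma multi_bernsteinD s n cs F G x :
  multi_bernstein s n cs (fun y => F y + G y) x =
  multi_bernstein s n cs F x + multi_bernstein s n cs G x.
Proof.
elim: cs x => [|j cs IH] x //=.
by rewrite -bernstein_opD; apply: eq_bernstein_op => i; rewrite IH.
Qed.

Lemma multi_bernsteinZ s n cs c F x :
  multi_bernstein s n cs (fun y => c * F y) x = c * multi_bernstein s n cs F x.
Proof.
elim: cs x => [|j cs IH] x //=.
by rewrite -bernstein_opZ; apply: eq_bernstein_op => i; rewrite IH.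
Qed.

Lemma multi_bernstein_cst s n cs c x : multi_bernstein s n cs (fun=> c) x = c.
Proof.
elim: cs x => [|j cs IH] x //=; under eq_bernstein_op do rewrite IH.
exact: bernstein_op_cst.
Qed.

Lemma multi_bernstein_sum s n cs (I : Type) (r : seq I) F x :
  multi_bernstein s n cs (fun y => \sum_(i <- r) F i y) x =
  \sum_(i <- r) multi_bernstein s n cs (F i) x.
Proof.
elim: r => [|i r IH].
  rewrite big_nil -[RHS](multi_bernstein_cst s n cs 0 x); congr multi_bernstein.
  by apply/funext => y; rewrite big_nil.
rewrite big_cons -IH -multi_bernsteinD; congr multi_bernstein.
by apply/funext => y; rewrite big_cons.
Qed.

Lemma multi_bernstein_coord s n cs j f x : uniq cs ->
  multi_bernstein s n cs (fun y => f (y j)) x =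
  if j \in cs then bernstein_op (s j) n f else f (x j).
Proof.
elim: cs j x => [|i cs IH] j x //= /andP[ics ucs].
rewrite inE; have [->|ji] /= := eqVneq j i.
  by apply: eq_bernstein_op => l; rewrite IH// (negbTE ics) /update eqxx.
under eq_bernstein_op => l do rewrite IH// /update (negbTE ji).
by rewrite bernstein_op_cst.
Qed.

(* Chebyshev's argument in Bernstein's proof of the Weierstrass theorem. *)
Lemma multi_bernstein_approx (s : 'I_k -> R) (n : nat) (F : ('I_k -> nat) -> R)
    (x0 : 'I_k -> nat) (c eps eta K : R) : (0 < n)%N ->
  (forall j, 0 <= s j <= 1) -> 0 <= eps -> 0 < eta -> 0 <= K ->
  (forall y, (forall j, `|(y j)%:R / n%:R - s j| < eta) -> `|F y - c| <= eps) ->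
  (forall y, `|F y - c| <= K) ->
  `|multi_bernstein s n (enum 'I_k) F x0 - c| <= eps + K * k%:R / (eta ^+ 2 * n%:R).
Proof.
move=> n0 s01 eps0 eta0 K0 near_c far_c.
have nR : 0 < n%:R :> R by rewrite ltr0n.
pose q j (i : nat) := ((i%:R : R) - n%:R * s j) ^+ 2.
(* A majorant of [F y - c] whose expectation is computable. If every coordinate is near, [eps]
   suffices; otherwise some [q j (y j)] is at least the square of [eta * n%:R], and the second term
   is at least [K]. *)
pose G y := eps + K / (eta * n%:R) ^+ 2 * \sum_(j <- enum 'I_k) q j (y j).
have FG y : `|F y - c| <= G y.
  have S0 : 0 <= \sum_(j <- enum 'I_k) q j (y j) by apply: sumr_ge0 => j _; exact: sqr_ge0.
  have D0 : 0 <= K / (eta * n%:R) ^+ 2 by rewrite divr_ge0// sqr_ge0.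
  have [h|/existsNP[j /negP]] := pselect (forall j, `|(y j)%:R / n%:R - s j| < eta).
    by rewrite (le_trans (near_c y h))// lerDl mulr_ge0.
  rewrite -leNgt => h; apply: (le_trans (far_c y)).
  rewrite /G ler_wpDl// -mulrA ler_peMr// mulrC ler_pdivlMr ?exprn_gt0 ?mulr_gt0//.
  rewrite mul1r (bigD1_seq j) ?mem_enum ?enum_uniq//=.
  apply: ler_wpDr; first by apply: sumr_ge0 => i _; exact: sqr_ge0.
  have -> : q j (y j) = `|((y j)%:R / n%:R - s j) * n%:R| ^+ 2.
    by rewrite real_normK ?num_real// mulrBl divfK ?gt_eqF// /q; congr (_ ^+ 2); ring.
  rewrite lerXn2r ?nnegrE ?mulr_ge0 ?(ltW eta0) ?(ltW nR)//.
  by rewrite normrM (gtr0_norm nR) ler_wpM2r// ltW.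
have GE : multi_bernstein s n (enum 'I_k) G x0 =
    eps + K / (eta * n%:R) ^+ 2 * \sum_(j <- enum 'I_k) n%:R * s j * (1 - s j).
  rewrite /G multi_bernsteinD multi_bernstein_cst multi_bernsteinZ multi_bernstein_sum.
  congr (_ + _ * _); apply: eq_bigr => j _.
  rewrite multi_bernstein_coord ?enum_uniq// mem_enum /=.
  by rewrite bernstein_op_var subrr expr0n addr0.
have GK : multi_bernstein s n (enum 'I_k) G x0 <= eps + K * k%:R / (eta ^+ 2 * n%:R).
  rewrite GE lerD2l.
  have : \sum_(j <- enum 'I_k) n%:R * s j * (1 - s j) <= n%:R * k%:R.
    have -> : n%:R * k%:R = \sum_(j <- enum 'I_k) n%:R :> R.
      by rewrite big_enum/= sumr_const card_ord mulr_natr.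
    apply: ler_sum => j _; have /andP[sj0 sj1] := s01 j.
    by rewrite -mulrA ler_piMr ?(ltW nR)// mulr_ile1// ?subr_ge0// lerBlDr lerDl.
  move=> h; apply: (@le_trans _ _ (K / (eta * n%:R) ^+ 2 * (n%:R * k%:R))).
    by rewrite ler_wpM2l// divr_ge0// sqr_ge0.
  by rewrite le_eqVlt; apply/orP; left; apply/eqP; field; rewrite !gt_eqF.
have FGc y : c - G y <= F y <= c + G y.
  by have := FG y; rewrite ler_norml => /andP[]; lra.
have lo : multi_bernstein s n (enum 'I_k) (fun y => c + -1 * G y) x0 <=
  multi_bernstein s n (enum 'I_k) F x0.
  by apply: multi_bernstein_le => // y; rewrite mulN1r; case/andP: (FGc y).
have hi : multi_bernstein s n (enum 'I_k) F x0 <=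
  multi_bernstein s n (enum 'I_k) (fun y => c + G y) x0.
  by apply: multi_bernstein_le => // y; case/andP: (FGc y).
clear GE; clearbody G; move: lo hi.
rewrite !multi_bernsteinD multi_bernsteinZ !multi_bernstein_cst ler_norml.
by move: GK; set B := eps + _ => GK lo hi; apply/andP; split; lra.
Qed.

End bernstein.

Section uniform_continuity.
Context {R : realType} {k : nat}.

(** Heine's theorem, by contradiction: among ever closer pairs violating the bound, the first
    components have a cluster point in [K], and continuity there is contradicted. *)
Lemma compact_uniform_continuous (K : set 'rV[R]_k) (f : 'rV[R]_k -> R) :
  compact K -> continuous f -> forall eps : R, 0 < eps ->
  exists2 eta : R, 0 < eta & forall u v, K u -> K v ->
    (forall j, `|u 0 j - v 0 j| < eta) -> `|f u - f v| <= eps.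
Proof.
move=> cK cf eps eps0; apply: contrapT => /forall2NP h.
have {}h (n : nat) : exists uv : 'rV[R]_k * 'rV[R]_k,
  [/\ K uv.1, K uv.2, (forall j, `|uv.1 0 j - uv.2 0 j| < n.+1%:R^-1) &
      eps < `|f uv.1 - f uv.2|].
  have [|] := h (n.+1%:R^-1); first by rewrite invr_gt0 ltr0n.
  move=> /existsNP[u /existsNP[v /not_implyP[Ku /not_implyP[Kv /not_implyP[uv fuv]]]]].
  by exists (u, v); split => //; rewrite ltNge; exact/negP.
have [uv uvP] := choice h.
have [|p [Kp clp]] := cK ((uv n).1 @[n --> \oo]) _.
  by exists 0%N => // n _ /=; have [] := uvP n.
have : \forall q \near p, `|f p - f q| < eps / 2.
  by have /cvgrPdist_lt := cf p; apply; rewrite divr_gt0.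
move=> /nbhs_ballP[e /= e0 pe].
have e20 : 0 < e / 2 by rewrite divr_gt0.
(* The cluster property is applied to a tail of the sequence, so that the index is large enough for
   both members of the pair to lie within [e] of [p]. *)
have [q [[n nN ->] pq]] : exists q,
    (exists2 n, (Num.truncn (2 / e) <= n)%N & q = (uv n).1) /\ ball p (e / 2) q.
  have [] := clp [set q | exists2 n, (Num.truncn (2 / e) <= n)%N & q = (uv n).1]
    (ball p (e / 2)).
  - by exists (Num.truncn (2 / e)) => // n /= ?; exists n.
  - exact: nbhsx_ballx.
  by move=> q [qn pq']; exists q.
have ne : n.+1%:R^-1 < e / 2.
  rewrite invf_plt ?posrE ?ltr0n// invf_div.
  by apply: lt_le_trans (truncnS_gt _) _; rewrite ler_nat ltnS.
have [_ _ uvn] := uvP n; apply/negP; rewrite -leNgt.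
have pu : ball p e (uv n).1.
  by apply: (le_ball _ pq); rewrite ler_pdivrMr// ler_pMr// ler1n.
have pv : ball p e (uv n).2.
  split=> // i j; rewrite (ord1 i) /ball/=.
  have [_ /(_ 0 j)] := pq; rewrite /ball/= => h1.
  have h2 := uvn j.
  rewrite (_ : p 0 j - (uv n).2 0 j =
    (p 0 j - (uv n).1 0 j) + ((uv n).1 0 j - (uv n).2 0 j)); last by ring.
  rewrite (le_lt_trans (ler_normD _ _))// (splitr e) ltrD//.
  exact: lt_trans ne.
have := pe _ pu; have := pe _ pv => /= h2 h1.
rewrite (_ : f _ - f _ = (f p - f (uv n).2) - (f p - f (uv n).1)); last by ring.
by rewrite (le_trans (ler_normB _ _))// (splitr eps) lerD// ltW.
Unshelve. all: by end_near. Qed.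

End uniform_continuity.

Lemma compact_cube {R : realType} (k : nat) (a b : R) :
  compact [set v : 'rV[R]_k | forall i, v ord0 i \in `[a, b]].
Proof.
apply: (@rV_compact _ k (fun=> `[a, b]%classic)).
by move=> _; apply: segment_compact.
Qed.

Lemma continuous_row_map {R : realType} (k : nat) (h : R -> R) :
  continuous h -> continuous (fun v : 'rV[R]_k => \row_j h (v 0 j)).
Proof.
move=> ch v; apply/(@cvg_ballP R _ _ (nbhs v)) => e e0.
have : \forall w \near v, forall j : 'I_k, ball (h (v 0 j)) e (h ((w : 'rV[R]_k) 0 j)).
  apply: (@filter_forall _ _ (fun (j : 'I_k) (w : 'rV[R]_k) =>
    ball (h (v 0 j)) e (h (w 0 j))) (nbhs v)) => j.
  have c : {for v, continuous (fun w : 'rV[R]_k => h (w 0 j))}.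
    apply: (@continuous_comp _ _ _ (fun w : 'rV[R]_k => w 0 j) h); last exact: ch.
    exact: coord_continuous.
  by have /cvg_ballP/(_ e e0) := c.
by apply: filterS => w H; split => // i j; rewrite !mxE; exact: H.
Qed.

(** * Trigonometric approximation of bounded continuous functions *)

Section trigonometric_sums.
Context {R : realType} {k : nat}.
Implicit Types (f g : ('I_k -> R) -> R) (t : R * ('I_k -> R) * R).

(** The triple consists of amplitude, frequency vector and phase. The phase accommodates sines, so
    that cosines alone form a class closed under products. *)
Definition trig_term t (y : 'I_k -> R) : R :=
  t.1.1 * cos (\sum_(j < k) t.1.2 j * y j + t.2).

Definition trig_sum f := exists s : seq (R * ('I_k -> R) * R),
  forall y, f y = \sum_(t <- s) trig_term t y.

Lemma trig_sum_cst c : trig_sum (fun=> c).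
Proof.
exists [:: (c, fun=> 0, 0)] => y; rewrite big_seq1 /trig_term/= big1 ?addr0 ?cos0 ?mulr1//.
by move=> j _; rewrite mul0r.
Qed.

Lemma trig_sum_coord (c b : R) (j : 'I_k) : trig_sum (fun y => cos (c * y j + b)).
Proof.
exists [:: (1, fun l => if l == j then c else 0, b)] => y.
rewrite big_seq1 /trig_term/= mul1r (bigD1 j)//= eqxx big1 ?addr0//.
by move=> i /negbTE ->; rewrite mul0r.
Qed.

Lemma trig_sumD f g : trig_sum f -> trig_sum g -> trig_sum (fun y => f y + g y).
Proof. by move=> [s sE] [r rE]; exists (s ++ r) => y; rewrite big_cat/= sE rE. Qed.

Lemma trig_termM t u y : trig_term t y * trig_term u y =
  trig_term (t.1.1 * u.1.1 / 2, (fun j => t.1.2 j + u.1.2 j), t.2 + u.2) y +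
  trig_term (t.1.1 * u.1.1 / 2, (fun j => t.1.2 j - u.1.2 j), t.2 - u.2) y.
Proof.
rewrite /trig_term/=.
set a := \sum_(j < k) t.1.2 j * y j; set b := \sum_(j < k) u.1.2 j * y j.
have -> : \sum_(j < k) (t.1.2 j + u.1.2 j) * y j = a + b.
  by rewrite -big_split/=; apply: eq_bigr => j _; rewrite mulrDl.
have -> : \sum_(j < k) (t.1.2 j - u.1.2 j) * y j = a - b.
  by rewrite -sumrB; apply: eq_bigr => j _; rewrite mulrBl.
have -> : a + b + (t.2 + u.2) = (a + t.2) + (b + u.2) by ring.
have -> : a - b + (t.2 - u.2) = (a + t.2) - (b + u.2) by ring.
by rewrite (cosD (a + t.2)) (cosB (a + t.2)); field.
Qed.

Lemma trig_sumM f g : trig_sum f -> trig_sum g -> trig_sum (fun y => f y * g y).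
Proof.
move=> [s sE] [r rE].
suff : trig_sum (fun y => (\sum_(t <- s) trig_term t y) * (\sum_(u <- r) trig_term u y)).
  by move=> [q qE]; exists q => y; rewrite sE rE.
elim: s {sE} => [|t s IH].
  have [q qE] := trig_sum_cst 0; exists q => y.
  by rewrite big_nil mul0r -qE.
suff tr : trig_sum (fun y => trig_term t y * \sum_(u <- r) trig_term u y).
  have [q qE] := trig_sumD tr IH; exists q => y; rewrite -qE.
  by rewrite big_cons mulrDl.
elim: r {rE IH} => [|u r IH].
  have [q qE] := trig_sum_cst 0; exists q => y.
  by rewrite big_nil mulr0 -qE.
have tu : trig_sum (fun y => trig_term t y * trig_term u y).
  by eexists [:: _; _] => y; rewrite trig_termM big_cons big_seq1.
have [q qE] := trig_sumD tu IH; exists q => y; rewrite -qE.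
by rewrite big_cons mulrDr.
Qed.

Lemma trig_sum_bernstein_op (s : ('I_k -> R) -> R) n (f : nat -> ('I_k -> R) -> R) :
  trig_sum s -> (forall i, trig_sum (f i)) ->
  trig_sum (fun y => bernstein_op (s y) n (f ^~ y)).
Proof.
move=> ts; elim: n f => [|n IH] f tf /=; first exact: tf.
apply: trig_sumD; apply: trig_sumM => //; last exact: IH.
  by apply: (IH (fun i => f i.+1)).
apply: trig_sumD; first exact: trig_sum_cst.
have [q qE] := trig_sumM (trig_sum_cst (-1)) ts; exists q => y.
by rewrite -qE mulN1r.
Qed.

Lemma trig_sum_multi_bernstein (s : ('I_k -> R) -> 'I_k -> R) n cs F x :
  (forall j, trig_sum (fun y => s y j)) ->
  trig_sum (fun y => multi_bernstein (s y) n cs F x).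
Proof.
move=> ts; elim: cs x => [|j cs IH] x /=; first exact: trig_sum_cst.
exact: (@trig_sum_bernstein_op _ _ (fun i y => multi_bernstein (s y) n cs F (update x j i))).
Qed.

(* Bernstein approximation in the variables [(1 + sin (y_j / L)) / 2], which
   parametrize the box [-L, L]^k; outside the box both sides are bounded. *)
Lemma trig_sum_approx (phi : 'rV[R]_k -> R) (L eps M : R) :
  continuous phi -> (forall v, `|phi v| <= M) -> 0 < L -> 0 < eps ->
  exists psi, [/\ trig_sum psi, (forall y, `|psi y| <= M) &
    forall y, (forall j, `|y j| <= L) -> `|psi y - phi (\row_j y j)| <= eps].
Proof.
move=> cphi phiM L0 eps0.
have M0 : 0 <= M by rewrite (le_trans _ (phiM 0)).
pose sn : R := sin 1.
have p2 : 1 <= pi / 2 :> R := pihalf_ge1 R.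
have p2' : pi / 2 < 2 :> R := pihalf_lt2 R.
have sn01 : 0 < sn < 1.
  apply/andP; split; first by apply: sin2_gt0; rewrite ltr01 ltr1n.
  have p1 : 1 < pi / 2 :> R.
    rewrite lt_neqAle p2 andbT; apply/eqP => e; have := @cos1_gt0 R.
    by rewrite e cos_pihalf ltxx.
  rewrite -(sin_pihalf R) /sn ltr_sin// in_itv/=; apply/andP; split; lra.
(* Truncation of t to [-sin 1, sin 1]. *)
pose clamp (t : R) := (`|t + sn| - `|t - sn|) / 2.
have clampb (t : R) : -1 < clamp t < 1.
  have /andP[s0 s1] := sn01; rewrite /clamp.
  by case: (ger0P (t + sn)) => h1; case: (ger0P (t - sn)) => h2; apply/andP; split; lra.
have cclamp : continuous clamp.
  move=> t; apply: cvgM; last exact: cvg_cst.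
  by apply: cvgB; apply: cvg_norm; [apply: cvgD|apply: cvgB] => //; exact: cvg_cst.
(* [gg] inverts the parametrization: for [y j] in [[-L, L]], the sine of [L^-1 * y j] lies in
   [[- sin 1, sin 1]], where [clamp] is the identity. Elsewhere the clamp keeps the argument inside
   the open interval on which [asin] is continuous. *)
pose gg (t : R) := L * asin (clamp (2 * t - 1)).
have casin : continuous (fun t : R => asin (clamp (2 * t - 1))).
  move=> t; apply: (@continuous_comp _ _ _ (fun t : R => clamp (2 * t - 1)) asin).
    apply: (@continuous_comp _ _ _ (fun t : R => 2 * t - 1) clamp); last exact: cclamp.
    by auto_continuous.
  exact: continuous_asin.
have cgg : continuous gg.
  by move=> t; apply: cvgM; [exact: cvg_cst|exact: casin].
pose s (y : 'I_k -> R) (j : 'I_k) := (1 + sin (L^-1 * y j)) / 2.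
have s01 y j : 0 <= s y j <= 1.
  have := sin_geN1 (L^-1 * y j); have := sin_le1 (L^-1 * y j); rewrite /s.
  by move=> h1 h2; apply/andP; split; lra.
have ggs y j : `|y j| <= L -> gg (s y j) = y j.
  move=> yL; have : `|L^-1 * y j| <= 1.
    by rewrite normrM normfV (gtr0_norm L0) ler_pdivrMl// mulr1.
  rewrite ler_norml => /andP[u1 u2].
  have -> : gg (s y j) = L * asin (clamp (sin (L^-1 * y j))).
    by rewrite /gg /s; congr (_ * asin (clamp _)); field.
  have -> : clamp (sin (L^-1 * y j)) = sin (L^-1 * y j).
    have h1 : - sn <= sin (L^-1 * y j).
      move: u1; rewrite le_eqVlt => /predU1P[<-|u1]; first by rewrite sinN.
      rewrite /sn -sinN ltW// ltr_sin// in_itv/=; apply/andP; split; lra.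
    have h2 : sin (L^-1 * y j) <= sn.
      move: u2; rewrite le_eqVlt => /predU1P[->//|u2].
      rewrite /sn ltW// ltr_sin// in_itv/=; apply/andP; split; lra.
    rewrite /clamp; have /andP[s0 s1] := sn01.
    by rewrite ger0_norm ?ler0_norm; [field|lra|lra].
  rewrite sinK; first by rewrite mulrA mulfV ?gt_eqF// mul1r.
  rewrite in_itv/=; apply/andP; split; lra.
pose Phi (v : 'rV[R]_k) := phi (\row_j gg (v 0 j)).
have cPhi : continuous Phi.
  move=> v; apply: (@continuous_comp _ _ _ (fun v : 'rV[R]_k => \row_j gg (v 0 j)) phi).
    exact: continuous_row_map.
  exact: cphi.
(* Points within [eta <= 1] of the unit cube remain in this larger cube. *)
pose K := [set v : 'rV[R]_k | forall j, v ord0 j \in `[-1, 2]].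
have cK : compact K by exact: compact_cube.
have [eta1 eta10 etaP] := compact_uniform_continuous cK cPhi (divr_gt0 eps0 (ltr0n _ 2)).
pose eta := Num.min eta1 1.
have eta0 : 0 < eta by rewrite lt_min eta10 ltr01.
have [N hN] : exists N, (2 * M) * k%:R / (eta ^+ 2 * N.+1%:R) <= eps / 2.
  exists (Num.truncn ((2 * M) * k%:R / eta ^+ 2 / (eps / 2))).
  set A := _ / (eps / 2); have := truncnS_gt A; set N1 := _.+1%:R.
  have e20 : 0 < eta ^+ 2 by rewrite exprn_gt0.
  rewrite /A ltr_pdivrMr ?divr_gt0// ltr_pdivrMr// => /ltW h.
  rewrite ler_pdivrMr ?mulr_gt0 ?ltr0n//; apply: le_trans h _.
  by rewrite (_ : N1 * _ * _ = eps / 2 * (eta ^+ 2 * N1))//; ring.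
set n := N.+1 in hN; have n0 : (0 < n)%N by [].
pose F (x : 'I_k -> nat) := Phi (\row_j ((x j)%:R / n%:R)).
have PhiM v : `|Phi v| <= M by exact: phiM.
exists (fun y => multi_bernstein (s y) n (enum 'I_k) F (fun=> 0%N)); split.
- apply: trig_sum_multi_bernstein => j.
  have [q qE] := trig_sumD (trig_sum_cst 2^-1)
    (trig_sumM (trig_sum_cst 2^-1) (trig_sum_coord L^-1 (- (pi / 2)) j)).
  by exists q => y; rewrite -qE /s cosBpihalf; field.
- move=> y; rewrite ler_norml -(multi_bernstein_cst (s y) n (enum 'I_k) (- M) (fun=> 0%N)).
  rewrite -[X in _ && (_ <= X)](multi_bernstein_cst (s y) n (enum 'I_k) M (fun=> 0%N)).
  by apply/andP; split; apply: multi_bernstein_le => // x; have := PhiM (\row_j ((x j)%:R / n%:R));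
    rewrite ler_norml => /andP[].
move=> y yL.
have -> : phi (\row_j y j) = Phi (\row_j s y j).
  by rewrite /Phi; congr phi; apply/rowP => j; rewrite !mxE ggs.
rewrite (splitr eps).
apply: le_trans (multi_bernstein_approx (eps := eps / 2) (K := 2 * M) (fun=> 0%N) n0 (s01 y) _ eta0 _ _ _) _.
- by rewrite divr_ge0// ltW.
- by rewrite mulr_ge0.
- move=> x hx; apply: etaP.
  + move=> j; rewrite /= mxE in_itv/=; have := hx j.
    rewrite lt_min => /andP[_]; rewrite ltr_norml => /andP[h1 h2].
    by have /andP[] := s01 y j => s0 s1; apply/andP; split; lra.
  + move=> j; rewrite /= mxE in_itv/=; have /andP[] := s01 y j => s0 s1; apply/andP; split; lra.
  + by move=> j; rewrite !mxE; have := hx j; rewrite lt_min => /andP[].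
- move=> x; rewrite (le_trans (ler_normB _ _))// mulr_natl mulr2n lerD//; exact: PhiM.
- by rewrite lerD2l.
Qed.

End trigonometric_sums.

(** * Measurability of random vectors *)

Section random_vector_measurability.
Context {R : realType} {I : Type} (Y : random_field R I).
Variables (k : nat) (p : 'I_k -> I).
Local Notation vec := (@rf_vector R I Y k p).

(** Only the coordinates are known to be measurable. An open set is a countable union of boxes with
    rational centre and radius 1 / (m + 1), and the preimage of a box is a finite intersection of
    coordinate events. *)
Lemma open_preimage_rf_vector (U : set 'rV[R]_k) : open U ->
  measurable (vec @^-1` U).
Proof.
move=> oU.
pose B (qm : 'rV[rat]_k * nat) : set 'rV[R]_k :=
  [set v | forall j, `|ratr (qm.1 0 j) - v 0 j| < qm.2.+1%:R^-1].
pose F qm := if pselect (B qm `<=` U) then vec @^-1` (B qm) else set0.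
have -> : vec @^-1` U = \bigcup_qm F qm.
  apply/seteqP; split => w /=; last first.
    by move=> [qm _]; rewrite /F; case: pselect => // BU /= Bw; exact: (BU _ Bw).
  move=> Uw; have := open_nbhs_nbhs (conj oU Uw) => /nbhs_ballP[e /= e0 eU].
  have e20 : 0 < e / 2 by rewrite divr_gt0.
  pose m := Num.truncn (2 / e).
  have me : m.+1%:R^-1 < e / 2.
    by rewrite invf_plt ?posrE ?ltr0n// invf_div; exact: truncnS_gt.
  have m0 : 0 < m.+1%:R^-1 :> R by rewrite invr_gt0 ltr0n.
  have /choice[q qP] (j : 'I_k) : exists q : rat, `|ratr q - vec w 0 j| < m.+1%:R^-1.
    have : vec w 0 j - m.+1%:R^-1 < vec w 0 j + m.+1%:R^-1.
      by rewrite ltrBlDr -addrA ltrDl addr_gt0.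
    move=> /rat_in_itvoo[q]; rewrite in_itv/= => /andP[h1 h2]; exists q.
    by rewrite ltr_norml ltrBlDl h2 andbT ltrBrDl.
  have Bw : B (\row_j q j, m) (vec w) by move=> j /=; rewrite mxE.
  exists (\row_j q j, m) => //; rewrite /F; case: pselect => // nBU; exfalso.
  apply: nBU => v Bv; apply: eU; split => // i j; rewrite (ord1 i) /ball/=.
  have h1 := Bw j; have h2 := Bv j.
  rewrite (_ : vec w 0 j - v 0 j =
    (ratr ((\row_j q j, m).1 0 j) - v 0 j) - (ratr ((\row_j q j, m).1 0 j) - vec w 0 j)); last by ring.
  rewrite (le_lt_trans (ler_normB _ _))// (splitr e) ltrD//.
    exact: lt_trans me.
  exact: lt_trans me.
apply: countable_bigcupT_measurable; first exact: countableP.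
move=> qm; rewrite /F; case: pselect => [_|_] /=; last exact: measurable0.
have -> : vec @^-1` (B qm) =
    \bigcap_(j in [set: 'I_k]) [set w | `|ratr (qm.1 0 j) - Y (p j) w| < qm.2.+1%:R^-1].
  apply/seteqP; split => w /= h j; first by move=> _; have := h j; rewrite /rf_vector mxE.
  by have := h j Logic.I; rewrite /rf_vector mxE.
apply: fin_bigcap_measurable => // j _.
have mj : measurable_fun [set: rf_space Y] (fun w => `|ratr (qm.1 0 j) - Y (p j) w|).
  by apply: measurableT_comp => //; apply: measurable_funB => //; exact: rf_measurable.
rewrite -[X in measurable X]setTI.
have := mj measurableT `]-oo, qm.2.+1%:R^-1[%classic (measurable_itv _).
by congr (measurable (_ `&` _)); apply/seteqP; split => w /=; rewrite in_itv.
Qed.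

Lemma measurable_continuous_rf_vector (phi : 'rV[R]_k -> R) : continuous phi ->
  measurable_fun [set: rf_space Y] (phi \o vec).
Proof.
move=> cphi; apply: (measurability _ (RGenOInfty.measurableE R)).
move=> _ [_ [x ->] <-]; rewrite setTI comp_preimage.
apply: open_preimage_rf_vector; apply: open_comp; last exact: interval_open.
by move=> v _; exact: cphi.
Qed.

End random_vector_measurability.

Lemma cvg_real_sum {R : realType} (J : Type) (r : seq J) (f : J -> nat -> R) (l : J -> R) :
  (forall i, f i n @[n --> \oo] --> l i) ->
  \sum_(i <- r) f i n @[n --> \oo] --> \sum_(i <- r) l i.
Proof.
move=> fl; elim: r => [|i r IH].
  by under eq_fun do rewrite big_nil; rewrite big_nil; exact: cvg_cst.
by under eq_fun do rewrite big_cons; rewrite big_cons; exact: cvgD.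
Qed.

(** * From convergence of covariances to convergence of expectations *)

Section gaussian_fields.
Context {R : realType} {I : Type}.

Definition rf_cov (Y : random_field R I) (i j : I) : R :=
  \int[rf_prob Y]_w (Y i w * Y j w).

Section one_field.
Variable Y : random_field R I.
Hypothesis gY : gaussian Y.
Hypothesis zY : zero_mean Y.
Local Notation P := (rf_prob Y).

Lemma gaussian_component i : normal_rv P (Y i).
Proof.
have := gY (fun _ : 'I_1 => i) (fun=> 1).
by under eq_fun do rewrite big_ord1 mul1r.
Qed.

Lemma measurable_component i : measurable_fun [set: rf_space Y] (Y i).
Proof. exact: rf_measurable. Qed.

Lemma integrable_component_sqr i : P.-integrable [set: _] (EFin \o (fun w => Y i w ^+ 2)).
Proof.
have [s [s0 YE]] := centered_normal_law (measurable_component i) (gaussian_component i) (zY i).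
apply: (@ge0_integrable _ _ _ _ _ _ (s ^+ 2 * gauss_var)).
- by apply: measurable_funX; exact: measurable_component.
- by move=> w _; exact: sqr_ge0.
have -> : (\int[P]_w (Y i w ^+ 2)%:E = \int[normal_prob 0 1]_x ((s * x) ^+ 2)%:E)%E.
  apply: (YE (fun y => (y ^+ 2)%:E)); first by apply/measurable_EFinP; exact: measurable_sqr.
  by move=> x; rewrite lee_fin sqr_ge0.
rewrite EFinM -integral_gauss_sqr -ge0_integralZl_EFin ?sqr_ge0//.
- by rewrite le_eqVlt; apply/orP; left; apply/eqP/eq_integral => x _; rewrite exprMn EFinM.
- by move=> x _; rewrite lee_fin sqr_ge0.
- by apply/measurable_EFinP; exact: measurable_sqr.
Qed.

Lemma integrable_component i : P.-integrable [set: _] (EFin \o Y i).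
Proof.
have h : P.-integrable [set: _] (EFin \o (fun w => 1 + Y i w ^+ 2)).
  apply: integrable_realD => //; last exact: integrable_component_sqr.
  exact: finite_measure_integrable_cst.
apply: le_integrable h => //; first by apply/measurable_EFinP; exact: measurable_component.
move=> w _; rewrite /= lee_fin ler_norml.
have : 0 <= 1 + Y i w ^+ 2 by rewrite addr_ge0// sqr_ge0.
by move=> /ger0_norm ->; apply/andP; split; nra.
Qed.

Lemma integrable_component_mul i j :
  P.-integrable [set: _] (EFin \o (fun w => Y i w * Y j w)).
Proof.
have h := integrable_realD measurableT (integrable_component_sqr i) (integrable_component_sqr j).
apply: le_integrable h => //.
  by apply/measurable_EFinP; apply: measurable_funM; exact: measurable_component.
move=> w _; rewrite /= lee_fin ler_norml.
have : 0 <= Y i w ^+ 2 + Y j w ^+ 2 by rewrite addr_ge0// sqr_ge0.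
by move=> /ger0_norm ->; apply/andP; split; nra.
Qed.

Lemma rf_covE i j : 'E_P[(fun w => Y i w * Y j w)%R]%E = (rf_cov Y i j)%:E.
Proof.
rewrite unlock /rf_cov /Rintegral fineK//.
exact: integrable_fin_num (integrable_component_mul i j).
Qed.

Variables (k : nat) (p : 'I_k -> I).

Lemma lincomb_mean0 (a : 'I_k -> R) :
  'E_P[(fun w => \sum_(j < k) a j * Y (p j) w)%R]%E = 0%E.
Proof.
have ij j : P.-integrable [set: _] (EFin \o (fun w => a j * Y (p j) w)).
  exact: (integrable_realZ measurableT (a j) (integrable_component (p j))).
have E0 j : \int[P]_w Y (p j) w = 0.
  by have := zY (p j); rewrite unlock /Rintegral => ->.
rewrite unlock -(fineK (integrable_fin_num _ (integrable_real_sum measurableT _ ij)))//.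
have := Rintegral_sum measurableT (index_enum 'I_k) ij; rewrite {1}/Rintegral => ->.
rewrite big1// => j _; rewrite RintegralZl ?E0 ?mulr0//.
exact: integrable_component.
Qed.

Definition lincomb_var (c : I -> I -> R) (a : 'I_k -> R) : R :=
  \sum_(i < k) \sum_(j < k) a i * a j * c (p i) (p j).

Lemma lincomb_second_moment (a : 'I_k -> R) :
  'E_P[(fun w => (\sum_(j < k) a j * Y (p j) w) * (\sum_(j < k) a j * Y (p j) w))%R]%E =
  (lincomb_var (rf_cov Y) a)%:E.
Proof.
pose f (i j : 'I_k) w := a i * a j * (Y (p i) w * Y (p j) w).
have fi i j : P.-integrable [set: _] (EFin \o f i j).
  exact: (integrable_realZ measurableT (a i * a j) (integrable_component_mul (p i) (p j))).
have fs i : P.-integrable [set: _] (EFin \o (fun w => \sum_(j < k) f i j w)).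
  exact: integrable_real_sum.
have -> : (fun w => (\sum_(j < k) a j * Y (p j) w) * (\sum_(j < k) a j * Y (p j) w)) =
    (fun w => \sum_(i < k) \sum_(j < k) f i j w).
  apply/funext => w; rewrite mulr_suml; apply: eq_bigr => i _.
  by rewrite mulr_sumr; apply: eq_bigr => j _; rewrite /f; ring.
rewrite unlock -(fineK (integrable_fin_num _ (integrable_real_sum measurableT _ fs)))//.
congr EFin; have := Rintegral_sum measurableT (index_enum 'I_k) fs; rewrite {1}/Rintegral => ->.
apply: eq_bigr => i _; rewrite Rintegral_sum//.
apply: eq_bigr => j _; rewrite /f RintegralZl//.
exact: integrable_component_mul.
Qed.

Lemma measurable_lincomb (a : 'I_k -> R) :
  measurable_fun [set: _] (fun w => \sum_(j < k) a j * Y (p j) w).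
Proof.
by apply: measurable_sum => j; apply: measurable_funM => //; exact: rf_measurable.
Qed.

Definition rf_point (w : rf_space Y) : 'I_k -> R := fun j => Y (p j) w.

Lemma measurable_trig_term t :
  measurable_fun [set: _] (fun w => trig_term t (rf_point w)).
Proof.
apply: measurable_funM => //; apply: measurableT_comp.
  by apply: continuous_measurable_fun; exact: continuous_cos.
by apply: measurable_funD => //; exact: measurable_lincomb.
Qed.

Lemma integrable_trig_term t :
  P.-integrable [set: _] (EFin \o (fun w => trig_term t (rf_point w))).
Proof.
apply: (@integrable_prob_bounded _ _ _ _ _ `|t.1.1|); first exact: measurable_trig_term.
by move=> w; rewrite normrM ler_piMr// cos_max.
Qed.

(** The mean of a trigonometric term under a centred Gaussian law, as a function of its covariance
    only. It is thus defined for a limit covariance that is not yet attached to any field. *)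
Definition trig_limit (c : I -> I -> R) (t : R * ('I_k -> R) * R) : R :=
  t.1.1 * gauss_expect (fun x => cos (x + t.2)) (Num.sqrt (lincomb_var c t.1.2 / gauss_var)).

Lemma continuous_cos_shift (b : R) : continuous (fun x : R => cos (x + b)).
Proof. by move=> x; auto_continuous. Qed.

Lemma bounded_cos_shift (b : R) : bounded_fun (fun x : R => cos (x + b)).
Proof.
exists 1; split; first exact: num_real.
by move=> x x1 y _ /=; rewrite (le_trans (cos_max _))// ltW.
Qed.

Lemma Rintegral_trig_term t :
  \int[P]_w trig_term t (rf_point w) = trig_limit (rf_cov Y) t.
Proof.
rewrite RintegralZl//; last first.
  apply: (@integrable_prob_bounded _ _ _ _ _ 1); last by move=> w; exact: cos_max.
  apply: measurableT_comp; last by apply: measurable_funD => //; exact: measurable_lincomb.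
  by apply: continuous_measurable_fun; exact: continuous_cos.
congr (_ * _).
have := centered_normal_expectation (measurable_lincomb t.1.2) (gY p t.1.2)
  (lincomb_mean0 t.1.2) (lincomb_second_moment t.1.2)
  (continuous_measurable_fun (@continuous_cos_shift t.2)) (@bounded_cos_shift t.2).
by rewrite unlock /Rintegral => ->.
Qed.

End one_field.

Lemma lincomb_var_cvg k (p : 'I_k -> I) (c : nat -> I -> I -> R) (C : I -> I -> R) a :
  (forall i j, c n i j @[n --> \oo] --> C i j) ->
  lincomb_var p (c n) a @[n --> \oo] --> lincomb_var p C a.
Proof.
move=> cC; apply: cvg_real_sum => i; apply: cvg_real_sum => j.
by apply: cvgM; [exact: cvg_cst|exact: cC].
Qed.

Lemma trig_limit_cvg k (p : 'I_k -> I) (c : nat -> I -> I -> R) (C : I -> I -> R) t :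
  (forall i j, c n i j @[n --> \oo] --> C i j) ->
  trig_limit p (c n) t @[n --> \oo] --> trig_limit p C t.
Proof.
move=> cC; apply: cvgM; first exact: cvg_cst.
apply: gauss_expect_cvg; [exact: continuous_cos_shift|exact: bounded_cos_shift|].
apply: (cvg_comp _ Num.sqrt); last exact: sqrt_continuous.
by apply: cvgM; [exact: lincomb_var_cvg|exact: cvg_cst].
Qed.

Lemma Rintegral_trig_sum_cvg (W : nat -> random_field R I) (C : I -> I -> R)
    k (p : 'I_k -> I) (s : seq (R * ('I_k -> R) * R)) :
  (forall n, gaussian (W n)) -> (forall n, zero_mean (W n)) ->
  (forall i j, rf_cov (W n) i j @[n --> \oo] --> C i j) ->
  \int[rf_prob (W n)]_w (\sum_(t <- s) trig_term t (rf_point p w)) @[n --> \oo] -->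
  \sum_(t <- s) trig_limit p C t.
Proof.
move=> gW zW cC.
rewrite (_ : (fun n => _) = (fun n => \sum_(t <- s) trig_limit p (rf_cov (W n)) t)).
  by apply: cvg_real_sum => t; exact: trig_limit_cvg.
apply/funext => n; rewrite Rintegral_sum//; last by move=> t; exact: integrable_trig_term.
by apply: eq_bigr => t _; rewrite Rintegral_trig_term.
Qed.

Lemma integrable_continuous_rf_vector (Y : random_field R I) k (p : 'I_k -> I)
    (phi : 'rV[R]_k -> R) : continuous phi -> bounded_fun phi ->
  (rf_prob Y).-integrable [set: _] (EFin \o (phi \o @rf_vector R I Y k p)).
Proof.
move=> cphi [M [_ hM]].
apply: (@integrable_prob_bounded _ _ _ _ _ (M + 1)).
  exact: measurable_continuous_rf_vector.
by move=> w; apply: (hM (M + 1)) => //; rewrite ltrDl.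
Qed.

Lemma expectation_continuous_rf_vector (Y : random_field R I) k (p : 'I_k -> I)
    (phi : 'rV[R]_k -> R) : continuous phi -> bounded_fun phi ->
  ('E_(rf_prob Y)[phi \o @rf_vector R I Y k p] =
   (\int[rf_prob Y]_w phi (rf_vector p w))%:E)%E.
Proof.
move=> cphi bphi; rewrite unlock /Rintegral fineK//.
exact: integrable_fin_num (integrable_continuous_rf_vector Y p cphi bphi).
Qed.

(* Tail estimate in the form of Chebyshev's inequality, with the event
   [max_j |y_j| > L] replaced by its majorant [sum_j y_j^2 / L^2]. *)
Lemma trig_sum_approx_mean (Y : random_field R I) k (p : 'I_k -> I)
    (phi : 'rV[R]_k -> R) (s : seq (R * ('I_k -> R) * R)) (L eps M : R) :
  gaussian Y -> zero_mean Y -> continuous phi -> 0 < L -> 0 < eps ->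
  (forall v, `|phi v| <= M) ->
  (forall y, `|\sum_(t <- s) trig_term t y| <= M) ->
  (forall y, (forall j, `|y j| <= L) ->
     `|\sum_(t <- s) trig_term t y - phi (\row_j y j)| <= eps) ->
  `|\int[rf_prob Y]_w (\sum_(t <- s) trig_term t (rf_point p w)) -
    \int[rf_prob Y]_w phi (rf_vector p w)| <=
  eps + 2 * M / L ^+ 2 * \sum_(j < k) rf_cov Y (p j) (p j).
Proof.
move=> gY zY cphi L0 eps0 phiM psiM approx.
have M0 : 0 <= M by rewrite (le_trans _ (phiM 0)).
have bphi : bounded_fun phi.
  by exists M; split; [exact: num_real|move=> x Mx v _ /=; rewrite (le_trans (phiM v))// ltW].
have ipsi : (rf_prob Y).-integrable [set: _]
    (EFin \o (fun w => \sum_(t <- s) trig_term t (rf_point p w))).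
  by apply: integrable_real_sum => // t; exact: integrable_trig_term.
have iphi := integrable_continuous_rf_vector Y p cphi bphi.
rewrite -RintegralB//.
have id := integrable_realB measurableT ipsi iphi.
apply: (le_trans (le_normr_Rintegral _ id)) => //.
pose c := 2 * M / L ^+ 2.
have c0 : 0 <= c by rewrite divr_ge0 ?sqr_ge0// mulr_ge0.
have isq j : (rf_prob Y).-integrable [set: _] (EFin \o (fun w => c * (Y (p j) w * Y (p j) w))).
  exact: (integrable_realZ measurableT c (integrable_component_mul gY zY (p j) (p j))).
have ieps : (rf_prob Y).-integrable [set: _] (EFin \o (fun=> eps)).
  exact: finite_measure_integrable_cst.
have iG := integrable_realD measurableT ieps
  (integrable_real_sum measurableT (index_enum 'I_k) isq).
apply: (le_trans (le_Rintegral measurableT (integrable_norm id) iG _)).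
  move=> w _ /=.
  have [h|/existsNP[j /negP]] := pselect (forall j, `|rf_point p w j| <= L).
    apply: (@le_trans _ _ eps); first exact: approx.
    by rewrite lerDl sumr_ge0// => j _; rewrite mulr_ge0// -expr2 sqr_ge0.
  rewrite -ltNge => Lj; apply: (@le_trans _ _ (2 * M)).
    by rewrite (le_trans (ler_normB _ _))// mulr_natl mulr2n lerD.
  rewrite (bigD1 j)//= ler_wpDl ?(ltW eps0)//.
  apply: ler_wpDr; first by rewrite sumr_ge0// => i _; rewrite mulr_ge0// -expr2 sqr_ge0.
  rewrite /c -mulrA ler_peMr ?mulr_ge0// mulrC ler_pdivlMr ?exprn_gt0// mul1r.
  rewrite -expr2 -(real_normK (num_real (Y (p j) w))).
  by rewrite lerXn2r ?nnegrE ?(ltW L0)// ltW.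
rewrite RintegralD//; last exact: integrable_real_sum.
rewrite lerD//.
  by rewrite /Rintegral (integral_prob_cst (rf_prob Y) eps).
rewrite Rintegral_sum// mulr_sumr ler_sum// => j _.
by rewrite RintegralZl//; exact: integrable_component_mul.
Qed.

(** Both expectations approach the same sum of [trig_limit] values, computed from [C] alone; the
    comparison of two sequences thus avoids naming a Gaussian field with covariance [C]. *)
Theorem gaussian_fdd_asymptotics (W W' : nat -> random_field R I) (C : I -> I -> R) :
  (forall n, gaussian (W n)) -> (forall n, zero_mean (W n)) ->
  (forall i j, rf_cov (W n) i j @[n --> \oo] --> C i j) ->
  (forall n, gaussian (W' n)) -> (forall n, zero_mean (W' n)) ->
  (forall i j, rf_cov (W' n) i j @[n --> \oo] --> C i j) ->
  forall k (p : 'I_k -> I) (phi : 'rV[R]_k -> R), continuous phi -> bounded_fun phi ->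
  \int[rf_prob (W n)]_w phi (rf_vector p w) -
  \int[rf_prob (W' n)]_w phi (rf_vector p w) @[n --> \oo] --> 0.
Proof.
move=> gW zW cW gW' zW' cW' k p phi cphi bphi.
have [M M0 phiM] : exists2 M, 0 < M & forall v, `|phi v| <= M.
  have [M [_ hM]] := bphi; exists (`|M| + 1); first by rewrite ltr_wpDl.
  by move=> v; apply: (hM (`|M| + 1)) => //; rewrite (le_lt_trans (ler_norm _))// ltrDl.
pose S := \sum_(j < k) C (p j) (p j).
apply/cvgr0Pnorm_le => e e0.
have S0 : 0 < `|S| + 1 by rewrite ltr_wpDl.
(* Solves 2 M (|S| + 1) / L^2 = e / 6, the sum of the variances being eventually at most |S| + 1.
   Each sequence then costs e / 6 three times: on the box, for the tails, and for the trigonometric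
   means. *)
pose L := Num.sqrt (2 * M * (`|S| + 1) / (e / 6)).
have A0 : 0 < 2 * M * (`|S| + 1) / (e / 6) by rewrite divr_gt0 ?mulr_gt0 ?divr_gt0.
have L0 : 0 < L by rewrite sqrtr_gt0.
have e60 : 0 < e / 6 by rewrite divr_gt0.
have [psi [[s sE] psiM approx]] := trig_sum_approx cphi phiM L0 e60.
have {}psiM y : `|\sum_(t <- s) trig_term t y| <= M by rewrite -sE.
have {}approx y : (forall j, `|y j| <= L) ->
  `|\sum_(t <- s) trig_term t y - phi (\row_j y j)| <= e / 6 by rewrite -sE; exact: approx.
have LE : 2 * M / L ^+ 2 * (`|S| + 1) <= e / 6.
  rewrite sqr_sqrtr ?(ltW A0)// le_eqVlt; apply/orP; left; apply/eqP.
  by field; rewrite !gt_eqF.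
have main (V : nat -> random_field R I) : (forall n, gaussian (V n)) ->
    (forall n, zero_mean (V n)) -> (forall i j, rf_cov (V n) i j @[n --> \oo] --> C i j) ->
    \forall n \near \oo,
    `|\int[rf_prob (V n)]_w phi (rf_vector p w) - \sum_(t <- s) trig_limit p C t| <= e / 2.
  move=> gV zV cV.
  have cS : \sum_(j < k) rf_cov (V n) (p j) (p j) @[n --> \oo] --> S.
    by apply: cvg_real_sum => j; exact: cV.
  have cT := @Rintegral_trig_sum_cvg V C k p s gV zV cV.
  near=> n.
  have h1 := @trig_sum_approx_mean (V n) k p _ _ _ _ _ (gV n) (zV n) cphi L0 e60 phiM psiM approx.
  have h2 : `|\sum_(t <- s) trig_limit p C t -
     \int[rf_prob (V n)]_w (\sum_(t <- s) trig_term t (rf_point p w))| <= e / 6.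
    by near: n; move/cvgrPdist_le : cT; apply.
  have h3 : \sum_(j < k) rf_cov (V n) (p j) (p j) <= `|S| + 1.
    have : `|S - \sum_(j < k) rf_cov (V n) (p j) (p j)| <= 1.
      by near: n; move/cvgrPdist_le : cS; apply.
    by rewrite ler_norml => /andP[h _]; have := ler_norm S; lra.
  have h4 : 2 * M / L ^+ 2 * \sum_(j < k) rf_cov (V n) (p j) (p j) <= e / 6.
    by apply: le_trans LE; rewrite ler_wpM2l// divr_ge0 ?sqr_ge0// mulr_ge0// ltW.
  move: h1 h2; set A := \int[_]_w _; set B := \int[_]_w _; set D := \sum_(t <- s) _ => h1 h2.
  have {}h1 : `|A - B| <= e / 6 + e / 6 by apply: (le_trans h1); rewrite lerD2l.
  move: h1 h2; rewrite !ler_norml => /andP[h11 h12] /andP[h21 h22].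
  by apply/andP; split; lra.
near=> n.
have h1 : `|\int[rf_prob (W n)]_w phi (rf_vector p w) -
  \sum_(t <- s) trig_limit p C t| <= e / 2 by near: n; exact: main.
have h2 : `|\int[rf_prob (W' n)]_w phi (rf_vector p w) -
  \sum_(t <- s) trig_limit p C t| <= e / 2 by near: n; exact: main.
move: h1 h2; rewrite !ler_norml => /andP[h11 h12] /andP[h21 h22].
by apply/andP; split; lra.
Unshelve. all: by end_near. Qed.

End gaussian_fields.

(** * Fejer kernels *)

Section dirichlet_sums.
Context {R : realType}.
Implicit Types (m : nat) (u : R).

Definition dcos m u : R := \sum_(1 <= t < m.+1) cos (t%:R * u).
Definition dsin m u : R := \sum_(1 <= t < m.+1) sin (t%:R * u).
(** With D_m(u) the sum of exp (i t u) over 1 <= t <= m, this is the squared modulus of D_m(u), the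
    Fejer kernel without its factor 1 / m. [cross_cos] and [cross_sin] are the real and imaginary
    parts of the conjugate of D_m times D_m'. *)
Definition fejer m u : R := dcos m u ^+ 2 + dsin m u ^+ 2.
Definition cross_cos m m' u : R := dcos m u * dcos m' u + dsin m u * dsin m' u.
Definition cross_sin m m' u : R := dcos m u * dsin m' u - dsin m u * dcos m' u.

Lemma dcosS m u : dcos m.+1 u = dcos m u + cos (m.+1%:R * u).
Proof. by rewrite /dcos big_nat_recr. Qed.

Lemma dsinS m u : dsin m.+1 u = dsin m u + sin (m.+1%:R * u).
Proof. by rewrite /dsin big_nat_recr. Qed.

Lemma dcos0 u : dcos 0 u = 0. Proof. by rewrite /dcos big_geq. Qed.
Lemma dsin0 u : dsin 0 u = 0. Proof. by rewrite /dsin big_geq. Qed.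

Lemma fejer_ge0 m u : 0 <= fejer m u.
Proof. by rewrite addr_ge0 ?sqr_ge0. Qed.

Lemma dcosN m u : dcos m (- u) = dcos m u.
Proof. by apply: eq_bigr => t _; rewrite mulrN cosN. Qed.

Lemma dsinN m u : dsin m (- u) = - dsin m u.
Proof. by rewrite /dsin -sumrN; apply: eq_bigr => t _; rewrite mulrN sinN. Qed.

Lemma fejerN m u : fejer m (- u) = fejer m u.
Proof. by rewrite /fejer dcosN dsinN sqrrN. Qed.

Lemma cross_sinN m m' u : cross_sin m m' (- u) = - cross_sin m m' u.
Proof. by rewrite /cross_sin !dcosN !dsinN; ring. Qed.

Lemma dcos_sin_closed m u :
  2 * sin (u / 2) * dcos m u = sin (m%:R * u + u / 2) - sin (u / 2) /\
  2 * sin (u / 2) * dsin m u = cos (u / 2) - cos (m%:R * u + u / 2).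
Proof.
elim: m => [|m [IHc IHs]]; first by rewrite dcos0 dsin0 !mul0r !add0r !subrr !mulr0.
rewrite dcosS dsinS !mulrDr IHc IHs.
have -> : m%:R * u + u / 2 = m.+1%:R * u - u / 2 by rewrite -[m.+1]addn1 natrD; field.
by rewrite !sinD !cosD !sinN !cosN; split; ring.
Qed.

(** In product form, so that it also covers the zeros of [sin (u / 2)]. *)
Lemma fejer_closed m u : 2 * sin (u / 2) ^+ 2 * fejer m u = 1 - cos (m%:R * u).
Proof.
have [hc hs] := dcos_sin_closed m u.
have e : 4 * sin (u / 2) ^+ 2 * fejer m u =
    (2 * sin (u / 2) * dcos m u) ^+ 2 + (2 * sin (u / 2) * dsin m u) ^+ 2.
  by rewrite /fejer; ring.
have h1 := cos2Dsin2 (m%:R * u + u / 2); have h2 := cos2Dsin2 (u / 2).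
have h3 : cos (m%:R * u) = cos (m%:R * u + u / 2) * cos (u / 2) +
    sin (m%:R * u + u / 2) * sin (u / 2).
  by rewrite -cosB; congr cos; ring.
move: e; rewrite hc hs h3.
by move: h1 h2; move: (cos _) (sin _) (cos _) (sin _) => a b c d h1 h2 e; lra.
Qed.

Lemma dcosD m l u :
  dcos (m + l) u = dcos m u + (cos (m%:R * u) * dcos l u - sin (m%:R * u) * dsin l u).
Proof.
elim: l => [|l IH]; first by rewrite addn0 dcos0 dsin0 !mulr0 subrr addr0.
rewrite addnS !dcosS dsinS IH.
have -> : (m + l).+1%:R * u = m%:R * u + l.+1%:R * u by rewrite -addnS natrD mulrDl.
by rewrite cosD; ring.
Qed.

Lemma dsinD m l u :
  dsin (m + l) u = dsin m u + (sin (m%:R * u) * dcos l u + cos (m%:R * u) * dsin l u).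
Proof.
elim: l => [|l IH]; first by rewrite addn0 dcos0 dsin0 !mulr0 !addr0.
rewrite addnS !dsinS dcosS IH.
have -> : (m + l).+1%:R * u = m%:R * u + l.+1%:R * u by rewrite -addnS natrD mulrDl.
by rewrite sinD; ring.
Qed.

Lemma cross_cosE m l u :
  2 * cross_cos (m + l) m u = fejer (m + l) u + fejer m u - fejer l u.
Proof.
rewrite /cross_cos /fejer dcosD dsinD.
have := cos2Dsin2 (m%:R * u); set a := cos _; set b := sin _ => ab.
have e : dcos l u ^+ 2 + dsin l u ^+ 2 =
   (a * dcos l u - b * dsin l u) ^+ 2 + (b * dcos l u + a * dsin l u) ^+ 2.
  rewrite -[LHS]mul1r -ab; ring.
by rewrite e; ring.
Qed.

Lemma cross_cosC m m' u : cross_cos m m' u = cross_cos m' m u.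
Proof. by rewrite /cross_cos; ring. Qed.

(* Polarization: the increments of a Dirichlet sum are again Dirichlet sums. *)
Lemma cross_cos_polar m m' u : cross_cos m m' u =
  2^-1 * (fejer m u + fejer m' u - fejer (maxn m m' - minn m m') u).
Proof.
wlog mm' : m m' / (m' <= m)%N.
  move=> h; have /orP[] := leq_total m' m; first exact: h.
  by move=> /h; rewrite cross_cosC maxnC minnC => ->; ring.
rewrite (maxn_idPl mm') (minn_idPr mm'); have := cross_cosE m' (m - m') u.
by rewrite subnKC// => <-; field.
Qed.

Lemma cross_cos_le m m' u : `|cross_cos m m' u| <= 2^-1 * (fejer m u + fejer m' u).
Proof.
rewrite /cross_cos /fejer; move: (dcos m u) (dsin m u) (dcos m' u) (dsin m' u) => a b c d.
rewrite ler_norml; have := sqr_ge0 (a - c); have := sqr_ge0 (a + c).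
have := sqr_ge0 (b - d); have := sqr_ge0 (b + d); rewrite !sqrrB !sqrrD => h1 h2 h3 h4.
by apply/andP; split; nra.
Qed.

Lemma cross_sin_le m m' u : `|cross_sin m m' u| <= 2^-1 * (fejer m u + fejer m' u).
Proof.
rewrite /cross_sin /fejer; move: (dcos m u) (dsin m u) (dcos m' u) (dsin m' u) => a b c d.
rewrite ler_norml; have := sqr_ge0 (a - d); have := sqr_ge0 (a + d).
have := sqr_ge0 (b - c); have := sqr_ge0 (b + c); rewrite !sqrrB !sqrrD => h1 h2 h3 h4.
by apply/andP; split; nra.
Qed.

Lemma normr_dcos_le m u : `|dcos m u| <= m%:R.
Proof.
rewrite (le_trans (ler_norm_sum _ _ _))//.
rewrite (le_trans (ler_sum _ (fun t _ => cos_max _)))// sumr_const_nat subSS subn0.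
by [].
Qed.

Lemma normr_dsin_le m u : `|dsin m u| <= m%:R.
Proof.
rewrite (le_trans (ler_norm_sum _ _ _))//.
rewrite (le_trans (ler_sum _ (fun t _ => sin_max _)))// sumr_const_nat subSS subn0.
by [].
Qed.

Lemma fejer_le m u : fejer m u <= 2 * m%:R ^+ 2.
Proof.
rewrite /fejer mulr_natl mulr2n -(real_normK (num_real (dcos m u))).
rewrite -(real_normK (num_real (dsin m u))).
by rewrite lerD// lerXn2r ?nnegrE// ?normr_dcos_le ?normr_dsin_le.
Qed.

Lemma continuous_dcos m : continuous (dcos m).
Proof.
move=> u; elim: m => [|m IH].
  by rewrite (_ : dcos 0 = fun=> 0); [exact: cvg_cst|apply/funext => y; rewrite dcos0].
rewrite (_ : dcos m.+1 = fun y => dcos m y + cos (m.+1%:R * y)); last first.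
  by apply/funext => y; rewrite dcosS.
apply: (@continuousD _ _ _ (dcos m) (fun y => cos (m.+1%:R * y))); first exact: IH.
by auto_continuous.
Qed.

Lemma continuous_dsin m : continuous (dsin m).
Proof.
move=> u; elim: m => [|m IH].
  by rewrite (_ : dsin 0 = fun=> 0); [exact: cvg_cst|apply/funext => y; rewrite dsin0].
rewrite (_ : dsin m.+1 = fun y => dsin m y + sin (m.+1%:R * y)); last first.
  by apply/funext => y; rewrite dsinS.
apply: (@continuousD _ _ _ (dsin m) (fun y => sin (m.+1%:R * y))); first exact: IH.
by auto_continuous.
Qed.

Lemma measurable_dcos m : measurable_fun [set: R] (dcos m).
Proof. by apply: continuous_measurable_fun; exact: continuous_dcos. Qed.

Lemma measurable_dsin m : measurable_fun [set: R] (dsin m).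
Proof. by apply: continuous_measurable_fun; exact: continuous_dsin. Qed.

Lemma measurable_fejer m : measurable_fun [set: R] (fejer m).
Proof.
by apply: measurable_funD; apply: measurable_funX;
  [exact: measurable_dcos|exact: measurable_dsin].
Qed.

Lemma measurable_cross_cos m m' : measurable_fun [set: R] (cross_cos m m').
Proof.
by apply: measurable_funD; apply: measurable_funM;
  solve [exact: measurable_dcos|exact: measurable_dsin].
Qed.

Lemma measurable_cross_sin m m' : measurable_fun [set: R] (cross_sin m m').
Proof.
by apply: measurable_funB; apply: measurable_funM;
  solve [exact: measurable_dcos|exact: measurable_dsin].
Qed.

End dirichlet_sums.

(** * Integrability of the power weight *)

Section fejer_asymptotics.
Context {R : realType}.
Local Notation mu := (@lebesgue_measure R).

Lemma half_kappa_fin (d : R) : 0 < d < 2^-1 ->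
  exists2 h : R, half_kappa d = h%:E & fine (kappa_sq d) = 4 * h.
Proof.
move=> d01; have [kE _] := kappa_sq_value d01.
move: kE; rewrite kappa_sq_half.
have : (0 <= half_kappa d)%E.
  by apply: integral_ge0 => x _; rewrite lee_fin mulr_ge0 ?powR_ge0// subr_ge0 cos_le1.
case: (half_kappa d) => [h _ _|_|//]; first by exists h.
by rewrite gt0_muley// lte_fin.
Qed.

Lemma onemcos_ge : exists2 c : R, 0 < c &
  forall u : R, 0 <= u <= pi -> c * u ^+ 2 <= 1 - cos u.
Proof.
have [c c0 hc] := @sin_ge_linear R.
exists (c ^+ 2 / 2); first by rewrite divr_gt0// exprn_gt0.
move=> u /andP[u0 up].
have -> : 1 - cos u = 2 * sin (u / 2) ^+ 2.
  (* The kernel [fejer 1] is constantly 1, so this is the half-angle formula. *)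
  have := fejer_closed 1 u; rewrite mul1r => <-.
  rewrite /fejer /dcos /dsin !big_nat1 !mul1r cos2Dsin2 mulr1//.
have h : c * (u / 2) <= sin (u / 2).
  by apply: hc; rewrite divr_ge0//= ler_wpM2r.
have h0 : 0 <= c * (u / 2) by rewrite mulr_ge0 ?divr_ge0// ltW.
have : (c * (u / 2)) ^+ 2 <= sin (u / 2) ^+ 2.
  by rewrite lerXn2r// nnegrE// (le_trans h0).
lra.
Qed.

Definition weight (d u : R) : R := `|u| `^ (- (2 * d)).

Lemma weight_ge0 d u : 0 <= weight d u. Proof. exact: powR_ge0. Qed.

Lemma weightN d u : weight d (- u) = weight d u.
Proof. by rewrite /weight normrN. Qed.

Lemma measurable_weight d : measurable_fun [set: R] (weight d).
Proof.
apply: (measurableT_comp (measurable_powR _)); exact: normr_measurable.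
Qed.

Definition sym_itv : set R := `[- pi, pi]%classic.

Lemma ge0_integral_sym_itv (f : R -> \bar R) : measurable_fun [set: R] f ->
  (forall x, 0 <= f x)%E -> (forall x, f (- x) = f x) ->
  (\int[mu]_(u in sym_itv) f u = 2%:E * \int[mu]_(u in `]0%R, pi]) f u)%E.
Proof.
move=> mf f0 fN; have p0 := @pi_gt0 R.
have mD : measurable sym_itv by exact: measurable_itv.
rewrite integral_mkcond ge0_integral_even.
- congr (_ * _)%E; rewrite integral_mkcond [RHS]integral_mkcond.
  apply: eq_integral => x _; rewrite !patchE; case: ifPn => [|xn].
    rewrite inE/= in_itv/= andbT => x0; congr (if _ then _ else _); apply/idP/idP; rewrite !inE /sym_itv/= !in_itv/= x0//=.
      by case/andP.
    by move=> ->; rewrite andbT (le_trans _ (ltW x0))// oppr_le0 ltW.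
  rewrite ifF//; apply: contraNF xn; rewrite !inE/= !in_itv/= andbT.
  by case/andP.
- by apply/(measurable_restrictT f mD); exact: measurable_funTS.
- by move=> x; rewrite patchE; case: ifPn.
- move=> x; rewrite !patchE fN; congr (if _ then _ else _).
  by apply/idP/idP; rewrite !inE /sym_itv/= !in_itv/= => /andP[h1 h2]; apply/andP; split; lra.
Qed.

(** Since c u^2 <= 1 - cos u on []0, pi]], the weight is dominated there by a multiple of the
    integrand of [half_kappa], whose integral is already known to be finite. *)
Lemma weight_integrable (d : R) : 0 < d < 2^-1 -> mu.-integrable sym_itv (EFin \o weight d).
Proof.
move=> d01; have [h hE _] := half_kappa_fin d01.
have [c c0 hc] := onemcos_ge.
have mw D : measurable_fun D (EFin \o weight d).
  by apply/measurable_EFinP/measurable_funTS; exact: measurable_weight.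
apply: (@ge0_integrable _ _ _ _ _ _ (2 * (c^-1 * h))).
- by apply: measurable_funTS; exact: measurable_weight.
- by move=> u _; exact: weight_ge0.
rewrite ge0_integral_sym_itv//; last 2 first.
- by move=> x; rewrite lee_fin weight_ge0.
- by move=> x; rewrite /= weightN.
rewrite EFinM lee_pmul2l// EFinM -hE -ge0_integralZl_EFin//; last 3 first.
- by move=> x _; rewrite lee_fin mulr_ge0 ?powR_ge0// subr_ge0 cos_le1.
- by apply/measurable_EFinP/measurable_funTS; exact: measurable_1Bcos_powR.
- by rewrite invr_ge0 ltW.
have m2 D : measurable_fun D (fun u : R => (c^-1%:E * ((1 - cos u) * u `^ (- (2 + 2 * d)))%:E)%E).
  by apply: measurable_funeM; apply/measurable_EFinP/measurable_funTS; exact: measurable_1Bcos_powR.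
have p2 (u : R) : (0 <= c^-1%:E * ((1 - cos u) * u `^ (- (2 + 2 * d)))%:E)%E.
  by rewrite -EFinM lee_fin !mulr_ge0 ?powR_ge0 ?invr_ge0 ?(ltW c0)// subr_ge0 cos_le1.
apply: (@le_trans _ _ (\int[mu]_(u in `]0%R, pi]) (c^-1%:E * ((1 - cos u) * u `^ (- (2 + 2 * d)))%:E))%E).
  apply: ge0_le_integral => //.
  - by move=> u _; rewrite lee_fin weight_ge0.
  - exact: mw.
  - exact: m2.
  move=> u; rewrite /= in_itv/= => /andP[u0 up].
  rewrite -EFinM lee_fin /weight gtr0_norm// ler_pdivlMl//.
  rewrite opprD powRD ?(gt_eqF u0) ?implybT// mulrA ler_wpM2r ?powR_ge0//.
  rewrite powRN powR_mulrn ?(ltW u0)// ler_pdivlMr ?exprn_gt0//.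
  by apply: hc; rewrite (ltW u0).
apply: ge0_subset_integral => //; first exact: m2.
by move=> u; rewrite /= !in_itv/= => /andP[->].
Qed.

End fejer_asymptotics.

(** * Asymptotics of the Fejer masses *)

Section fejer_mass.
Context {R : realType}.
Local Notation mu := (@lebesgue_measure R).

Definition fejer_mass (d : R) (m : nat) : R :=
  \int[mu]_(u in @sym_itv R) (fejer m u * weight d u).

Lemma measurable_fejer_weight (d : R) m :
  measurable_fun [set: R] (fun u => fejer m u * weight d u).
Proof. by apply: measurable_funM; [exact: measurable_fejer|exact: measurable_weight]. Qed.

Lemma fejer_weight_integrable (d : R) m : 0 < d < 2^-1 ->
  mu.-integrable (@sym_itv R) (EFin \o (fun u => fejer m u * weight d u)).
Proof.
move=> d01; have := weight_integrable d01.
move=> /integrable_realZ => /(_ _ (2 * m%:R ^+ 2)) h.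
apply: (le_integrable _ _ _ (h _)); [exact: measurable_itv| | |exact: measurable_itv].
  by apply/measurable_EFinP; apply: measurable_funTS; exact: measurable_fejer_weight.
move=> u _; rewrite /= lee_fin ger0_norm ?mulr_ge0 ?fejer_ge0 ?weight_ge0//.
by rewrite ger0_norm ?mulr_ge0 ?weight_ge0// ler_wpM2r ?weight_ge0// fejer_le.
Qed.

Lemma fejer_massE (d : R) m : 0 < d < 2^-1 ->
  ((fejer_mass d m)%:E =
   2%:E * \int[mu]_(u in `]0%R, pi]) (fejer m u * weight d u)%:E)%E.
Proof.
move=> d01; rewrite /fejer_mass /Rintegral fineK; last first.
  by apply: (integrable_fin_num _ (fejer_weight_integrable m d01)); exact: measurable_itv.
rewrite ge0_integral_sym_itv//.
- by apply/measurable_EFinP; exact: measurable_fejer_weight.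
- by move=> x; rewrite lee_fin mulr_ge0 ?fejer_ge0 ?weight_ge0.
- by move=> x; rewrite fejerN weightN.
Qed.

(** The integrand of the normalized mass after the substitution u = w / N. The factor u^2 is grouped
    with the kernel because their product has a limit, and extension by zero beyond [N * pi] puts
    all the integrals on the same half-line. *)
Definition fejer_scaled (d N : R) (m : nat) (w : R) : R :=
  if w / N <= pi then (w / N) ^+ 2 * fejer m (w / N) * w `^ (- (2 + 2 * d)) else 0.

Lemma fejer_scaled_ge0 d N m w : 0 <= fejer_scaled d N m w.
Proof.
by rewrite /fejer_scaled; case: ifP => // _; rewrite mulr_ge0 ?powR_ge0// mulr_ge0 ?sqr_ge0 ?fejer_ge0.
Qed.

Lemma measurable_fejer_scaled d N m : measurable_fun [set: R] (fejer_scaled d N m).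
Proof.
have mdiv : measurable_fun [set: R] (fun w : R => w / N) by exact: measurable_funM.
apply: measurable_fun_ifT => //; first exact: measurable_fun_ler.
apply: measurable_funM; last exact: measurable_powR.
apply: measurable_funM; first exact: measurable_funX.
by apply: measurableT_comp => //; exact: measurable_fejer.
Qed.

Lemma fejer_mass_scale (d N : R) m : 0 < d < 2^-1 -> 0 < N ->
  ((N `^ (- (1 + 2 * d)) * fejer_mass d m)%:E =
   2%:E * \int[mu]_(w in `]0%R, +oo[) (fejer_scaled d N m w)%:E)%E.
Proof.
move=> d01 N0; rewrite EFinM fejer_massE// muleCA; congr (_ * _)%E.
have NV0 : 0 < N^-1 by rewrite invr_gt0.
pose f (u : R) := fejer_scaled d N m (N * u).
have mf : measurable_fun [set: R] f.
  by apply: measurableT_comp; [exact: measurable_fejer_scaled|exact: measurable_funM].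
have f0 (u : R) : 0 <= f u by exact: fejer_scaled_ge0.
transitivity (N%:E * \int[mu]_(u in `]0%R, +oo[) (f u)%:E)%E; last first.
  have := @ge0_integral_scale R N^-1 `]0%R, +oo[%classic (EFin \o f) NV0.
  rewrite invrK => <-//; last 2 first.
  - by apply/measurable_EFinP; exact: measurable_funTS.
  - by move=> u _; rewrite lee_fin.
  have -> : *%R N^-1 @^-1` `]0, +oo[ = `]0, +oo[%classic :> set R.
    by apply/seteqP; split => u /=; rewrite !in_itv/= !andbT pmulr_rgt0.
  by apply: eq_integral => w _; rewrite /f/= mulrA divff ?gt_eqF// mul1r.
have -> : (\int[mu]_(u in `]0%R, +oo[) (f u)%:E =
    \int[mu]_(u in `]0%R, pi]) ((N `^ (- (2 + 2 * d)))%:E * (fejer m u * weight d u)%:E))%E.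
  rewrite integral_mkcond [RHS]integral_mkcond; apply: eq_integral => u _; rewrite !patchE.
  case: ifPn => [|un]; last first.
    rewrite ifF//; apply: contraNF un; rewrite !inE/= !in_itv/= andbT.
    by case/andP.
  rewrite inE/= in_itv/= andbT => u0.
  have -> : (u \in `]0, pi]%classic) = (u <= pi).
    by apply/idP/idP; rewrite inE/= in_itv/= u0.
  rewrite /f /fejer_scaled mulrAC divff ?gt_eqF// mul1r; case: ifP => // _.
  rewrite -EFinM; congr EFin; rewrite powRM ?(ltW u0) ?(ltW N0)//.
  rewrite /weight gtr0_norm// [in u `^ _]opprD powRD ?(gt_eqF u0) ?implybT//.
  rewrite [u `^ (- 2)]powRN powR_mulrn ?(ltW u0)//.
  by field; rewrite gt_eqF.
rewrite ge0_integralZl_EFin ?powR_ge0//.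
- rewrite muleA -EFinM; congr (_%:E * _)%E.
  rewrite -{2}[N]powRr1 ?(ltW N0)// -powRD ?(gt_eqF N0) ?implybT//.
  by congr (_ `^ _); ring.
- by move=> u _; rewrite lee_fin mulr_ge0 ?fejer_ge0 ?weight_ge0.
- by apply/measurable_EFinP; apply: measurable_funTS; exact: measurable_fejer_weight.
Qed.

Lemma fejer_sqr_le : exists2 c : R, 0 < c & forall (u : R) m, 0 <= u <= pi ->
  u ^+ 2 * fejer m u <= c * (1 - cos (m%:R * u)).
Proof.
have [c c0 hc] := @onemcos_ge R.
exists c^-1; first by rewrite invr_gt0.
move=> u m u0p; rewrite -fejer_closed.
have /hc : 0 <= u <= pi by [].
have -> : 1 - cos u = 2 * sin (u / 2) ^+ 2.
  have := fejer_closed 1 u; rewrite mul1r => <-.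
  by rewrite /fejer /dcos /dsin !big_nat1 !mul1r cos2Dsin2 mulr1.
move=> h; rewrite mulrA ler_wpM2r ?fejer_ge0// ler_pdivlMl//.
Qed.

(** For w >= 1 the product of u^2 and the kernel is bounded, and the power of w is integrable at
    infinity. For w < 1 the crude bound by 2 m^2, with m at most x N, leaves a multiple of w^2,
    hence of 1 - cos w. *)
Lemma fejer_scaled_le (d x : R) : 0 <= x -> exists2 C : R, 0 < C &
  forall N m w, 0 < N -> m%:R / N <= x -> 0 < w ->
    fejer_scaled d N m w <=
    C * ((1 - cos w) * w `^ (- (2 + 2 * d)) + (if 1 <= w then w `^ (- (2 + 2 * d)) else 0)).
Proof.
move=> x0; have [c c0 hc] := fejer_sqr_le; have [b b0 hb] := @onemcos_ge R.
exists (2 * c + 2 * x ^+ 2 * b^-1).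
  by rewrite ltr_pwDl ?mulr_gt0// mulr_ge0 ?mulr_ge0 ?sqr_ge0// invr_ge0 ltW.
move=> N m w N0 mN w0; rewrite /fejer_scaled; set q := w `^ _.
have q0 : 0 <= q by exact: powR_ge0.
have A0 : 0 <= 2 * x ^+ 2 * b^-1 by rewrite mulr_ge0 ?mulr_ge0 ?sqr_ge0// invr_ge0 ltW.
have cw0 : 0 <= 1 - cos w by rewrite subr_ge0 cos_le1.
have wN0 : 0 <= w / N by rewrite divr_ge0 ?(ltW N0) ?(ltW w0).
case: ifP => wN; last first.
  by apply: mulr_ge0; [rewrite addr_ge0// mulr_ge0// ltW|rewrite addr_ge0 ?mulr_ge0//; case: ifP].
have [w1|w1] := leP 1 w.
  have h : (w / N) ^+ 2 * fejer m (w / N) <= 2 * c.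
    apply: (le_trans (hc _ _ _)); first by rewrite wN0.
    rewrite mulrC ler_wpM2r ?(ltW c0)//.
    by have := cos_geN1 (m%:R * (w / N)); lra.
  apply: (@le_trans _ _ (2 * c * q)); first by rewrite ler_wpM2r.
  have cc : 0 <= 2 * c by rewrite mulr_ge0// ltW.
  have c1 : 2 * c <= 2 * c + 2 * x ^+ 2 * b^-1 by rewrite lerDl.
  have c2 : q <= (1 - cos w) * q + q by rewrite lerDr mulr_ge0.
  exact: ler_pM.
rewrite addr0 mulrA ler_wpM2r//.
have cc : 2 * x ^+ 2 * b^-1 <= 2 * c + 2 * x ^+ 2 * b^-1 by rewrite lerDr mulr_ge0// ltW.
apply: le_trans (ler_wpM2r cw0 cc).
have h1 := fejer_le m (w / N).
have w2 : b * w ^+ 2 <= 1 - cos w.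
  by apply: hb; rewrite (ltW w0)/=; have := @pi_ge2 R; lra.
apply: (@le_trans _ _ (2 * (m%:R / N) ^+ 2 * w ^+ 2)).
  have -> : 2 * (m%:R / N) ^+ 2 * w ^+ 2 = (w / N) ^+ 2 * (2 * m%:R ^+ 2).
    by field; rewrite gt_eqF.
  by rewrite ler_wpM2l ?sqr_ge0.
have mN0 : 0 <= m%:R / N by rewrite divr_ge0// ltW.
rewrite -[leRHS]mulrA; apply: ler_pM; rewrite ?sqr_ge0//.
- by rewrite mulr_ge0// sqr_ge0.
- by rewrite ler_pM2l// lerXn2r ?nnegrE.
- by rewrite ler_pdivlMl.
Qed.

Lemma fejer_dominator_integrable (d : R) : 0 < d < 2^-1 ->
  mu.-integrable `]0%R, +oo[%classic (EFin \o (fun w : R =>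
    (1 - cos w) * w `^ (- (2 + 2 * d)) + (if 1 <= w then w `^ (- (2 + 2 * d)) else 0))).
Proof.
move=> d01; have [h hE _] := half_kappa_fin d01.
have mif : measurable_fun [set: R] (fun w : R => if 1 <= w then w `^ (- (2 + 2 * d)) else 0).
  apply: measurable_fun_ifT; [exact: measurable_fun_ler|exact: measurable_powR|].
  exact: measurable_cst.
apply: integrable_realD => //.
  apply: (@ge0_integrable _ _ _ _ _ _ h).
  - by apply: measurable_funTS; exact: measurable_1Bcos_powR.
  - by move=> x _; rewrite mulr_ge0 ?powR_ge0// subr_ge0 cos_le1.
  by rewrite -hE.
apply: (@ge0_integrable _ _ _ _ _ _ (2 + 2 * d - 1)^-1).
- exact: measurable_funTS.
- by move=> x _; case: ifP => // _; exact: powR_ge0.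
rewrite -integral_powR1y; last by lra.
rewrite le_eqVlt; apply/orP; left; apply/eqP.
rewrite integral_mkcond [RHS]integral_mkcond; apply: eq_integral => u _; rewrite !patchE.
have -> : (u \in `[1, +oo[%classic) = (1 <= u).
  by apply/idP/idP; rewrite inE/= in_itv/= andbT.
have -> : (u \in `]0, +oo[%classic) = (0 < u).
  by apply/idP/idP; rewrite inE/= in_itv/= andbT.
case: (leP 1 u) => [u1|u1]; last by case: ifP.
by rewrite (lt_le_trans ltr01 u1).
Qed.

Lemma cvg_sinc (h : nat -> R) : h n @[n --> \oo] --> 0 -> (forall n, h n != 0) ->
  sin (h n) / h n @[n --> \oo] --> (1 : R).
Proof.
move=> h0 hn0; have [dsin sinE] := is_derive_sin (0 : R).
have := dsin; rewrite /derivable => /cvg_ex[l hl].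
have l1 : l = 1.
  have := sinE; rewrite cos0 => <-; rewrite /derive; apply/esym.
  exact: cvg_lim hl.
rewrite l1 in hl.
have hh : h n @[n --> \oo] --> (0 : R)^'.
  move=> A [e/= e0 eA]; move/cvgrPdist_lt : h0 => /(_ e e0)[k _ hk].
  by exists k => // n kn; apply: eA => //=; apply: hk.
have := cvg_comp _ _ hh hl; rewrite (_ : _ \o _ = fun n => sin (h n) / h n)//.
by apply/funext => n; rewrite /= addr0 sin0 subr0 /GRing.scale/= mulr1 mulrC.
Qed.

Lemma cvg_fejer_scaled (d : R) (N : nat -> R) (m : nat -> nat) (x w : R) :
  (forall n, 0 < N n) -> N n @[n --> \oo] --> +oo ->
  (m n)%:R / N n @[n --> \oo] --> x -> 0 < w ->
  fejer_scaled d (N n) (m n) w @[n --> \oo] -->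
    2 * ((1 - cos (x * w)) * w `^ (- (2 + 2 * d))).
Proof.
move=> N0 Ny mx w0; set q := w `^ _.
have v0 n : 0 < w / N n by rewrite divr_gt0.
have NV : (N n)^-1 @[n --> \oo] --> (0 : R).
  have /gtr0_cvgV0 h : \forall n \near \oo, 0 < N n by near=> n; exact: N0.
  exact: (h.2 Ny).
have vc : w / N n @[n --> \oo] --> (0 : R).
  by rewrite -(mulr0 w); apply: cvgM => //; exact: cvg_cst.
have hc : w / N n / 2 @[n --> \oo] --> (0 : R).
  by rewrite -(mul0r 2^-1); apply: cvgM => //; exact: cvg_cst.
have hn0 n : w / N n / 2 != 0 by rewrite gt_eqF// divr_gt0.
have sc := cvg_sinc hc hn0.
have scV : (sin (w / N n / 2) / (w / N n / 2))^-1 @[n --> \oo] --> (1 : R).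
  by rewrite -[X in _ --> X]invr1; apply: cvgV => //; exact: oner_neq0.
have cc : cos ((m n)%:R / N n * w) @[n --> \oo] --> cos (x * w).
  apply: (cvg_comp (fun n => (m n)%:R / N n * w) (@cos R)); last exact: continuous_cos.
  by apply: cvgM => //; exact: cvg_cst.
(* By [fejer_closed] this sequence equals [fejer_scaled] as soon as [w / N n] is at most [pi], where
   the sine of its half is positive. *)
have lim : 2 * (((sin (w / N n / 2) / (w / N n / 2))^-1 * (sin (w / N n / 2) / (w / N n / 2))^-1)
   * (1 - cos ((m n)%:R / N n * w)) * q) @[n --> \oo] --> 2 * ((1 * 1) * (1 - cos (x * w)) * q).
  apply: cvgM; first exact: cvg_cst.
  apply: cvgM; last exact: cvg_cst.
  apply: cvgM; first exact: cvgM.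
  by apply: cvgB => //; exact: cvg_cst.
rewrite !mul1r in lim; apply: cvg_trans lim; apply: near_eq_cvg.
near=> n.
have vpi : w / N n <= pi.
  have : `|0 - w / N n| <= pi.
    by near: n; move/cvgrPdist_le : vc; apply; exact: pi_gt0.
  by rewrite sub0r normrN gtr0_norm.
have s0 : 0 < sin (w / N n / 2).
  apply: sin_gt0_pi; rewrite divr_gt0//= ltr_pdivrMr//.
  by have := @pi_gt0 R; lra.
rewrite /fejer_scaled vpi -/q mulrA; congr (_ * q).
have := fejer_closed (m n) (w / N n).
have -> : (m n)%:R / N n * w = (m n)%:R * (w / N n) by ring.
move=> <-; move: (v0 n) s0; move: (w / N n) => v vn0; move: (sin _) => s s0.
by field; rewrite !gt_eqF.
Unshelve. all: by end_near. Qed.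

Lemma integral_onemcos_scale (d h x : R) : 0 < d -> half_kappa d = h%:E -> 0 <= x ->
  (\int[mu]_(w in `]0%R, +oo[) (2 * ((1 - cos (x * w)) * w `^ (- (2 + 2 * d))))%:E =
   (2 * x `^ (1 + 2 * d) * h)%:E)%E.
Proof.
move=> d0 hE; rewrite le_eqVlt => /orP[/eqP <-|x0].
  rewrite powR0 ?mulr0 ?mul0r; last by rewrite gt_eqF//; lra.
  by rewrite integral0_eq// => w _; rewrite mul0r cos0 subrr mul0r mulr0.
pose f (u : R) := 2 * x `^ (2 + 2 * d) * ((1 - cos u) * u `^ (- (2 + 2 * d))).
have f0 (u : R) : 0 <= (1 - cos u) * u `^ (- (2 + 2 * d)).
  by rewrite mulr_ge0 ?powR_ge0// subr_ge0 cos_le1.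
have c0 : 0 <= 2 * x `^ (2 + 2 * d) by rewrite mulr_ge0 ?powR_ge0.
have mf : measurable_fun [set: R] f.
  by apply: measurable_funM => //; exact: measurable_1Bcos_powR.
have fg0 (u : R) : 0 <= f u by rewrite /f mulr_ge0.
transitivity (x^-1%:E * \int[mu]_(u in `]0%R, +oo[) (f u)%:E)%E.
  rewrite -(@ge0_integral_scale R x `]0%R, +oo[%classic (EFin \o f) x0)//; last 2 first.
  - by apply/measurable_EFinP; exact: measurable_funTS.
  - by move=> u _; rewrite lee_fin.
  have -> : *%R x @^-1` `]0, +oo[ = `]0, +oo[%classic :> set R.
    by apply/seteqP; split => u /=; rewrite !in_itv/= !andbT pmulr_rgt0.
  apply: eq_integral => w; rewrite inE/= in_itv/= andbT => w0; congr EFin.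
  rewrite /f powRM ?(ltW x0) ?(ltW w0)// [x `^ (- _)]powRN.
  by field; rewrite gt_eqF ?powR_gt0.
under eq_integral do rewrite /f EFinM.
rewrite ge0_integralZl_EFin//; last 2 first.
- by move=> u _; rewrite lee_fin.
- by apply/measurable_EFinP; apply: measurable_funTS; exact: measurable_1Bcos_powR.
rewrite -/(half_kappa d) hE -!EFinM; congr EFin.
have -> : 2 + 2 * d = 1 + (1 + 2 * d) by ring.
rewrite powRD ?(gt_eqF x0) ?implybT// powRr1 ?(ltW x0)//.
by field; rewrite gt_eqF.
Qed.

Lemma fejer_mass_cvg_bounded (d : R) (N : nat -> R) (m : nat -> nat) (x : R) :
  0 < d < 2^-1 -> (forall n, 0 < N n) -> (forall n, (m n)%:R / N n <= x + 1) ->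
  N n @[n --> \oo] --> +oo -> (m n)%:R / N n @[n --> \oo] --> x ->
  N n `^ (- (1 + 2 * d)) * fejer_mass d (m n) @[n --> \oo] -->
    x `^ (1 + 2 * d) * fine (kappa_sq d).
Proof.
move=> d01 N0 mN Ny mx; have [h hE ->] := half_kappa_fin d01.
have d0 : 0 < d by case/andP: d01.
have x0 : 0 <= x.
  by apply: (cvgr_to_ge mx); near=> n; rewrite divr_ge0// ltW.
have x10 : 0 <= x + 1 by rewrite addr_ge0.
have [C C0 hC] := @fejer_scaled_le d (x + 1) x10.
suff : ((N n `^ (- (1 + 2 * d)) * fejer_mass d (m n))%:E @[n --> \oo] -->
    (x `^ (1 + 2 * d) * (4 * h))%:E)%E by move/fine_cvg.
rewrite (_ : (fun n => _) = fun n => (2%:E *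
  \int[mu]_(w in `]0%R, +oo[) (fejer_scaled d (N n) (m n) w)%:E)%E); last first.
  by apply/funext => n; exact: fejer_mass_scale.
have -> : (x `^ (1 + 2 * d) * (4 * h))%:E = (2%:E * (2 * x `^ (1 + 2 * d) * h)%:E)%E.
  by rewrite -EFinM; congr EFin; ring.
apply: cvgeZl => //; rewrite -(integral_onemcos_scale d0 hE x0).
have mg : mu.-integrable `]0%R, +oo[%classic (EFin \o (fun w : R =>
    C * ((1 - cos w) * w `^ (- (2 + 2 * d)) + (if 1 <= w then w `^ (- (2 + 2 * d)) else 0)))).
  by apply: integrable_realZ => //; exact: fejer_dominator_integrable.
apply: (dominated_cvg _ _ _ _ mg) => //.
- by move=> n; apply/measurable_EFinP; apply: measurable_funTS; exact: measurable_fejer_scaled.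
- move=> w; rewrite /= in_itv/= andbT => w0; apply: cvg_EFin; first exact: nearW.
  exact: cvg_fejer_scaled.
- move=> n w; rewrite /= in_itv/= andbT => w0.
  by rewrite lee_fin ger0_norm ?fejer_scaled_ge0// hC.
Unshelve. all: by end_near. Qed.

(** Positivity of [N n] and the bound [x + 1] needed for domination hold only eventually; shifting
    the index by [k] makes them hold for all [n]. *)
Theorem fejer_mass_cvg (d : R) (N : nat -> R) (m : nat -> nat) (x : R) :
  0 < d < 2^-1 -> N n @[n --> \oo] --> +oo -> (m n)%:R / N n @[n --> \oo] --> x ->
  N n `^ (- (1 + 2 * d)) * fejer_mass d (m n) @[n --> \oo] -->
    x `^ (1 + 2 * d) * fine (kappa_sq d).
Proof.
move=> d01 Ny mx.
have [k _ hk] : \forall n \near \oo, 0 < N n /\ (m n)%:R / N n <= x + 1.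
  near=> n; split; first by near: n; move/cvgryPgt : Ny; apply.
  near: n; apply: (cvgr_le _ mx); by rewrite ltrDl.
have Ny' : N (n + k)%N @[n --> \oo] --> +oo by have := Ny; rewrite -(cvg_shiftn k N).
have mx' : (m (n + k)%N)%:R / N (n + k)%N @[n --> \oo] --> x.
  by have := mx; rewrite -(cvg_shiftn k).
rewrite -(cvg_shiftn k); apply: fejer_mass_cvg_bounded => //.
- by move=> n; have [] := hk (n + k)%N (leq_addl _ _).
- by move=> n; have [] := hk (n + k)%N (leq_addl _ _).
Unshelve. all: by end_near. Qed.

End fejer_mass.

(** * Integrals of products of functions of one variable *)

Section product_integral.
Context d1 d2 (T1 : measurableType d1) (T2 : measurableType d2) {R : realType}.
Variables (m1 : {sigma_finite_measure set T1 -> \bar R}).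
Variables (m2 : {sigma_finite_measure set T2 -> \bar R}).
Implicit Types (a : T1 -> R) (b : T2 -> R).

Lemma integrable_tensorT a b : m1.-integrable [set: T1] (EFin \o a) ->
  m2.-integrable [set: T2] (EFin \o b) ->
  (m1 \x m2)%E.-integrable [set: T1 * T2] (fun z => (a z.1 * b z.2)%:E).
Proof.
move=> ia ib; have ma := measurable_int m1 ia; have mb := measurable_int m2 ib.
have m12 : measurable_fun [set: T1 * T2] (fun z => (a z.1 * b z.2)%:E).
  apply/measurable_EFinP; apply: measurable_funM.
    by apply: (measurableT_comp _ measurable_fst); exact/measurable_EFinP.
  by apply: (measurableT_comp _ measurable_snd); exact/measurable_EFinP.
apply/integrable12ltyP => //=.
have fa := integrable_fin_num measurableT (integrable_abse ia).
have fb := integrable_fin_num measurableT (integrable_abse ib).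
rewrite (_ : (\int[m1]_x _)%E =
   (\int[m1]_x (`|(a x)%:E| * \int[m2]_y `|(b y)%:E|))%E); last first.
  apply: eq_integral => x _; rewrite -ge0_integralZl//.
    by apply: eq_integral => y _; rewrite /= normrM EFinM.
  exact: measurable_int (integrable_abse ib).
have b0 : (0 <= \int[m2]_y `|(b y)%:E|)%E by exact: integral_ge0.
rewrite ge0_integralZr//; last exact: measurable_int (integrable_abse ia).
rewrite -(fineK fb) -(fineK fa) -EFinM ltry//.
Qed.

Lemma Rintegral_tensorT a b : m1.-integrable [set: T1] (EFin \o a) ->
  m2.-integrable [set: T2] (EFin \o b) ->
  (\int[(m1 \x m2)%E]_z (a z.1 * b z.2)%:E =
   ((\int[m1]_x a x) * (\int[m2]_y b y))%:E)%E.
Proof.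
move=> ia ib; rewrite -integral12_prod_meas1; last exact: integrable_tensorT.
rewrite /Rintegral EFinM.
rewrite (fineK (integrable_fin_num measurableT ia)).
rewrite -[in RHS](fineK (integrable_fin_num measurableT ib)).
rewrite -integralZr//; apply: eq_integral => x _ /=.
rewrite [in RHS]fineK ?(integrable_fin_num measurableT ib)//.
by rewrite -integralZl//; apply: eq_integral => y _; rewrite EFinM.
Qed.

Variables (A : set T1) (B : set T2).
Hypotheses (mA : measurable A) (mB : measurable B).

Let patch_tensor a b : (EFin \o (fun z => a z.1 * b z.2)) \_ (A `*` B) =
  (fun z => ((a \_ A) z.1 * (b \_ B) z.2)%:E).
Proof.
apply/funext => z; rewrite !patchE in_setX.
by case: (z.1 \in A); case: (z.2 \in B); rewrite /= ?mulr0 ?mul0r.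
Qed.

Lemma integrable_tensor a b : m1.-integrable A (EFin \o a) ->
  m2.-integrable B (EFin \o b) ->
  (m1 \x m2)%E.-integrable (A `*` B) (EFin \o (fun z => a z.1 * b z.2)).
Proof.
move=> /(integrable_mkcond _ mA) ia /(integrable_mkcond _ mB) ib.
apply/integrable_mkcond; first exact: measurableX.
rewrite patch_tensor; apply: integrable_tensorT.
  by rewrite -restrict_EFin.
by rewrite -restrict_EFin.
Qed.

Lemma Rintegral_tensor a b : m1.-integrable A (EFin \o a) ->
  m2.-integrable B (EFin \o b) ->
  \int[(m1 \x m2)%E]_(z in A `*` B) (a z.1 * b z.2) =
  (\int[m1]_(x in A) a x) * (\int[m2]_(y in B) b y).
Proof.
move=> /(integrable_mkcond _ mA) ia /(integrable_mkcond _ mB) ib.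
rewrite /Rintegral integral_mkcond patch_tensor Rintegral_tensorT; last 2 first.
- by rewrite -restrict_EFin.
- by rewrite -restrict_EFin.
by rewrite /= /Rintegral [in RHS]integral_mkcond [in X in _ = _ * X]integral_mkcond !restrict_EFin.
Qed.

End product_integral.

Section odd_integrals.
Context {R : realType}.
Local Notation mu := (@lebesgue_measure R).

Lemma ge0_integral_reflect (f : R -> \bar R) : measurable_fun [set: R] f ->
  (forall x, 0 <= f x)%E -> (\int[mu]_x f (- x)%R = \int[mu]_x f x)%E.
Proof.
move=> mf f0; have mN : measurable_fun [set: R] (fun x => f (- x)).
  exact: measurableT_comp.
have split (h : R -> \bar R) : measurable_fun [set: R] h -> (forall x, 0 <= h x)%E ->
  (\int[mu]_x h x = \int[mu]_(x in `[0%R, +oo[) h (- x)%R + \int[mu]_(x in `[0%R, +oo[) h x)%E.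
  move=> mh h0; rewrite -(setUv `]-oo, 0%R]%classic) ge0_integral_setU//=.
  - rewrite setCitvl integral_itv_obnd_cbnd; last exact: measurable_funTS.
    congr (_ + _)%E; rewrite ge0_integration_by_substitution0//.
    by apply: eq_integral => r _; rewrite opprK.
    exact: measurableT_comp.
  - exact: measurableC.
  - by rewrite setUv.
  - exact/disj_setPCl.
rewrite (split _ mf f0) (split _ mN) => [|x]; last exact: f0.
by rewrite addeC; congr (_ + _)%E; apply: eq_integral => x _; rewrite opprK.
Qed.

Lemma Rintegral_odd (a : R -> R) : measurable_fun [set: R] a ->
  (forall u, a (- u) = - a u) -> \int[mu]_(u in @sym_itv R) a u = 0.
Proof.
move=> ma aN; rewrite /Rintegral integralE.
have S_N (u : R) : (- u \in @sym_itv R) = (u \in @sym_itv R).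
  by apply/idP/idP; rewrite !inE /sym_itv/= !in_itv/= => /andP[h1 h2]; apply/andP; split; lra.
have -> : (\int[mu]_(u in @sym_itv R) (fun x => (a x)%:E)^\- u =
    \int[mu]_(u in @sym_itv R) (fun x => (a x)%:E)^\+ u)%E.
  rewrite integral_mkcond [RHS]integral_mkcond -[RHS]ge0_integral_reflect.
  - apply: eq_integral => u _; rewrite !patchE S_N funenegE funeposE aN.
    by case: ifP.
  - have mS : measurable (@sym_itv R) by exact: measurable_itv.
    apply/(measurable_restrictT _ mS); apply: measurable_funTS; apply: measurable_funepos.
    exact/measurable_EFinP.
  - by move=> u; rewrite patchE; case: ifP => // _; exact: funepos_ge0.
(* If the two equal parts are infinite, their difference is infinite and [fine] returns 0. *)
by case: (integral _ _ _) => [r| |]//=; rewrite subrr.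
Qed.

End odd_integrals.

(** * Tails and cross masses of Fejer kernels *)

Section fejer_tail.
Context {R : realType}.
Local Notation mu := (@lebesgue_measure R).
Local Notation S := (@sym_itv R).

Lemma measurable_far (delta : R) :
  measurable_fun [set: R] (fun u : R => (delta <= `|u|)%R%:R : R).
Proof.
rewrite (_ : (fun u : R => _) = fun u : R => if delta <= `|u| then 1 else 0); last first.
  by apply/funext => u; case: ifP.
by apply: measurable_fun_ifT => //; apply: measurable_fun_ler => //; exact: normr_measurable.
Qed.

Lemma far_integrable (delta : R) (a : R -> R) : mu.-integrable S (EFin \o a) ->
  mu.-integrable S (EFin \o (fun u => (delta <= `|u|)%R%:R * a u)).
Proof.
move=> ia; apply: (le_integrable _ _ _ ia); [exact: measurable_itv| |].
  apply/measurable_EFinP; apply: measurable_funM.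
    by apply: measurable_funTS; exact: measurable_far.
  by apply/measurable_EFinP; exact: measurable_int ia.
by move=> u _; rewrite /= lee_fin normrM ler_piMl//; case: (delta <= _); rewrite ?normr1 ?normr0.
Qed.

(** Away from the origin the kernels are bounded uniformly in [m], so the tail stays bounded while
    the full mass grows like m^(1 + 2d). *)
Lemma fejer_tail_le (d delta : R) : 0 < d < 2^-1 -> 0 < delta ->
  exists C : R, forall m,
    \int[mu]_(u in S) ((delta <= `|u|)%R%:R * (fejer m u * weight d u)) <= C.
Proof.
move=> d01 delta0; have [c c0 hc] := @fejer_sqr_le R.
exists (2 * c / delta ^+ 2 * \int[mu]_(u in S) weight d u) => m.
rewrite -RintegralZl ?weight_integrable//; last exact: measurable_itv.
have K0 : 0 <= 2 * c / delta ^+ 2 by rewrite divr_ge0 ?sqr_ge0// mulr_ge0// ltW.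
apply: le_Rintegral; first exact: measurable_itv.
- exact/far_integrable/fejer_weight_integrable.
- by apply: integrable_realZ; [exact: measurable_itv|exact: weight_integrable].
move=> u; rewrite /sym_itv/= in_itv/= => /andP[u1 u2].
have [du|_] := leP delta `|u|; last by rewrite mul0r mulr_ge0 ?weight_ge0.
rewrite mul1r ler_wpM2r ?weight_ge0//.
have : 0 <= `|u| <= pi by rewrite normr_ge0 ler_norml u1.
move=> /(hc _ m); rewrite [fejer m `|u|](_ : _ = fejer m u); last first.
  by case: (ger0P u) => _ //; rewrite fejerN.
move=> h; rewrite ler_pdivlMr ?exprn_gt0//.
have h2 : fejer m u * delta ^+ 2 <= `|u| ^+ 2 * fejer m u.
  rewrite mulrC ler_wpM2r ?fejer_ge0// lerXn2r ?nnegrE// ltW//.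
apply: (le_trans h2); apply: (le_trans h).
rewrite mulrC ler_wpM2r ?(ltW c0)//.
by have := cos_geN1 (m%:R * `|u|); lra.
Qed.

Lemma cross_cos_mass (d : R) m m' : 0 < d < 2^-1 ->
  \int[mu]_(u in S) (cross_cos m m' u * weight d u) =
  2^-1 * (fejer_mass d m + fejer_mass d m' - fejer_mass d (maxn m m' - minn m m')).
Proof.
move=> d01; have i k := fejer_weight_integrable k d01.
have mS : measurable (S : set (measurableTypeR R)) by exact: measurable_itv.
rewrite /fejer_mass -RintegralD// -RintegralB//; last exact: integrable_realD.
rewrite -RintegralZl//; last first.
  by apply: integrable_realB => //; exact: integrable_realD.
by apply: eq_Rintegral => u _; rewrite cross_cos_polar; ring.
Qed.

Lemma cross_sin_mass (d : R) m m' :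
  \int[mu]_(u in S) (cross_sin m m' u * weight d u) = 0.
Proof.
apply: Rintegral_odd.
  by apply: measurable_funM; [exact: measurable_cross_sin|exact: measurable_weight].
by move=> u; rewrite cross_sinN weightN mulNr.
Qed.

Lemma cvg_natr_dist (N : nat -> R) (m m' : nat -> nat) (x x' : R) :
  (forall n, 0 <= N n) -> (m n)%:R / N n @[n --> \oo] --> x -> (m' n)%:R / N n @[n --> \oo] --> x' ->
  (maxn (m n) (m' n) - minn (m n) (m' n))%:R / N n @[n --> \oo] --> `|x - x'|.
Proof.
move=> N0 mx mx'; rewrite (_ : (fun n => _) = fun n => `|(m n)%:R / N n - (m' n)%:R / N n|).
  by apply: cvg_norm; exact: cvgB.
apply/funext => n; rewrite -mulrBl normrM [`|(N n)^-1|]ger0_norm ?invr_ge0//; congr (_ / _).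
rewrite natrB ?geq_min ?leq_max ?leqnn//.
wlog h : m m' {mx mx'} / (m' n <= m n)%N.
  move=> h; have /orP[] := leq_total (m' n) (m n); first exact: h.
  by move=> /h; rewrite maxnC minnC distrC.
by rewrite (maxn_idPl h) (minn_idPr h) ger0_norm// subr_ge0 ler_nat.
Qed.

Lemma cross_cos_mass_cvg (d : R) (N : nat -> R) (m m' : nat -> nat) (x x' : R) :
  0 < d < 2^-1 -> (forall n, 0 <= N n) -> N n @[n --> \oo] --> +oo ->
  (m n)%:R / N n @[n --> \oo] --> x -> (m' n)%:R / N n @[n --> \oo] --> x' ->
  N n `^ (- (1 + 2 * d)) * \int[mu]_(u in S) (cross_cos (m n) (m' n) u * weight d u)
    @[n --> \oo] -->
  2^-1 * (x `^ (1 + 2 * d) + x' `^ (1 + 2 * d) - `|x - x'| `^ (1 + 2 * d)) * fine (kappa_sq d).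
Proof.
move=> d01 N0 Ny mx mx'.
rewrite (_ : (fun n => _) = fun n =>
  2^-1 * (N n `^ (- (1 + 2 * d)) * fejer_mass d (m n) +
          N n `^ (- (1 + 2 * d)) * fejer_mass d (m' n) -
          N n `^ (- (1 + 2 * d)) * fejer_mass d (maxn (m n) (m' n) - minn (m n) (m' n)))); last first.
  by apply/funext => n; rewrite cross_cos_mass//; ring.
have c1 := fejer_mass_cvg d01 Ny mx; have c2 := fejer_mass_cvg d01 Ny mx'.
have c3 := fejer_mass_cvg d01 Ny (cvg_natr_dist N0 mx mx').
rewrite -mulrA mulrBl [X in _ * (X - _)]mulrDl; apply: cvgM; first exact: cvg_cst.
exact: (cvgB (cvgD c1 c2) c3).
Qed.

End fejer_tail.

(** * Covariances of partial sums *)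

Section covariance_asymptotics.
Context {R : realType}.
Local Notation mu := (@lebesgue_measure R).
Local Notation mu2 := (@lebesgue2 R).
Local Notation S := (@sym_itv R).
Local Notation T := (@torus R).

Let mS : measurable (S : set (measurableTypeR R)).
Proof. exact: measurable_itv. Qed.

Lemma measurable_torus : measurable (T : set (measurableTypeR R * measurableTypeR R)).
Proof. exact: measurableX. Qed.

(** With D_m the exponential sums, the real part of the product of conj(D_m) D_m' at [z.1] and
    conj(D_l) D_l' at [z.2]. Its integral against the spectral density is the covariance of two
    rectangle sums. *)
Definition dirichlet_kernel m m' l l' (z : R * R) : R :=
  cross_cos m m' z.1 * cross_cos l l' z.2 - cross_sin m m' z.1 * cross_sin l l' z.2.

Definition fejer_mean m m' (u : R) : R := 2^-1 * (fejer m u + fejer m' u).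

Lemma fejer_mean_ge0 m m' u : 0 <= fejer_mean m m' u.
Proof. by rewrite mulr_ge0// addr_ge0// fejer_ge0. Qed.

Lemma fejer_mean_le m m' u : fejer_mean m m' u <= m%:R ^+ 2 + m'%:R ^+ 2.
Proof. by rewrite /fejer_mean; have := fejer_le m u; have := fejer_le m' u; lra. Qed.

Lemma measurable_fejer_mean m m' : measurable_fun [set: R] (fejer_mean m m').
Proof.
by apply: measurable_funM => //; apply: measurable_funD; exact: measurable_fejer.
Qed.

Definition mean_mass (d : R) m m' : R :=
  \int[mu]_(u in S) (fejer_mean m m' u * weight d u).

Definition mean_tail (d delta : R) m m' : R :=
  \int[mu]_(u in S) ((delta <= `|u|)%R%:R * (fejer_mean m m' u * weight d u)).

(** The kernel changes sign; errors are bounded in absolute value through this nonnegative product,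
    whose weighted masses are combinations of Fejer masses. *)
Lemma kernel_le m m' l l' z :
  `|dirichlet_kernel m m' l l' z| <= 2 * (fejer_mean m m' z.1 * fejer_mean l l' z.2).
Proof.
rewrite (le_trans (ler_normB _ _))// mulr_natl mulr2n !normrM.
by rewrite lerD// ler_pM// ?cross_cos_le ?cross_sin_le.
Qed.

Lemma measurable_dirichlet_kernel m m' l l' :
  measurable_fun [set: measurableTypeR R * measurableTypeR R] (dirichlet_kernel m m' l l').
Proof.
have h1 (a : R -> R) : measurable_fun [set: R] a ->
    measurable_fun [set: measurableTypeR R * measurableTypeR R] (fun z => a z.1).
  by move=> ma; exact: (measurableT_comp ma measurable_fst).
have h2 (a : R -> R) : measurable_fun [set: R] a ->
    measurable_fun [set: measurableTypeR R * measurableTypeR R] (fun z => a z.2).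
  by move=> ma; exact: (measurableT_comp ma measurable_snd).
apply: measurable_funB; apply: measurable_funM; solve
  [exact: (h1 _ (measurable_cross_cos _ _))|exact: (h2 _ (measurable_cross_cos _ _))
  |exact: (h1 _ (measurable_cross_sin _ _))|exact: (h2 _ (measurable_cross_sin _ _))].
Qed.

Lemma kernel_integrable m m' l l' (f : R * R -> R) : mu2.-integrable T (EFin \o f) ->
  mu2.-integrable T (EFin \o (fun z => dirichlet_kernel m m' l l' z * f z)).
Proof.
move=> fi; pose C : R := 2 * ((m%:R ^+ 2 + m'%:R ^+ 2) * (l%:R ^+ 2 + l'%:R ^+ 2)).
have C0 : 0 <= C by rewrite mulr_ge0// mulr_ge0// addr_ge0// sqr_ge0.
have := integrable_realZ measurable_torus C fi.
apply: le_integrable; first exact: measurable_torus.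
  apply/measurable_EFinP; apply: measurable_funM.
    by apply: measurable_funTS; exact: measurable_dirichlet_kernel.
  by apply/measurable_EFinP; exact: measurable_int fi.
move=> z _; rewrite /= lee_fin normrM [leRHS]normrM (ger0_norm C0) ler_wpM2r//.
apply: (le_trans (kernel_le _ _ _ _ _)); rewrite /C ler_pM2l//.
by rewrite ler_pM ?fejer_mean_ge0 ?fejer_mean_le.
Qed.

Variables d1 d2 : R.
Hypotheses (hd1 : 0 < d1 < 2^-1) (hd2 : 0 < d2 < 2^-1).

Definition weight2 (z : R * R) : R := weight d1 z.1 * weight d2 z.2.

Lemma weight2_ge0 z : 0 <= weight2 z.
Proof. by rewrite mulr_ge0 ?weight_ge0. Qed.

Lemma weight2_integrable : mu2.-integrable T (EFin \o weight2).
Proof. by apply: integrable_tensor => //; exact: weight_integrable. Qed.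

Lemma cross_integrable (d : R) (a : R -> R) m m' : 0 < d < 2^-1 ->
  measurable_fun [set: R] a -> (forall u, `|a u| <= fejer_mean m m' u) ->
  mu.-integrable S (EFin \o (fun u => a u * weight d u)).
Proof.
move=> d01 ma ale; have := integrable_realZ mS (m%:R ^+ 2 + m'%:R ^+ 2) (weight_integrable d01).
apply: le_integrable => //.
  apply/measurable_EFinP; apply: measurable_funTS.
  by apply: measurable_funM => //; exact: measurable_weight.
move=> u _; rewrite /= lee_fin !normrM ler_wpM2r//.
by rewrite (le_trans (ale u))// (le_trans (fejer_mean_le _ _ _))// ler_norm.
Qed.

Lemma fejer_mean_integrable (d : R) m m' : 0 < d < 2^-1 ->
  mu.-integrable S (EFin \o (fun u => fejer_mean m m' u * weight d u)).
Proof.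
move=> d01; apply: (cross_integrable (m := m) (m' := m') d01); first exact: measurable_fejer_mean.
by move=> u; rewrite ger0_norm// fejer_mean_ge0.
Qed.

(** The weight is even in each variable and [cross_sin] is odd, so the product of the sine terms
    integrates to 0. *)
Lemma kernel_weight2 m m' l l' :
  \int[mu2]_(z in T) (dirichlet_kernel m m' l l' z * weight2 z) =
  (\int[mu]_(u in S) (cross_cos m m' u * weight d1 u)) *
  (\int[mu]_(v in S) (cross_cos l l' v * weight d2 v)).
Proof.
have ic (d : R) k k' : 0 < d < 2^-1 -> mu.-integrable S (EFin \o (fun u => cross_cos k k' u * weight d u)).
  move=> d01; apply: (cross_integrable d01); first exact: measurable_cross_cos.
  by move=> u; exact: cross_cos_le.
have isn (d : R) k k' : 0 < d < 2^-1 -> mu.-integrable S (EFin \o (fun u => cross_sin k k' u * weight d u)).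
  move=> d01; apply: (cross_integrable d01); first exact: measurable_cross_sin.
  by move=> u; exact: cross_sin_le.
transitivity (\int[mu2]_(z in T)
   ((cross_cos m m' z.1 * weight d1 z.1) * (cross_cos l l' z.2 * weight d2 z.2) -
    (cross_sin m m' z.1 * weight d1 z.1) * (cross_sin l l' z.2 * weight d2 z.2))).
  by apply: eq_Rintegral => z _; rewrite /dirichlet_kernel /weight2; ring.
rewrite RintegralB; last 3 first.
- exact: measurable_torus.
- exact: (integrable_tensor mS mS (ic _ m m' hd1) (ic _ l l' hd2)).
- exact: (integrable_tensor mS mS (isn _ m m' hd1) (isn _ l l' hd2)).
rewrite (Rintegral_tensor mS mS (ic _ m m' hd1) (ic _ l l' hd2)).
rewrite (Rintegral_tensor mS mS (isn _ m m' hd1) (isn _ l l' hd2)).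
by rewrite cross_sin_mass mul0r subr0.
Qed.

(** The indicators of the two strips are added, not combined into one, so that every term of the
    majorant is a product of one-dimensional integrals. The factor 2 is that of [kernel_le]. *)
Lemma kernel_error m m' l l' (f : R * R -> R) (eps M delta : R) :
  mu2.-integrable T (EFin \o f) ->
  (forall z, T z -> `|f z - weight2 z| <=
     (eps + M * ((delta <= `|z.1|)%R%:R + (delta <= `|z.2|)%R%:R)) * weight2 z) ->
  `|\int[mu2]_(z in T) (dirichlet_kernel m m' l l' z * f z) -
    \int[mu2]_(z in T) (dirichlet_kernel m m' l l' z * weight2 z)| <=
  2 * (eps * (mean_mass d1 m m' * mean_mass d2 l l') +
       M * (mean_tail d1 delta m m' * mean_mass d2 l l' +
            mean_mass d1 m m' * mean_tail d2 delta l l')).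
Proof.
move=> fi fle; have mT := measurable_torus.
have ki := kernel_integrable m m' l l' fi.
have kwi := kernel_integrable m m' l l' weight2_integrable.
rewrite -RintegralB//; have kbi := integrable_realB mT ki kwi.
apply: (le_trans (le_normr_Rintegral mT kbi)).
have ia := fejer_mean_integrable m m' hd1; have ib := fejer_mean_integrable l l' hd2.
have ia' := far_integrable delta ia; have ib' := far_integrable delta ib.
have iab := integrable_realZ mT eps (integrable_tensor mS mS ia ib).
have iab1 := integrable_tensor mS mS ia' ib.
have iab2 := integrable_tensor mS mS ia ib'.
have iab12 := integrable_realD mT iab1 iab2.
have iM := integrable_realZ mT M iab12.
have isum := integrable_realD mT iab iM.
have idom := integrable_realZ mT 2 isum.
have -> : 2 * (eps * (mean_mass d1 m m' * mean_mass d2 l l') +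
       M * (mean_tail d1 delta m m' * mean_mass d2 l l' +
            mean_mass d1 m m' * mean_tail d2 delta l l')) = \int[mu2]_(z in T)
  (2 * (eps * ((fejer_mean m m' z.1 * weight d1 z.1) * (fejer_mean l l' z.2 * weight d2 z.2)) +
   M * (((delta <= `|z.1|)%R%:R * (fejer_mean m m' z.1 * weight d1 z.1)) *
        (fejer_mean l l' z.2 * weight d2 z.2) +
        (fejer_mean m m' z.1 * weight d1 z.1) *
        ((delta <= `|z.2|)%R%:R * (fejer_mean l l' z.2 * weight d2 z.2))))).
  rewrite RintegralZl//; congr (_ * _); rewrite RintegralD//; congr (_ + _).
    by rewrite RintegralZl; [rewrite (Rintegral_tensor mS mS ia ib)|exact: mT|exact: (integrable_tensor mS mS ia ib)].
  rewrite RintegralZl//; congr (_ * _); rewrite RintegralD//.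
  by rewrite (Rintegral_tensor mS mS ia' ib) (Rintegral_tensor mS mS ia ib').
apply: le_Rintegral => //; first exact: (integrable_norm kbi).
move=> z Tz; rewrite /= -mulrBr normrM.
apply: (le_trans (ler_pM (normr_ge0 _) (normr_ge0 _) (kernel_le _ _ _ _ _) (fle z Tz))).
by rewrite /weight2 le_eqVlt; apply/orP; left; apply/eqP; ring.
Qed.

End covariance_asymptotics.

(** * Limits of the kernel integrals *)

Section kernel_asymptotics.
Context {R : realType}.
Local Notation mu := (@lebesgue_measure R).
Local Notation mu2 := (@lebesgue2 R).
Local Notation S := (@sym_itv R).
Local Notation T := (@torus R).

Let mS : measurable (S : set (measurableTypeR R)).
Proof. exact: measurable_itv. Qed.

Lemma mean_massE (d : R) m m' : 0 < d < 2^-1 ->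
  mean_mass d m m' = 2^-1 * (fejer_mass d m + fejer_mass d m').
Proof.
move=> d01; have i k := fejer_weight_integrable k d01.
rewrite /fejer_mass -RintegralD// -RintegralZl//; last exact: integrable_realD.
by apply: eq_Rintegral => u _; rewrite /fejer_mean; ring.
Qed.

Lemma mean_tail_ge0 (d delta : R) m m' : 0 <= mean_tail d delta m m'.
Proof.
by apply: Rintegral_ge0 => u _; rewrite mulr_ge0 ?ler0n// mulr_ge0 ?fejer_mean_ge0 ?weight_ge0.
Qed.

Lemma mean_tail_le (d delta : R) : 0 < d < 2^-1 -> 0 < delta ->
  exists C : R, forall m m', mean_tail d delta m m' <= C.
Proof.
move=> d01 delta0; have [C hC] := fejer_tail_le d01 delta0; exists C => m m'.
have i k := far_integrable delta (fejer_weight_integrable k d01).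
have -> : mean_tail d delta m m' =
  2^-1 * (\int[mu]_(u in S) ((delta <= `|u|)%R%:R * (fejer m u * weight d u)) +
          \int[mu]_(u in S) ((delta <= `|u|)%R%:R * (fejer m' u * weight d u))).
  rewrite -RintegralD// -RintegralZl//; last exact: integrable_realD.
  by apply: eq_Rintegral => u _; rewrite /fejer_mean; ring.
by have := hC m; have := hC m'; lra.
Qed.

Lemma mean_mass_cvg (d : R) (N : nat -> R) (m m' : nat -> nat) (x x' : R) :
  0 < d < 2^-1 -> N n @[n --> \oo] --> +oo ->
  (m n)%:R / N n @[n --> \oo] --> x -> (m' n)%:R / N n @[n --> \oo] --> x' ->
  N n `^ (- (1 + 2 * d)) * mean_mass d (m n) (m' n) @[n --> \oo] -->
  2^-1 * (x `^ (1 + 2 * d) * fine (kappa_sq d) + x' `^ (1 + 2 * d) * fine (kappa_sq d)).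
Proof.
move=> d01 Ny mx mx'.
have c1 := fejer_mass_cvg d01 Ny mx; have c2 := fejer_mass_cvg d01 Ny mx'.
rewrite (_ : (fun n => _) = fun n =>
  2^-1 * (N n `^ (- (1 + 2 * d)) * fejer_mass d (m n) +
          N n `^ (- (1 + 2 * d)) * fejer_mass d (m' n))); last first.
  by apply/funext => n; rewrite mean_massE//; ring.
apply: cvgM; first exact: cvg_cst.
exact: (cvgD c1 c2).
Qed.

Lemma powR_cvg0_nat (p : R) (N : nat -> R) : 0 < p -> N n @[n --> \oo] --> +oo ->
  N n `^ (- p) @[n --> \oo] --> (0 : R).
Proof. by move=> p0 Ny; exact: (cvg_comp _ _ Ny (powR_cvgy0 p0)). Qed.

Lemma mean_tail_cvg (d delta : R) (N : nat -> R) (m m' : nat -> nat) :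
  0 < d < 2^-1 -> 0 < delta -> N n @[n --> \oo] --> +oo ->
  N n `^ (- (1 + 2 * d)) * mean_tail d delta (m n) (m' n) @[n --> \oo] --> (0 : R).
Proof.
move=> d01 delta0 Ny; have [C hC] := mean_tail_le d01 delta0.
have p0 : 0 < 1 + 2 * d by move: d01 => /andP[]; lra.
have NC : N n `^ (- (1 + 2 * d)) * C @[n --> \oo] --> (0 : R).
  rewrite -(mul0r C); apply: cvgM; last exact: cvg_cst.
  exact: powR_cvg0_nat.
apply: (squeeze_cvgr _ (cvg_cst 0) NC); near=> n; apply/andP; split.
  by rewrite mulr_ge0 ?powR_ge0 ?mean_tail_ge0.
by rewrite ler_wpM2l ?powR_ge0.
Unshelve. all: by end_near. Qed.

Variables d1 d2 : R.
Hypotheses (hd1 : 0 < d1 < 2^-1) (hd2 : 0 < d2 < 2^-1).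

(** Asymptotic equality with the weight at the origin, and comparability elsewhere, as a relative
    error in multiplicative form: the weight is 0 on the axes by convention and cannot be divided
    by. *)
Definition asymp_weight2 (f : R * R -> R) : Prop :=
  exists2 M : R, 0 <= M & forall eps : R, 0 < eps -> exists2 delta : R, 0 < delta &
    forall z, T z -> `|f z - weight2 d1 d2 z| <=
      (eps + M * ((delta <= `|z.1|)%R%:R + (delta <= `|z.2|)%R%:R)) * weight2 d1 d2 z.

Theorem kernel_cvg (f : R * R -> R) (N1 N2 : nat -> R) (m m' l l' : nat -> nat) (x x' y y' : R) :
  mu2.-integrable T (EFin \o f) -> asymp_weight2 f ->
  (forall n, 0 <= N1 n) -> N1 n @[n --> \oo] --> +oo ->
  (forall n, 0 <= N2 n) -> N2 n @[n --> \oo] --> +oo ->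
  (m n)%:R / N1 n @[n --> \oo] --> x -> (m' n)%:R / N1 n @[n --> \oo] --> x' ->
  (l n)%:R / N2 n @[n --> \oo] --> y -> (l' n)%:R / N2 n @[n --> \oo] --> y' ->
  N1 n `^ (- (1 + 2 * d1)) * N2 n `^ (- (1 + 2 * d2)) *
    \int[mu2]_(z in T) (dirichlet_kernel (m n) (m' n) (l n) (l' n) z * f z) @[n --> \oo] -->
  (2^-1 * (x `^ (1 + 2 * d1) + x' `^ (1 + 2 * d1) - `|x - x'| `^ (1 + 2 * d1)) *
     fine (kappa_sq d1)) *
  (2^-1 * (y `^ (1 + 2 * d2) + y' `^ (1 + 2 * d2) - `|y - y'| `^ (1 + 2 * d2)) *
     fine (kappa_sq d2)).
Proof.
move=> fi [M M0 hf] N10 N1y N20 N2y mx mx' ly ly'.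
pose p n := N1 n `^ (- (1 + 2 * d1)); pose q n := N2 n `^ (- (1 + 2 * d2)).
have p0 n : 0 <= p n by exact: powR_ge0.
have q0 n : 0 <= q n by exact: powR_ge0.
have cA := mean_mass_cvg hd1 N1y mx mx'; have cB := mean_mass_cvg hd2 N2y ly ly'.
set a := (X in _ --> X) in cA; set b := (X in _ --> X) in cB.
have main : p n * q n * \int[mu2]_(z in T)
    (dirichlet_kernel (m n) (m' n) (l n) (l' n) z * weight2 d1 d2 z) @[n --> \oo] -->
  (2^-1 * (x `^ (1 + 2 * d1) + x' `^ (1 + 2 * d1) - `|x - x'| `^ (1 + 2 * d1)) *
     fine (kappa_sq d1)) *
  (2^-1 * (y `^ (1 + 2 * d2) + y' `^ (1 + 2 * d2) - `|y - y'| `^ (1 + 2 * d2)) *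
     fine (kappa_sq d2)).
  have c1 := cross_cos_mass_cvg hd1 N10 N1y mx mx'.
  have c2 := cross_cos_mass_cvg hd2 N20 N2y ly ly'.
  rewrite (_ : (fun n => _) = fun n =>
    (p n * \int[mu]_(u in S) (cross_cos (m n) (m' n) u * weight d1 u)) *
    (q n * \int[mu]_(u in S) (cross_cos (l n) (l' n) u * weight d2 u))).
    exact: (cvgM c1 c2).
  by apply/funext => n; rewrite (kernel_weight2 hd1 hd2) mulrACA.
rewrite -[X in _ --> X]addr0 (_ : (fun n => _) = fun n =>
  p n * q n * \int[mu2]_(z in T) (dirichlet_kernel (m n) (m' n) (l n) (l' n) z * weight2 d1 d2 z) +
  p n * q n * (\int[mu2]_(z in T) (dirichlet_kernel (m n) (m' n) (l n) (l' n) z * f z) -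
    \int[mu2]_(z in T) (dirichlet_kernel (m n) (m' n) (l n) (l' n) z * weight2 d1 d2 z))); last first.
  by apply/funext => n; rewrite -/(p n) -/(q n); ring.
apply: cvgD => //; apply/cvgr0Pnorm_le => e e0.
have ab0 : 0 < `|a * b| + 1 by rewrite ltr_wpDl.
(* The normalized masses tend to [a] and [b], so the part of the error carrying [eps] has limit at
   most e / 2; the parts carrying a tail tend to 0. *)
pose eps := e / (4 * (`|a * b| + 1)).
have eps0 : 0 < eps by rewrite divr_gt0// mulr_gt0.
have [delta delta0 hdelta] := hf eps eps0.
have cA' := mean_tail_cvg m m' hd1 delta0 N1y; have cB' := mean_tail_cvg l l' hd2 delta0 N2y.
have cE : 2 * (eps * ((p n * mean_mass d1 (m n) (m' n)) * (q n * mean_mass d2 (l n) (l' n))) +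
    M * ((p n * mean_tail d1 delta (m n) (m' n)) * (q n * mean_mass d2 (l n) (l' n)) +
         (p n * mean_mass d1 (m n) (m' n)) * (q n * mean_tail d2 delta (l n) (l' n))))
   @[n --> \oo] --> 2 * (eps * (a * b) + M * (0 * b + a * 0)).
  apply: cvgM; first exact: cvg_cst.
  apply: cvgD; apply: cvgM; first exact: cvg_cst; first exact: (cvgM cA cB).
    exact: cvg_cst.
  by apply: cvgD; [exact: (cvgM cA' cB)|exact: (cvgM cA cB')].
have lt_e : 2 * (eps * (a * b) + M * (0 * b + a * 0)) < e.
  rewrite mul0r !mulr0 addr0 mulr0 addr0.
  have h1 : eps * (a * b) <= eps * (`|a * b| + 1).
    by rewrite ler_pM2l// (le_trans (ler_norm _))// lerDl.
  have h2 : eps * (`|a * b| + 1) = e / 4 by rewrite /eps; field; rewrite gt_eqF.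
  by move: h1; rewrite h2; lra.
near=> n.
rewrite normrM ger0_norm ?mulr_ge0//.
have err := kernel_error hd1 hd2 (m n) (m' n) (l n) (l' n) fi hdelta.
apply: (le_trans (ler_wpM2l (mulr_ge0 (p0 n) (q0 n)) err)).
apply: (@le_trans _ _ (2 * (eps * ((p n * mean_mass d1 (m n) (m' n)) * (q n * mean_mass d2 (l n) (l' n))) +
    M * ((p n * mean_tail d1 delta (m n) (m' n)) * (q n * mean_mass d2 (l n) (l' n)) +
         (p n * mean_mass d1 (m n) (m' n)) * (q n * mean_tail d2 delta (l n) (l' n)))))).
  by rewrite le_eqVlt; apply/orP; left; apply/eqP; ring.
near: n; exact: cvgr_le cE _ lt_e.
Unshelve. all: by end_near. Qed.

End kernel_asymptotics.

(** * Operations on Gaussian fields and transfer of expectations *)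

Section field_operations.
Context {R : realType} {I : Type}.
Implicit Types Y Z : random_field R I.

Lemma gaussian_scale c Y : gaussian Y -> gaussian (rf_scale c Y).
Proof.
move=> gY k p a; have := gY k p (fun j => a j * c).
by under eq_fun do under eq_bigr do rewrite -mulrA.
Qed.

Lemma gaussian_reindex (J : Type) (h : J -> I) Y : gaussian Y -> gaussian (rf_reindex h Y).
Proof. by move=> gY k p a; exact: (gY k (h \o p) a). Qed.

Lemma zero_mean_reindex (J : Type) (h : J -> I) Y : zero_mean Y -> zero_mean (rf_reindex h Y).
Proof. by move=> zY j; exact: zY. Qed.

(** Indices may repeat in [r], as [gaussian] ranges over arbitrary families; linear combinations of
    sums over overlapping rectangles are of this kind. *)
Lemma gaussian_sum_seq Y (r : seq (R * I)) : gaussian Y ->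
  normal_rv (rf_prob Y) (fun w => \sum_(i <- r) i.1 * Y i.2 w).
Proof.
move=> gY; have := gY (size r) (fun j => (tnth (in_tuple r) j).2) (fun j => (tnth (in_tuple r) j).1).
by under eq_fun do rewrite -(big_tnth _ _ _ predT (fun i => i.1 * Y i.2 _)).
Qed.

Lemma mean0_sum_seq Y (r : seq (R * I)) : gaussian Y -> zero_mean Y ->
  'E_(rf_prob Y)[(fun w => \sum_(i <- r) i.1 * Y i.2 w)%R]%E = 0%E.
Proof.
move=> gY zY; have := lincomb_mean0 gY zY (fun j => (tnth (in_tuple r) j).2)
  (fun j => (tnth (in_tuple r) j).1).
by under eq_fun do rewrite -(big_tnth _ _ _ predT (fun i => i.1 * Y i.2 _)).
Qed.

Lemma zero_mean_scale c Y : gaussian Y -> zero_mean Y -> zero_mean (rf_scale c Y).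
Proof.
move=> gY zY i; have := mean0_sum_seq [:: (c, i)] gY zY.
by under eq_fun do rewrite big_seq1.
Qed.

Lemma rf_cov_scale c Y i j : gaussian Y -> zero_mean Y ->
  rf_cov (rf_scale c Y) i j = c ^+ 2 * rf_cov Y i j.
Proof.
move=> gY zY; rewrite /rf_cov /= -RintegralZl//; last exact: integrable_component_mul.
by apply: eq_Rintegral => w _; ring.
Qed.

Lemma rf_cov_sum Y (r s : seq I) : gaussian Y -> zero_mean Y ->
  \int[rf_prob Y]_w ((\sum_(i <- r) Y i w) * (\sum_(j <- s) Y j w)) =
  \sum_(i <- r) \sum_(j <- s) rf_cov Y i j.
Proof.
move=> gY zY; have ij i j := integrable_component_mul gY zY i j.
transitivity (\int[rf_prob Y]_w (\sum_(i <- r) \sum_(j <- s) Y i w * Y j w)).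
  by apply: eq_Rintegral => w _; rewrite mulr_suml; apply: eq_bigr => i _; rewrite mulr_sumr.
rewrite Rintegral_sum//; last first.
  by move=> i; apply: integrable_real_sum => // j; exact: ij.
by apply: eq_bigr => i _; rewrite Rintegral_sum// => j; exact: ij.
Qed.

Lemma borel_continuous_preimage k (phi : 'rV[R]_k -> R) (B : set R) : continuous phi ->
  measurable B -> <<s [set U : set 'rV[R]_k | open U] >> (phi @^-1` B).
Proof.
move=> cphi mB.
have : measurable_fun setT (phi : g_sigma_algebraType [set U : set 'rV[R]_k | open U] -> R).
  apply: (measurability _ (RGenOInfty.measurableE R)).
  move=> _ [_ [x ->] <-]; rewrite setTI; apply: sub_gen_smallest => /=.
  by apply: open_comp; [move=> v _; exact: cphi|exact: interval_open].
by move=> /(_ measurableT B mB); rewrite setTI.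
Qed.

(** Positive and negative parts are transferred separately, which covers unbounded [phi]; the
    product of two coordinates then yields the shift invariance of covariances. *)
Lemma same_fdd_expectation Y Z k (p : 'I_k -> I) (phi : 'rV[R]_k -> R) :
  same_fdd Y Z -> continuous phi ->
  'E_(rf_prob Y)[phi \o @rf_vector R I Y k p]%E = 'E_(rf_prob Z)[phi \o @rf_vector R I Z k p]%E.
Proof.
move=> YZ cphi.
have mY : measurable_fun setT (phi \o @rf_vector R I Y k p) by exact: measurable_continuous_rf_vector.
have mZ : measurable_fun setT (phi \o @rf_vector R I Z k p) by exact: measurable_continuous_rf_vector.
have E (h : R -> \bar R) : measurable_fun setT h -> (forall x, 0 <= h x)%E ->
   (\int[rf_prob Y]_w h (phi (rf_vector p w)) = \int[rf_prob Z]_w h (phi (rf_vector p w)))%E.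
  move=> mh h0.
  have := @ge0_integral_pushforward _ _ _ _ R _ mY (rf_prob Y) setT h measurableT mh (fun x _ => h0 x).
  have := @ge0_integral_pushforward _ _ _ _ R _ mZ (rf_prob Z) setT h measurableT mh (fun x _ => h0 x).
  rewrite !preimage_setT => /= <- <-; apply: eq_measure_integral => A mA _.
  rewrite /pushforward; exact: (YZ k p _ (borel_continuous_preimage cphi mA)).
have mE : measurable_fun [set: R] (@EFin R) by exact/measurable_EFinP.
rewrite unlock integralE [RHS]integralE; congr (_ - _)%E.
  transitivity (\int[rf_prob Y]_w ((@EFin R)^\+%E (phi (rf_vector p w))))%E.
    by apply: eq_integral => w _; rewrite !funeposE.
  rewrite (E _ (measurable_funepos mE)) => [|x]; last exact: funepos_ge0.
  by apply: eq_integral => w _; rewrite !funeposE.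
transitivity (\int[rf_prob Y]_w ((@EFin R)^\-%E (phi (rf_vector p w))))%E.
  by apply: eq_integral => w _; rewrite !funenegE.
rewrite (E _ (measurable_funeneg mE)) => [|x]; last exact: funeneg_ge0.
by apply: eq_integral => w _; rewrite !funenegE.
Qed.

End field_operations.

(** * Covariances of rectangle sums as spectral integrals *)

Section spectral_covariance.
Context {R : realType}.
Local Notation mu2 := (@lebesgue2 R).
Local Notation T := (@torus R).
Variables (X : random_field R (int * int)) (f : R * R -> R).
Hypotheses (sX : stationary X) (gX : gaussian X) (zX : zero_mean X).
Hypothesis Xf : spectral_density X f.

Lemma stationary_cov (s t : int * int) : rf_cov X s t = rf_cov X (0, 0) (t - s).
Proof.
apply/EFin_inj; rewrite -!rf_covE//.
pose p (j : 'I_2) : int * int := if j == 0 then (0, 0) else t - s.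
pose phi (v : 'rV[R]_2) : R := v 0 0 * v 0 1.
have cphi : continuous phi.
  by move=> v; apply: (@continuousM _ _ (fun v : 'rV[R]_2 => v 0 0) (fun v => v 0 1));
    exact: coord_continuous.
have := same_fdd_expectation p (sX s) cphi.
have E1 : phi \o @rf_vector R _ (rf_reindex (fun t => t + s) X) 2 p = (fun w => X s w * X t w).
  apply/funext => w; rewrite /= /phi /rf_vector !mxE /p/= subrK.
  by rewrite (_ : (0, 0) + s = s)// -[RHS]add0r.
have E2 : phi \o @rf_vector R _ X 2 p = (fun w => X (0, 0) w * X (t - s) w).
  by apply/funext => w; rewrite /= /phi /rf_vector !mxE.
by rewrite E1 E2.
Qed.

Lemma spectral_cov (h : int * int) : rf_cov X (0, 0) h =
  \int[mu2]_(z in T) (cos (h.1%:~R * z.1 + h.2%:~R * z.2) * f z).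
Proof.
have [_ _ _ /(_ h.1 h.2)[c cE cI]] := Xf.
have -> : rf_cov X (0, 0) h = c by apply/EFin_inj; rewrite -rf_covE// -cE; case: (h).
have := congr1 (@complex.Re R) cI => /= ->.
by apply: eq_Rintegral => z _; rewrite /= mulr0 subr0.
Qed.

Lemma cos_integrable (a b : R) :
  mu2.-integrable T (EFin \o (fun z => cos (a * z.1 + b * z.2) * f z)).
Proof.
have [_ _ fi _] := Xf.
move: (fi); apply: le_integrable; first exact: measurable_torus.
  apply/measurable_EFinP; apply: measurable_funM; last by apply/measurable_EFinP; exact: measurable_int fi.
  apply: measurable_funTS; apply: measurableT_comp.
    by apply: continuous_measurable_fun; exact: continuous_cos.
  apply: measurable_funD; apply: measurable_funM => //; solve [exact: measurable_fst|exact: measurable_snd].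
by move=> z _; rewrite /= lee_fin normrM ler_piMl// cos_max.
Qed.

Definition rectangle m l : seq (int * int) :=
  [seq (t%:Z, s%:Z) | t <- index_iota 1 m.+1, s <- index_iota 1 l.+1].

Lemma sum_rectangle (V : zmodType) m l (F : int * int -> V) :
  \sum_(i <- rectangle m l) F i =
  \sum_(1 <= t < m.+1) \sum_(1 <= s < l.+1) F (t%:Z, s%:Z).
Proof. by rewrite /rectangle big_allpairs_dep. Qed.

Lemma sum_cos_rectangle m l (z : R * R) :
  \sum_(i <- rectangle m l) cos (i.1%:~R * z.1 + i.2%:~R * z.2) =
  dcos m z.1 * dcos l z.2 - dsin m z.1 * dsin l z.2.
Proof.
rewrite sum_rectangle /dcos /dsin !mulr_suml -sumrB; apply: eq_bigr => t _.
by rewrite !mulr_sumr -sumrB; apply: eq_bigr => s _; rewrite cosD.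
Qed.

Lemma sum_sin_rectangle m l (z : R * R) :
  \sum_(i <- rectangle m l) sin (i.1%:~R * z.1 + i.2%:~R * z.2) =
  dsin m z.1 * dcos l z.2 + dcos m z.1 * dsin l z.2.
Proof.
rewrite sum_rectangle /dcos /dsin !mulr_suml -big_split/=; apply: eq_bigr => t _.
by rewrite !mulr_sumr -big_split/=; apply: eq_bigr => s _; rewrite sinD.
Qed.

(** The cosine of a difference decouples the two rectangles, and the addition formulas split each
    rectangle sum into one-dimensional sums. *)
Lemma sum_cos_rectangle2 m m' l l' (z : R * R) :
  \sum_(i <- rectangle m l) \sum_(j <- rectangle m' l')
    cos ((j - i).1%:~R * z.1 + (j - i).2%:~R * z.2) = dirichlet_kernel m m' l l' z.
Proof.
pose A (i : int * int) := i.1%:~R * z.1 + i.2%:~R * z.2.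
transitivity ((\sum_(i <- rectangle m l) cos (A i)) * (\sum_(j <- rectangle m' l') cos (A j)) +
  (\sum_(i <- rectangle m l) sin (A i)) * (\sum_(j <- rectangle m' l') sin (A j))).
  rewrite !mulr_suml -big_split/=; apply: eq_bigr => i _.
  rewrite !mulr_sumr -big_split/=; apply: eq_bigr => j _.
  rewrite (_ : _ + _ = A j - A i); last by rewrite /A/= !rmorphB/=; ring.
  by rewrite cosB; ring.
rewrite !sum_cos_rectangle !sum_sin_rectangle /dirichlet_kernel /cross_cos /cross_sin.
by ring.
Qed.

Lemma cov_rectangle m m' l l' :
  \int[rf_prob X]_w ((\sum_(i <- rectangle m l) X i w) * (\sum_(j <- rectangle m' l') X j w)) =
  \int[mu2]_(z in T) (dirichlet_kernel m m' l l' z * f z).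
Proof.
have mT := @measurable_torus R.
rewrite rf_cov_sum//.
transitivity (\int[mu2]_(z in T) (\sum_(i <- rectangle m l) \sum_(j <- rectangle m' l')
    cos ((j - i).1%:~R * z.1 + (j - i).2%:~R * z.2) * f z)); last first.
  apply: eq_Rintegral => z _; rewrite -sum_cos_rectangle2 mulr_suml.
  by apply: eq_bigr => i _; rewrite mulr_suml.
rewrite Rintegral_sum//; last first.
  by move=> i; apply: integrable_real_sum => // j; exact: cos_integrable.
apply: eq_bigr => i _; rewrite Rintegral_sum//; last by move=> j; exact: cos_integrable.
by apply: eq_bigr => j _; rewrite stationary_cov spectral_cov.
Qed.

End spectral_covariance.

Section partial_sums.
Context {R : realType}.
Variables (X : random_field R (int * int)).
Hypotheses (gX : gaussian X) (zX : zero_mean X).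

Lemma partial_sumE gamma n (p : open_quadrant R) w :
  partial_sum X gamma n p w =
  \sum_(i <- rectangle (Num.truncn (n%:R * p.1%:num)) (Num.truncn (n%:R `^ gamma * p.2%:num)))
    X i w.
Proof. by rewrite sum_rectangle. Qed.

Lemma gaussian_partial_sum gamma n : gaussian (partial_sum X gamma n).
Proof.
move=> k p a.
pose r (j : 'I_k) := rectangle (Num.truncn (n%:R * (p j).1%:num))
  (Num.truncn (n%:R `^ gamma * (p j).2%:num)).
have := gaussian_sum_seq [seq (a j, i) | j <- index_enum 'I_k, i <- r j] gX.
congr (normal_rv _ _); apply/funext => w; rewrite big_allpairs_dep.
by apply: eq_bigr => j _; rewrite partial_sumE mulr_sumr.
Qed.

Lemma zero_mean_partial_sum gamma n : zero_mean (partial_sum X gamma n).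
Proof.
move=> p; have := mean0_sum_seq [seq (1, i) | i <- rectangle (Num.truncn (n%:R * p.1%:num))
  (Num.truncn (n%:R `^ gamma * p.2%:num))] gX zX.
congr (expectation _ _ = _); apply/funext => w; rewrite big_map partial_sumE.
by apply: eq_bigr => i _; rewrite mul1r.
Qed.

End partial_sums.

(** * Limits in law *)

Section law_determination.
Context {R : realType}.

(** Ensures that the extended distance between two row vectors is finite. *)
Lemma rowv_ball_fin k (x y : 'rV[R]_k) : exists2 r : R, 0 < r & ball x r y.
Proof.
have r0 : 0 < 1 + \sum_(j < k) `|x 0 j - y 0 j| by rewrite ltr_pwDl// sumr_ge0.
exists (1 + \sum_(j < k) `|x 0 j - y 0 j|) => //.
split => // i j; rewrite (ord1 i) /ball/= (bigD1 j)//= addrCA ltrDl.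
by rewrite ltr_pwDl// sumr_ge0.
Qed.

(** The function is the distance to the complement of [U], or the constant 1 when that complement is
    empty and the distance infinite. *)
Lemma open_continuous_positive k (U : set 'rV[R]_k) : open U ->
  exists f : 'rV[R]_k -> R, [/\ continuous f, forall v, 0 <= f v & forall v, U v <-> 0 < f v].
Proof.
move=> oU; have [UT|/set0P[a Ua]] := eqVneq (~` U) set0.
  exists (fun=> 1); split => //; first exact: cst_continuous.
  move=> v; split => // _; apply: contrapT => nU; have : (~` U) v by [].
  by rewrite UT.
have dfin v : edist_inf (~` U) v \is a fin_num.
  rewrite ge0_fin_numE ?edist_inf_ge0//; apply: (@le_lt_trans _ _ (edist (v, a))).
    by apply: ereal_inf_lbound; exists a.
  rewrite -ge0_fin_numE ?edist_ge0//; apply/edist_finP; exact: rowv_ball_fin.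
exists (fun v => fine (edist_inf (~` U) v)); split.
- move=> v; have := @edist_inf_continuous _ _ (~` U) v.
  by rewrite /continuous_at -[edist_inf _ v]fineK// => /fine_cvg.
- by move=> v; rewrite fine_ge0// edist_inf_ge0.
move=> v; split => [Uv|]; last first.
  by apply: contraPP => nU; rewrite edist_inf0//= ltxx.
have /nbhs_ballP[e /= e0 eU] := open_nbhs_nbhs (conj oU Uv).
rewrite -lte_fin fineK// (@lt_le_trans _ _ e%:E)// /edist_inf.
apply: le_ereal_inf_tmp => _ [b nUb <-]; rewrite leNgt; apply/negP => /edist_lt_ball/= bb.
exact/nUb/eU.
Qed.

(** With [f] continuous and positive exactly on [U], the bounded continuous functions min (1, n f)
    increase to the indicator of [U]. The laws thus agree on open sets, which are stable under
    intersection and generate the Borel sets. *)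
Lemma same_fdd_of_expectation (I : Type) (Y Z : random_field R I) :
  (forall k (p : 'I_k -> I) (phi : 'rV[R]_k -> R), continuous phi -> bounded_fun phi ->
     'E_(rf_prob Y)[phi \o @rf_vector R I Y k p]%E =
     'E_(rf_prob Z)[phi \o @rf_vector R I Z k p]%E) ->
  same_fdd Y Z.
Proof.
move=> YZ k p.
pose G := [set U : set 'rV[R]_k | open U].
have mvec (W : random_field R I) : measurable_fun [set: rf_space W]
    (@rf_vector R I W k p : rf_space W -> g_sigma_algebraType G).
  apply: (@measurability _ _ _ (g_sigma_algebraType G) _ _ G) => // _ [U oU <-]; rewrite setTI; exact: open_preimage_rf_vector.
have cvgE (W : random_field R I) (U : set 'rV[R]_k) (f : 'rV[R]_k -> R) :
   open U -> continuous f -> (forall v, 0 <= f v) -> (forall v, U v <-> 0 < f v) ->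
   (\int[rf_prob W]_w (Num.min 1 (n%:R * f (rf_vector p w)))%:E @[n --> \oo] -->
     rf_prob W (@rf_vector R I W k p @^-1` U))%E.
  move=> oU cf f0 fU; have mU := @open_preimage_rf_vector R I W k p U oU.
  rewrite -[_ @^-1` U]setIT -integral_indic//.
  rewrite [X in _ --> X](_ : _ = (\int[rf_prob W]_w
      limn (fun n => (Num.min 1 (n%:R * f (rf_vector p w)))%:E))%E).
    apply: cvg_monotone_convergence => //.
    - move=> n; apply/measurable_EFinP; apply: measurable_minr => //.
      by apply: measurable_funM => //; exact: (measurable_continuous_rf_vector (Y := W) p cf).
    - by move=> n w _; rewrite lee_fin le_min ler01 mulr_ge0.
    - move=> w _ m n mn; rewrite lee_fin le_min ge_min lexx/= ge_min.
      by rewrite ler_wpM2r ?ler_nat// orbT.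
  apply: eq_integral => w _; apply/esym/cvg_lim => //; apply: cvg_EFin.
    by apply: nearW.
  rewrite /= indicE; have [fw|fw] := ltP 0 (f (rf_vector p w)).
    rewrite mem_set; last exact/fU.
    apply: cvg_near_cst; near=> n; rewrite /=; apply/min_idPl.
    rewrite -ler_pdivrMr//; near: n; exact: nbhs_infty_ger.
  rewrite memNset => [|/= /fU]; last by rewrite ltNge fw.
  have -> : f (rf_vector p w) = 0 by apply/eqP; rewrite eq_le fw f0.
  by apply: cvg_near_cst; apply: nearW => n; rewrite /= mulr0 min_r ?ler01.
have mG : (measurable : set (set (g_sigma_algebraType G))) = <<s G >> by [].
have GI : setI_closed G by move=> A B; exact: openI.
move=> A sA.
pose law W := measure_function_pushforward__canonical__measure_function_Measure
  (rf_prob W) (mvec W).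
apply: (@measure_unique _ R (g_sigma_algebraType G) G (fun=> setT) mG GI _ _
  (law Y) (law Z) _ _ A sA).
- by move=> _; exact: openT.
- by rewrite bigcup_const.
- move=> U oU; have [f [cf f0 fU]] := open_continuous_positive oU.
  rewrite /law /= /pushforward -(cvg_lim _ (cvgE Y _ _ oU cf f0 fU))// -(cvg_lim _ (cvgE Z _ _ oU cf f0 fU))//.
  apply: congr_lim; apply/funext => n.
  have := YZ k p (fun v => Num.min 1 (n%:R * f v)); rewrite unlock; apply.
    move=> v; apply: (@continuous_min R _ (fun=> 1) (fun v => n%:R * f v) v).
      exact: cst_continuous.
    by apply: (@continuousM _ _ (fun=> n%:R) f v); [exact: cst_continuous|exact: cf].
  exists 1; split => // M M1 v _ /=.
  by rewrite ger0_norm ?le_min ?ler01 ?mulr_ge0// ge_min ltW.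
- by move=> _; rewrite /law /= /pushforward preimage_setT probability_setT ltry.
Unshelve. all: by end_near. Qed.

End law_determination.

(** * From the factor g to a relative error *)

Section spectral_perturbation.
Context {R : realType}.
Local Notation T := (@torus R).
Variables d1 d2 : R.
Hypotheses (hd1 : 0 < d1 < 2^-1) (hd2 : 0 < d2 < 2^-1).

Lemma weight2V (z : R * R) :
  weight2 d1 d2 z = (`|z.1| `^ (2 * d1) * `|z.2| `^ (2 * d2))^-1.
Proof. by rewrite /weight2 /weight !powRN invfM. Qed.

Lemma asymp_weight2_density (g : R * R -> R) :
  [bounded g z | z in T] -> g z @[z --> ((0 : R), (0 : R))^'] --> (1 : R) ->
  asymp_weight2 d1 d2 (fun z => g z / (`|z.1| `^ (2 * d1) * `|z.2| `^ (2 * d2))).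
Proof.
move=> [M [_ hM]] g1; pose K := `|M| + 1.
have gK z : T z -> `|g z| <= K by apply: hM; rewrite (le_lt_trans (ler_norm _))// ltrDl.
have K0 : 0 <= K by rewrite addr_ge0.
exists (K + 1); first by rewrite addr_ge0.
move=> eps eps0.
move/cvgrPdist_le : g1 => /(_ _ eps0); rewrite near_withinE => /nbhs_ballP[delta /= delta0 hdelta].
exists delta => // z Tz; rewrite -weight2V.
rewrite -[X in _ - X]mul1r -mulrBl normrM (ger0_norm (weight2_ge0 _ _ _)).
(* The limit of [g] says nothing about its value at the origin, but the weight is 0 there, since 0
   to a nonzero power is 0. *)
have [->|z0] := eqVneq z (0, 0).
  suff -> : weight2 d1 d2 (0, 0) = 0 by rewrite !mulr0.
  rewrite /weight2 /weight /= normr0 powR0 ?mul0r// oppr_eq0 mulf_neq0//.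
  by case/andP : hd1 => h _; rewrite gt_eqF.
rewrite ler_wpM2r ?weight2_ge0//.
have gz : `|g z - 1| <= K + 1 by rewrite (le_trans (ler_normB _ _))// normr1 lerD2r gK.
have [h1|h1] := leP delta `|z.1|.
  rewrite (le_trans gz)// -[leLHS]add0r; apply: lerD; first exact: ltW.
  by rewrite ler_peMr ?addr_ge0// lerDl.
have [h2|h2] := leP delta `|z.2|.
  by rewrite (le_trans gz)// add0r mulr1 -[leLHS]add0r lerD// ltW.
rewrite addr0 mulr0 addr0 distrC; apply: hdelta => //.
by split; rewrite /ball/= sub0r normrN.
Qed.

End spectral_perturbation.

(** * Covariances and laws of normalized partial sums *)

Section normalized_partial_sums.
Context {R : realType}.

Lemma truncn_div_cvg (N : nat -> R) (x : R) : 0 <= x -> N n @[n --> \oo] --> +oo ->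
  (Num.truncn (N n * x))%:R / N n @[n --> \oo] --> x.
Proof.
move=> x0 Ny; have NV : (N n)^-1 @[n --> \oo] --> 0.
  by apply/gtr0_cvgV0 => //; move/cvgryPgt : Ny; apply.
apply: (@squeeze_cvgr _ _ _ _ (fun n => x - (N n)^-1) (fun=> x)); last exact: cvg_cst.
  near=> n; have N0 : 0 < N n by near: n; move/cvgryPgt : Ny; apply.
  have /andP[h1 h2] : (Num.truncn (N n * x))%:R <= N n * x < (Num.truncn (N n * x)).+1%:R.
    by apply: truncn_itv; rewrite mulr_ge0// ltW.
  rewrite ler_pdivrMr// [x * _]mulrC h1 andbT ler_pdivlMr// mulrBl mulVf ?gt_eqF//.
  by rewrite lerBlDr [x * _]mulrC natr1 ltW.
by rewrite -[X in _ --> X]subr0; apply: cvgB => //; exact: cvg_cst.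
Unshelve. all: by end_near. Qed.

Lemma natr_powR_cvgy (gamma : R) : 0 < gamma -> (n%:R : R) `^ gamma @[n --> \oo] --> +oo.
Proof.
move=> g0; apply/cvgryPge => A; near=> n.
have A0 : 0 <= Num.max A 0 by rewrite le_max lexx orbT.
apply: (@le_trans _ _ (Num.max A 0)); first by rewrite le_max lexx.
have -> : Num.max A 0 = (Num.max A 0 `^ gamma^-1) `^ gamma.
  by rewrite -powRrM mulVf ?gt_eqF// powRr1.
apply: ge0_ler_powR; rewrite ?nnegrE ?powR_ge0 ?ler0n//; first exact: ltW.
near: n; exact: nbhs_infty_ger.
Unshelve. all: by end_near. Qed.

(** The origin of H(gamma): its square normalization is the product of those of the two Fejer
    masses, at scales n and n^gamma. At [n = 0] both sides are 0 because all the exponents are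
    nonzero. *)
Lemma powR_norm_sqr (d1 d2 gamma : R) n : 0 < d1 -> 0 < d2 -> 0 < gamma ->
  (n%:R `^ (- ((1 + gamma) / 2 + d1 + d2 * gamma))) ^+ 2 =
  n%:R `^ (- (1 + 2 * d1)) * (n%:R `^ gamma) `^ (- (1 + 2 * d2)) :> R.
Proof.
move=> d10 d20 g0; have gd : 0 < d2 * gamma by exact: mulr_gt0.
case: n => [|n].
  by rewrite !powR0 ?expr0n/= ?mul0r// ?oppr_eq0 gt_eqF//; lra.
rewrite -powR_mulrn ?powR_ge0// -!powRrM -powRD; last by rewrite pnatr_eq0 implybT.
by congr (_ `^ _); field.
Qed.

Variables d1 d2 : R.
Hypotheses (hd1 : 0 < d1 < 2^-1) (hd2 : 0 < d2 < 2^-1).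

Definition sheet_cov (p q : open_quadrant R) : R :=
  let x := p.1%:num in let y := p.2%:num in let x' := q.1%:num in let y' := q.2%:num in
  (2^-1 * (x `^ (1 + 2 * d1) + x' `^ (1 + 2 * d1) - `|x - x'| `^ (1 + 2 * d1)) *
     fine (kappa_sq d1)) *
  (2^-1 * (y `^ (1 + 2 * d2) + y' `^ (1 + 2 * d2) - `|y - y'| `^ (1 + 2 * d2)) *
     fine (kappa_sq d2)).

Lemma sheet_cov_gt0 p : 0 < sheet_cov p p.
Proof.
have k0 (d : R) : 0 < d < 2^-1 -> 0 < fine (kappa_sq d).
  by move=> /[dup] d01 /kappa_gt0 k; rewrite kappa_sqK//= exprn_gt0.
have e (d : R) : 0 < d < 2^-1 -> 1 + 2 * d != 0 by move=> /andP[d0 _]; rewrite gt_eqF//; lra.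
rewrite /sheet_cov !subrr normr0 !powR0 ?e// !subr0.
by rewrite mulr_gt0// mulr_gt0 ?k0// mulr_gt0// addr_gt0// powR_gt0.
Qed.

Lemma sheet_covE (B : random_field R (closed_quadrant R)) p q :
  fractional_brownian_sheet (d1 + 2^-1) (d2 + 2^-1) B ->
  rf_cov (rf_scale (kappa d1 * kappa d2) (rf_reindex (@quadrant_incl R) B)) p q = sheet_cov p q.
Proof.
move=> [gB zB covB]; rewrite rf_cov_scale; last 2 first.
- exact: gaussian_reindex.
- exact: zero_mean_reindex.
have -> : rf_cov (rf_reindex (@quadrant_incl R) B) p q =
    rf_cov B (quadrant_incl p) (quadrant_incl q) by [].
have := covB (quadrant_incl p) (quadrant_incl q); rewrite rf_covE// => -[->] /=.
rewrite /sheet_cov !kappa_sqK//=.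
have -> : 2 * (d1 + 2^-1) = 1 + 2 * d1 by field.
have -> : 2 * (d2 + 2^-1) = 1 + 2 * d2 by field.
by field.
Qed.

Variables (X : random_field R (int * int)) (f : R * R -> R).
Hypotheses (sX : stationary X) (gX : gaussian X) (zX : zero_mean X).
Hypotheses (Xf : spectral_density X f) (fw : asymp_weight2 d1 d2 f).

Lemma partial_sum_cov_cvg (gamma : R) p q : 0 < gamma ->
  rf_cov (rf_scale (n%:R `^ (- ((1 + gamma) / 2 + d1 + d2 * gamma))) (partial_sum X gamma n)) p q
    @[n --> \oo] --> sheet_cov p q.
Proof.
move=> g0; have [/andP[d10 _] /andP[d20 _]] := (hd1, hd2).
have [_ _ fi _] := Xf.
have N1y : (n%:R : R) @[n --> \oo] --> +oo by exact: cvgr_idn.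
have N2y : (n%:R : R) `^ gamma @[n --> \oo] --> +oo by exact: natr_powR_cvgy.
have posnum_ge0 (r : {posnum R}) : 0 <= r%:num by [].
have := kernel_cvg hd1 hd2 fi fw (fun n => ler0n R n) N1y (fun n => powR_ge0 _ _) N2y
  (truncn_div_cvg (posnum_ge0 p.1) N1y) (truncn_div_cvg (posnum_ge0 q.1) N1y)
  (truncn_div_cvg (posnum_ge0 p.2) N2y) (truncn_div_cvg (posnum_ge0 q.2) N2y).
rewrite (_ : (fun n => _) = (fun n => rf_cov (rf_scale
  (n%:R `^ (- ((1 + gamma) / 2 + d1 + d2 * gamma))) (partial_sum X gamma n)) p q))//.
apply/funext => n.
rewrite rf_cov_scale; last 2 first.
- exact: gaussian_partial_sum.
- exact: zero_mean_partial_sum.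
rewrite powR_norm_sqr//; congr (_ * _); rewrite -(cov_rectangle sX gX zX Xf) /rf_cov.
by apply: eq_Rintegral => w _; rewrite !partial_sumE.
Qed.

Lemma partial_sum_fdd_cvg (gamma : R) (B : random_field R (closed_quadrant R)) : 0 < gamma ->
  fractional_brownian_sheet (d1 + 2^-1) (d2 + 2^-1) B ->
  fdd_cvg (fun n => rf_scale (n%:R `^ (- ((1 + gamma) / 2 + d1 + d2 * gamma)))
    (partial_sum X gamma n)) (rf_scale (kappa d1 * kappa d2) (rf_reindex (@quadrant_incl R) B)).
Proof.
move=> g0 hB; have [gB zB _] := hB => k p phi cphi bphi.
have gB' := gaussian_reindex (@quadrant_incl R) gB.
have zB' := zero_mean_reindex (@quadrant_incl R) zB.
rewrite expectation_continuous_rf_vector//.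
under eq_fun do rewrite expectation_continuous_rf_vector//.
apply: cvg_EFin; first exact: nearW.
apply/subr_cvg0.
(* The limiting sheet itself serves as the second sequence, constant in [n]. *)
apply: (gaussian_fdd_asymptotics (C := sheet_cov)
  (W' := fun=> rf_scale (kappa d1 * kappa d2) (rf_reindex (@quadrant_incl R) B))) => //.
- by move=> n; apply/gaussian_scale/gaussian_partial_sum.
- by move=> n; apply: zero_mean_scale; [exact: gaussian_partial_sum|exact: zero_mean_partial_sum].
- by move=> i j; exact: partial_sum_cov_cvg.
- by move=> n; exact: gaussian_scale.
- by move=> n; exact: zero_mean_scale.
- by move=> i j; under eq_fun do rewrite sheet_covE//; exact: cvg_cst.
Qed.

End normalized_partial_sums.

(** * Limits in law of Gaussian sequences *)

Section gaussian_limits.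
Context {R : realType} {I : Type}.
Implicit Types Y Z V : random_field R I.
Implicit Types U : nat -> random_field R I.

Lemma rf_vector_scale a Y k (p : 'I_k -> I) w :
  @rf_vector R I (rf_scale a Y) k p w = a *: @rf_vector R I Y k p w.
Proof. by apply/rowP => j; rewrite !mxE. Qed.

Lemma continuous_comp_scale a k (phi : 'rV[R]_k -> R) :
  continuous phi -> continuous (fun v : 'rV[R]_k => phi (a *: v)).
Proof.
move=> cphi v; apply: (@continuous_comp _ _ _ (fun v : 'rV[R]_k => a *: v) phi); last exact: cphi.
exact: scaler_continuous.
Qed.

Lemma bounded_comp_scale a k (phi : 'rV[R]_k -> R) :
  bounded_fun phi -> bounded_fun (fun v : 'rV[R]_k => phi (a *: v)).
Proof. by move=> [M [Mr hM]]; exists M; split => // x xM v _; exact: (hM x xM). Qed.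

Lemma comp_rf_vector_scale a Y k (p : 'I_k -> I) (phi : 'rV[R]_k -> R) :
  phi \o @rf_vector R I (rf_scale a Y) k p =
  (fun v : 'rV[R]_k => phi (a *: v)) \o @rf_vector R I Y k p.
Proof. by apply/funext => w; rewrite /= rf_vector_scale. Qed.

Lemma fdd_cvg_scale a U V : fdd_cvg U V -> fdd_cvg (fun n => rf_scale a (U n)) (rf_scale a V).
Proof.
move=> UV k p phi cphi bphi.
rewrite comp_rf_vector_scale; under eq_fun do rewrite comp_rf_vector_scale.
by apply: UV; [exact: continuous_comp_scale|exact: bounded_comp_scale].
Qed.

Lemma same_fdd_sym Y Z : same_fdd Y Z -> same_fdd Z Y.
Proof. by move=> YZ k p A sA; rewrite YZ. Qed.

Lemma same_fdd_trans Y Z V : same_fdd Y Z -> same_fdd Z V -> same_fdd Y V.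
Proof. by move=> YZ ZV k p A sA; rewrite YZ// ZV. Qed.

Lemma same_fdd_scale a Y Z : same_fdd Y Z -> same_fdd (rf_scale a Y) (rf_scale a Z).
Proof.
move=> YZ; apply: same_fdd_of_expectation => k p phi cphi bphi.
rewrite !comp_rf_vector_scale.
exact: (same_fdd_expectation p YZ (@continuous_comp_scale a _ _ cphi)).
Qed.

(** [V] and [V'] are arbitrary fields: their expectations of bounded continuous functions agree by
    [gaussian_fdd_asymptotics], and these determine the laws. *)
Lemma gaussian_fdd_limit_unique U U' (C : I -> I -> R) V V' :
  (forall n, gaussian (U n)) -> (forall n, zero_mean (U n)) ->
  (forall i j, rf_cov (U n) i j @[n --> \oo] --> C i j) ->
  (forall n, gaussian (U' n)) -> (forall n, zero_mean (U' n)) ->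
  (forall i j, rf_cov (U' n) i j @[n --> \oo] --> C i j) ->
  fdd_cvg U V -> fdd_cvg U' V' -> same_fdd V V'.
Proof.
move=> gU zU cU gU' zU' cU' UV UV'; apply: same_fdd_of_expectation => k p phi cphi bphi.
have := UV k p phi cphi bphi; have := UV' k p phi cphi bphi.
rewrite !expectation_continuous_rf_vector//.
under eq_fun do rewrite expectation_continuous_rf_vector//.
move=> /fine_cvg/= c'.
under eq_fun do rewrite expectation_continuous_rf_vector//.
move=> /fine_cvg/= c; congr EFin; apply/eqP; rewrite -subr_eq0; apply/eqP.
have := gaussian_fdd_asymptotics gU zU cU gU' zU' cU' p cphi bphi.
move/(cvg_lim (@Rhausdorff R)) => <-; apply/esym/(cvg_lim (@Rhausdorff R)).
exact: (cvgB c c').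
Qed.

Lemma gaussian_expect_exp_sqr Y i : gaussian Y -> zero_mean Y ->
  \int[rf_prob Y]_w expR (- (Y i w ^+ 2 / 2)) = (Num.sqrt (1 + rf_cov Y i i / gauss_var))^-1.
Proof.
move=> gY zY; pose h (x : R) := expR (- (x ^+ 2 / 2)).
have mh : measurable_fun [set: R] h.
  by apply: measurableT_comp => //; apply: measurableT_comp => //; apply: measurable_funM.
have bh : bounded_fun h.
  exists 1; split => // M M1 x _ /=; rewrite ger0_norm ?expR_ge0// (le_trans _ (ltW M1))//.
  by rewrite expR_le1 oppr_le0 divr_ge0 ?sqr_ge0.
have v0 : 0 <= rf_cov Y i i by apply: Rintegral_ge0 => w _; rewrite -expr2 sqr_ge0.
have c0 : 0 <= rf_cov Y i i / gauss_var by rewrite divr_ge0// ltW// gauss_var_gt0.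
have := centered_normal_expectation (@rf_measurable _ _ Y i) (gaussian_component gY i) (zY i)
  (rf_covE gY zY i i) mh bh.
rewrite unlock /Rintegral => ->/=.
have := @integral_gauss_exp_sqr R (rf_cov Y i i / gauss_var).
rewrite /gauss_expect /Rintegral /h.
under eq_integral do rewrite exprMn sqr_sqrtr//.
by move=> -> //; lra.
Qed.

Lemma Rintegral_le0_ae d (S : measurableType d) (P : probability S R) (a : S -> R) :
  P.-integrable [set: S] (EFin \o a) -> (forall w, 0 <= a w) -> \int[P]_w a w <= 0 ->
  {ae P, forall w, a w = 0}.
Proof.
move=> ia a0 le0.
have ma : measurable_fun [set: S] (EFin \o a) by exact: measurable_int ia.
have /(ae_eq_integral_abs P measurableT ma) : (\int[P]_w `|(EFin \o a) w| = 0)%E.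
  under eq_integral do rewrite gee0_abs ?lee_fin//.
  rewrite -(fineK (integrable_fin_num measurableT ia)); congr EFin; apply/eqP.
  by rewrite eq_le le0 Rintegral_ge0.
by apply: filterS => w /(_ Logic.I)[].
Qed.

(** The lower bound will keep the limiting variance finite, the upper bound will keep it
    positive. *)
Lemma exp_sqr_expectation_bounds V i :
  let l := \int[rf_prob V]_w expR (- (V i w ^+ 2 / 2)) in
  0 < l /\ (~ {ae rf_prob V, forall w, V i w = 0} -> l < 1).
Proof.
pose h w := expR (- (V i w ^+ 2 / 2)).
have h1 w : h w <= 1 by rewrite expR_le1 oppr_le0 divr_ge0 ?sqr_ge0.
have mV : measurable_fun [set: rf_space V] (V i) by exact: rf_measurable.
have ih : (rf_prob V).-integrable setT (EFin \o h).
  apply: (@integrable_prob_bounded _ _ _ _ _ 1); last by move=> w; rewrite ger0_norm ?expR_ge0.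
  apply: measurableT_comp => //; apply: measurableT_comp => //; apply: measurable_funM => //.
  exact: measurable_funX.
split.
  rewrite ltNge; apply/negP => /(Rintegral_le0_ae ih (fun w => expR_ge0 _))[N [mN N0 NT]].
  have : (rf_prob V N >= rf_prob V setT)%E.
    apply: le_measure; rewrite ?inE// => w _; apply: NT => /= /eqP.
    by rewrite gt_eqF ?expR_gt0.
  by rewrite N0 probability_setT lee_fin ler10.
move=> nV; rewrite ltNge; apply/negP => l1; apply: nV.
have i1 : (rf_prob V).-integrable setT (EFin \o (fun=> 1 : R)).
  exact: finite_measure_integrable_cst.
have : \int[rf_prob V]_w (1 - h w) <= 0.
  rewrite RintegralB//.
  have -> : \int[rf_prob V]_w (1 : R) = 1 by rewrite /Rintegral integral_prob_cst.
  by rewrite subr_le0.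
move/Rintegral_le0_ae => /(_ (integrable_realB measurableT i1 ih)) /=.
have b0 w : 0 <= 1 - h w by rewrite subr_ge0.
move=> /(_ b0); apply: filterS => w hw; have [//|V0] := eqVneq (V i w) 0.
have : h w < 1 by rewrite expR_lt1 oppr_lt0 divr_gt0// exprn_even_gt0.
by lra.
Qed.

(** One coordinate on which [V] does not vanish almost everywhere suffices, since the same factor
    [b n] multiplies all the covariances. *)
Lemma gaussian_scale_limit U (b : nat -> R) (c : nat -> I -> I -> R) (C : I -> I -> R) V :
  (forall n, gaussian (U n)) -> (forall n, zero_mean (U n)) ->
  (\forall n \near \oo, forall i j, rf_cov (U n) i j = b n * c n i j) ->
  (forall i j, c n i j @[n --> \oo] --> C i j) -> (forall i, 0 < C i i) ->
  fdd_cvg U V -> nontrivial V ->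
  exists2 l : R, 0 < l & b n @[n --> \oo] --> l.
Proof.
move=> gU zU covU cC C0 UV ntV.
have [i ntVi] : exists i, ~ {ae rf_prob V, forall w, V i w = 0} by exact/existsNP.
have [l0 /(_ ntVi) l1] := exp_sqr_expectation_bounds V i.
set l := \int[_]_w _ in l0 l1.
have gv0 := @gauss_var_gt0 R.
have v0 n : 0 <= rf_cov (U n) i i by apply: Rintegral_ge0 => w _; rewrite -expr2 sqr_ge0.
have el : (Num.sqrt (1 + rf_cov (U n) i i / gauss_var))^-1 @[n --> \oo] --> l.
  pose phi (v : 'rV[R]_1) := expR (- (v 0 0 ^+ 2 / 2)).
  have cphi : continuous phi.
    move=> v; apply: (@continuous_comp _ _ _ (fun v : 'rV[R]_1 => v 0 0)
      (fun x => expR (- (x ^+ 2 / 2)))); first exact: coord_continuous.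
    by auto_continuous.
  have bphi : bounded_fun phi.
    exists 1; split => // M M1 x _ /=; rewrite ger0_norm ?expR_ge0// (le_trans _ (ltW M1))//.
    by rewrite expR_le1 oppr_le0 divr_ge0 ?sqr_ge0.
  have := UV 1%N (fun=> i) phi cphi bphi.
  under eq_fun do rewrite expectation_continuous_rf_vector//.
  rewrite expectation_continuous_rf_vector// => /fine_cvg/=.
  have E Y : \int[rf_prob Y]_w phi (rf_vector (fun=> i) w) = \int[rf_prob Y]_w expR (- (Y i w ^+ 2 / 2)).
    by apply: eq_Rintegral => w _; rewrite /phi mxE.
  rewrite E -/l /comp/=; under eq_fun do rewrite E gaussian_expect_exp_sqr//.
  by [].
(* The formula of [gaussian_expect_exp_sqr] is solved for the variance; continuity of the solution
   uses [0 < l]. *)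
have vl : rf_cov (U n) i i @[n --> \oo] --> gauss_var * ((l ^+ 2)^-1 - 1).
  rewrite (_ : (fun n => _) = fun n => gauss_var *
    ((((Num.sqrt (1 + rf_cov (U n) i i / gauss_var))^-1) ^+ 2)^-1 - 1)).
    apply: cvgM; first exact: cvg_cst.
    apply: cvgB; last exact: cvg_cst.
    apply: cvgV; first by rewrite expf_neq0// gt_eqF.
    by rewrite !expr2; under eq_fun do rewrite expr2; exact: cvgM.
  apply/funext => n; rewrite exprVn invrK sqr_sqrtr; last first.
    by rewrite addr_ge0// divr_ge0// ltW.
  by field; rewrite gt_eqF.
exists (gauss_var * ((l ^+ 2)^-1 - 1) / C i i).
  rewrite divr_gt0// mulr_gt0// subr_gt0 invf_gt1 ?exprn_gt0//.
  by rewrite expr_lt1// ltW.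
have cV : (c n i i)^-1 @[n --> \oo] --> (C i i)^-1 by apply: cvgV => //; rewrite gt_eqF.
have : rf_cov (U n) i i * (c n i i)^-1 @[n --> \oo] -->
  gauss_var * ((l ^+ 2)^-1 - 1) / C i i by exact: cvgM.
apply: cvg_trans; apply: near_eq_cvg; near=> n.
have cn0 : 0 < c n i i by near: n; exact: (cvgr_gt _ (cC i i)).
have -> : rf_cov (U n) i i = b n * c n i i by near: n; apply: filterS covU => n; apply.
by rewrite /= mulfK// gt_eqF.
Unshelve. all: by end_near. Qed.

End gaussian_limits.

(** * Absence of scaling transition *)

Section no_scaling_transition.
Context {R : realType}.
Variables d1 d2 : R.
Hypotheses (hd1 : 0 < d1 < 2^-1) (hd2 : 0 < d2 < 2^-1).
Variables (X : random_field R (int * int)) (f : R * R -> R).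
Hypotheses (sX : stationary X) (gX : gaussian X) (zX : zero_mean X).
Hypotheses (Xf : spectral_density X f) (fw : asymp_weight2 d1 d2 f).

Lemma gaussian_normalized_sum (gamma : R) (a : nat -> R) n :
  gaussian (rf_scale (a n) (partial_sum X gamma n)).
Proof. exact/gaussian_scale/gaussian_partial_sum. Qed.

Lemma zero_mean_normalized_sum (gamma : R) (a : nat -> R) n :
  zero_mean (rf_scale (a n) (partial_sum X gamma n)).
Proof. by apply: zero_mean_scale; [exact: gaussian_partial_sum|exact: zero_mean_partial_sum]. Qed.

Lemma normalized_sum_cov_cvg (gamma : R) (a : nat -> R) V : 0 < gamma ->
  fdd_cvg (fun n => rf_scale (a n) (partial_sum X gamma n)) V -> nontrivial V ->
  exists2 l : R, 0 < l &
    forall i j, rf_cov (rf_scale (a n) (partial_sum X gamma n)) i j @[n --> \oo] -->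
      l * sheet_cov d1 d2 i j.
Proof.
move=> g0 UV ntV; pose H := (1 + gamma) / 2 + d1 + d2 * gamma.
pose b n := (a n / n%:R `^ (- H)) ^+ 2.
pose c n i j := rf_cov (rf_scale (n%:R `^ (- H)) (partial_sum X gamma n)) i j.
(* [b n] is the squared ratio of the given normalization to the natural one, whose power of [n] is
   nonzero once [n] is positive. *)
have covU : \forall n \near \oo, forall i j,
    rf_cov (rf_scale (a n) (partial_sum X gamma n)) i j = b n * c n i j.
  near=> n; have n0 : (0 < n)%N by near: n; exact: nbhs_infty_gt.
  move=> i j; rewrite /b /c !rf_cov_scale; try exact: gaussian_partial_sum;
    try exact: zero_mean_partial_sum.
  have p0 : n%:R `^ (- H) != 0 by rewrite gt_eqF// powR_gt0// ltr0n.
  by field.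
have cC i j : c n i j @[n --> \oo] --> sheet_cov d1 d2 i j.
  exact: (partial_sum_cov_cvg hd1 hd2 sX gX zX Xf fw g0).
have [l l0 bl] := gaussian_scale_limit (gaussian_normalized_sum gamma a)
  (zero_mean_normalized_sum gamma a) covU cC (sheet_cov_gt0 hd1 hd2) UV ntV.
exists l => // i j.
have : b n * c n i j @[n --> \oo] --> l * sheet_cov d1 d2 i j by exact: cvgM.
by apply: cvg_trans; apply: near_eq_cvg; near=> n; apply/esym; near: n; apply: filterS covU => n; apply.
Unshelve. all: by end_near. Qed.

Theorem no_scaling_transition : ~ exhibits_scaling_transition X.
Proof.
move=> [_ [A [V [hV [g0 [Vp [Vm [g00 hp hm noa]]]]]]]].
have gp : 0 < g0 + 1 by rewrite addr_gt0.
have gm : 0 < g0 / 2 by rewrite divr_gt0.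
have [_ ntp Up] := hV _ gp; have [_ ntm Um] := hV _ gm.
have [l l0 cl] := normalized_sum_cov_cvg gp Up ntp.
have [l' l'0 cl'] := normalized_sum_cov_cvg gm Um ntm.
(* Both limit covariances are multiples of the same [sheet_cov], by [l] above the threshold and by
   [l'] below it; scaling by [a] makes them equal. *)
pose a := Num.sqrt (l / l').
have a0 : 0 < a by rewrite sqrtr_gt0 divr_gt0.
have hp1 : same_fdd (V (g0 + 1)) Vp by apply: hp; rewrite ltrDl.
apply: (noa a a0); apply: (same_fdd_trans (same_fdd_sym hp1)).
have hm2 : same_fdd (V (g0 / 2)) Vm by apply: hm; rewrite gm ltr_pdivrMr// ltr_pMr// ltr1n.
apply: (same_fdd_trans (Z := rf_scale a (V (g0 / 2)))); last exact: same_fdd_scale.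
have Uam := fdd_cvg_scale (a := a) Um.
have gU n := gaussian_normalized_sum (g0 / 2) (fun n => (A (g0 / 2) n)^-1) n.
have zU n := zero_mean_normalized_sum (g0 / 2) (fun n => (A (g0 / 2) n)^-1) n.
apply: (gaussian_fdd_limit_unique _ _ cl _ _ _ Up Uam).
- exact: gaussian_normalized_sum.
- exact: zero_mean_normalized_sum.
- by move=> n; exact: gaussian_scale.
- by move=> n; exact: zero_mean_scale.
move=> i j; have -> : l * sheet_cov d1 d2 i j = a ^+ 2 * (l' * sheet_cov d1 d2 i j).
  by rewrite sqr_sqrtr ?divr_ge0 ?ltW//; field; rewrite gt_eqF.
under eq_fun do rewrite rf_cov_scale//.
by apply: cvgM => //; exact: cvg_cst.
Qed.

End no_scaling_transition.

Theorem proposition3p2 (R : realType) (d1 d2 : R)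
    (X : random_field R (int * int)) (g : R * R -> R) :
  0 < d1 < 2^-1 -> 0 < d2 < 2^-1 ->
  stationary X -> gaussian X -> zero_mean X ->
  (forall z, torus z -> 0 <= g z) ->
  [bounded g z | z in @torus R] ->
  g z @[z --> ((0 : R), (0 : R))^'] --> (1 : R) ->
  spectral_density X
    (fun z => g z / (`|z.1| `^ (2 * d1) * `|z.2| `^ (2 * d2))) ->
  (forall d : R, d = d1 \/ d = d2 ->
     0 < kappa d /\
     kappa_sq d = (pi / ((d + 2^-1) * Gamma (2 * d + 1) * cos (pi * d)))%:E) /\
  (forall gamma : R, 0 < gamma ->
   let H := (1 + gamma) / 2 + d1 + d2 * gamma in
   forall B : random_field R (closed_quadrant R),
     fractional_brownian_sheet (d1 + 2^-1) (d2 + 2^-1) B ->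
     fdd_cvg (fun n => rf_scale (n%:R `^ (- H)) (partial_sum X gamma n))
             (rf_scale (kappa d1 * kappa d2)
                       (rf_reindex (@quadrant_incl R) B))) /\
  ~ exhibits_scaling_transition X.
Proof.
move=> hd1 hd2 sX gX zX g0 gb g1 Xf; have fw := asymp_weight2_density d2 hd1 gb g1.
split; last split.
- move=> d hd; have d01 : 0 < d < 2^-1 by case: hd => ->.
  by split; [exact: kappa_gt0|have [] := kappa_sq_value d01].
- by move=> gamma gamma0 H B hB; exact: (partial_sum_fdd_cvg hd1 hd2 sX gX zX Xf fw).
- exact: (no_scaling_transition hd1 hd2 sX gX zX Xf fw).
Qed.
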